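(* There is an algorithm that, given any finite family $\mathcal B$ of finite sets, finds a minimal well-graded extension of $\mathcal B$ in time $O(nm\ell+n^3m)$, where $n$ is the number of sets in $\mathcal B$, $\ell$ is the size of the largest set in $\mathcal B$, and $m$ is the sum of the cardinalities of the sets in $\mathcal B$. (The extension $\mathcal F$ is output in the form of a family of sets $\mathcal B'\supseteq\mathcal B$ whose span is $\mathcal F$.)
   Context: All sets and families are finite. For finite sets $P,Q$ let $d(P,Q)=|P\bigtriangleup Q|$. A tight path in a family $\mathcal F$ between distinct $P,Q\in\mathcal F$ is a sequence $P_0=P,P_1,\ldots,P_n=Q$ of members of $\mathcal F$ with $d(P,Q)=n$ and $d(P_i,P_{i+1})=1$ for $0\le i\le n-1$. The family $\mathcal F$ is well-graded if there is a tight path in $\mathcal F$ between any two of its distinct sets. $\mathcal F$ is $\cup$-closed if $\cup\mathcal G\in\mathcal F$ for every nonempty $\mathcal G\subseteq\mathcal F$. The span of a family $\mathcal G$ is the family of all unions of nonempty subfamilies of $\mathcal G$. A minimal well-graded extension of a family $\mathcal B$ is a well-graded $\cup$-closed family $\mathcal F$ with $\mathcal B\subseteq\mathcal F$ such that no $\cup$-closed family $\mathcal F'$ with $\mathcal B\subseteq\mathcal F'\subsetneq\mathcal F$ is well-graded. Model of computation: standard random-access machine, with simple arithmetic steps and memory accesses in constant time. Each set element is an object of constant storage with which further information can be associated (e.g. elements are integers $0,1,2,\ldots$ usable as array indices); a set is given as a list of its elements and a family of sets as a list of such lists. Running times are worst case. *)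

(* Defs.v *)
From mathcomp Require Export all_boot finmap.

Set Implicit Arguments.
Unset Strict Implicit.
Unset Printing Implicit Defensive.

Section WellGraded.

Local Open Scope fset_scope.

Variable K : choiceType.
Implicit Types (P Q : {fset K}) (F B G : {fset {fset K}}).

Definition dist P Q : nat := #|` (P `\` Q) `|` (Q `\` P)|.

(* The path is P :: s, so its number of steps is size s. *)
Definition tight_path F P Q (s : seq {fset K}) : bool :=
  [&& all (mem F) (P :: s), last P s == Q, size s == dist P Q
    & path (fun X Y => dist X Y == 1) P s].

Definition well_graded F : Prop :=
  forall P Q, P \in F -> Q \in F -> P != Q -> exists s, tight_path F P Q s.

Definition union_closed F : Prop :=
  forall G, G `<=` F -> G != fset0 -> fcover G \in F.

Definition span G : {fset {fset K}} :=
  [fset fcover H | H in fpowerset G & H != fset0].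

Definition minimal_wg_extension B F : Prop :=
  [/\ well_graded F, union_closed F, B `<=` F &
      forall F' : {fset {fset K}},
        union_closed F' -> B `<=` F' -> F' `<` F -> ~ well_graded F'].

Definition max_card B : nat := \max_(X <- B) #|` X|.

Definition total_card B : nat := \sum_(X <- B) #|` X|.

End WellGraded.

(* A random-access machine with unit-cost instructions. The program refers to
   registers by number; memory is addressed through register contents. Neither
   multiplication nor division is provided. *)
Inductive instr : Type :=
  | Const of nat & nat        (* Const r c  :  r := c                      *)
  | Add of nat & nat & nat    (* Add r a b  :  r := a + b                  *)
  | Sub of nat & nat & nat    (* Sub r a b  :  r := a - b, truncated at 0  *)
  | Read of nat & nat         (* Read r a   :  r := mem[a]                 *)
  | Write of nat & nat        (* Write a r  :  mem[a] := r                 *)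
  | Jz of nat & nat.          (* Jz r l     :  if r = 0 goto l             *)

Definition program : Type := seq instr.

Record state : Type := State { pc : nat; regs : nat -> nat; cells : nat -> nat }.

Definition exec (i : instr) (s : state) : state :=
  let: State p r m := s in
  match i with
  | Const d c => State p.+1 [eta r with d |-> c] m
  | Add d a b => State p.+1 [eta r with d |-> r a + r b] m
  | Sub d a b => State p.+1 [eta r with d |-> r a - r b] m
  | Read d a => State p.+1 [eta r with d |-> m (r a)] m
  | Write a b => State p.+1 r [eta m with r a |-> r b]
  | Jz a l => State (if r a == 0 then l else p.+1) r m
  end.

(* The machine halts when the program counter leaves the program. *)
Definition step (prog : program) (s : state) : option state :=
  omap (exec^~ s) (onth prog (pc s)).

Definition halts_in (prog : program) (s : state) (t : nat) (s' : state) : Prop :=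
  iter t (obind (step prog)) (Some s) = Some s' /\ step prog s' = None.

(* A list of lists is stored in consecutive cells, each list being preceded by
   its length. *)
Definition encode (ss : seq (seq nat)) : seq nat :=
  size ss :: flatten [seq size s :: s | s <- ss].

Definition init_state (ss : seq (seq nat)) : state :=
  State 0 (fun=> 0) (nth 0 (encode ss)).

(* Register 0 holds the address of the output. *)
Definition outputs (s : state) (ss : seq (seq nat)) : Prop :=
  forall i, i < size (encode ss) -> cells s (regs s 0 + i) = nth 0 (encode ss) i.

(* ss lists the members of B, each once and in any order, and each member is
   given by its elements, each once and in any order. *)
Definition lists_family (ss : seq (seq nat)) (B : {fset {fset nat}}) : Prop :=
  let sets := [seq [fset x in s]%fset | s <- ss] in
  [/\ all uniq ss, uniq sets & B = [fset X in sets]%fset].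

(* Main.v *)
(* A union-closed family spanned by B' is well-graded as soon as it contains,
   for all P and Q in B, a chain from P to P `|` Q growing one element at a time.
   All these chains are grown simultaneously, by increasing size of their heads.
   A head H of the chain of (P, Q) moves to some z |` H, z in Q, that is already
   in the span, if there is one; otherwise the least element x of Q `\` H is
   used and x |` H becomes a new generator. Heads of equal size are visited by
   decreasing least missing element.

   The result is minimal because z |` H, with z in Q `\` H, never enters the span
   later on except for z = x. Indeed such a set would itself be a new generator
   z |` H = y |` H' with #|H'| = #|H|. If H' != H, it is the union of H and H',
   hence already in the span; if H' = H then y = z, and the order of the visits
   makes z at most x. So every smaller well-graded extension contains H and Q,
   must step from H towards Q, and can only do so through x |` H.

   To decide whether z |` H is in the span, it suffices to look, for each of the
   n^2 chains, at its first element missing from H. A pointer per pair (head,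
   chain) finds it; pointers never go back, so that they cost n^3 m in total,
   while each of the at most n m moves costs O(n^2 + l) otherwise. *)

From mathcomp Require Import zify.
Require Import Defs.

Set Implicit Arguments.
Unset Strict Implicit.
Unset Printing Implicit Defensive.

(** * Spans and well-graded families *)

Section Families.

Local Open Scope fset_scope.

Variable K : choiceType.
Implicit Types (P Q X Y : {fset K}) (F G : {fset {fset K}}).

(** The term $nm\ell$ also pays for the order of the visits. Elements are arbitrary integers, so
    they are ranked by first occurrence in the input, a later one counting as smaller. Heads are
    never sorted: on each of the $2\ell$ size levels the elements are scanned in order of occurrence
    and, for every set containing the current element, the n heads with that target are visited. A
    head counts its missing elements as they pass and moves when the last of them, the least, comes
    by. Moves apart, a visit takes constant time, so a scan costs $O(nm)$. Pointers survive the
    moves because heads and chains only grow. The machine cannot multiply, so squares and row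
    offsets are tabulated by repeated addition. Cells beyond the input are zero, so arrays need no
    clearing, and the row width may exceed every element at no cost in time. The program is written
    in a small structured language with a clock. Two potentials, the sum of all pointers and the sum
    of all chain lengths, reduce the amortised bounds to one inequality per command. *)

Lemma spanP G X : reflect
  ((exists2 g, g \in G & g `<=` X) /\
   forall x, x \in X -> exists g, [/\ g \in G, x \in g & g `<=` X])
  (X \in span G).
Proof.
rewrite /span; apply: (iffP (imfsetP _ _ _ _)) => [[H /=]|[[g0 g0G g0X] cov]].
  rewrite !inE fpowersetE => /andP[/fsubsetP sHG /fset0Pn[g gH]] ->.
  have sub g' : g' \in H -> g' `<=` fcover H.
    by move=> g'H; apply/fsubsetP => y yg; apply/bigfcupP; exists g'; rewrite ?g'H.
  split; first by exists g; [apply: sHG|apply: sub].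
  move=> x /bigfcupP[g' /andP[g'H _] xg']; exists g'; split=> //; [exact: sHG|exact: sub].
(* The largest subfamily that can do is taken; only for empty X does its non-emptiness need the
   separate clause. *)
exists [fset g in G | g `<=` X] => /=.
  rewrite !inE fpowersetE; apply/andP; split.
    by apply/fsubsetP => g; rewrite !inE /= => /andP[].
  by apply/fset0Pn; exists g0; rewrite !inE /= g0G.
apply/fsetP => x; apply/idP/bigfcupP => [/cov[g [gG xg gX]]|[g]].
  by exists g; rewrite // !inE /= gG gX.
by rewrite !inE /= andbT => /andP[_ /fsubsetP gX] /gX.
Qed.

Lemma sub_span G : G `<=` span G.
Proof.
apply/fsubsetP => g gG; apply/spanP; split; first by exists g.
by move=> x xg; exists g.
Qed.

Lemma span_sub G F : union_closed F -> G `<=` F -> span G `<=` F.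
Proof.
move=> ucF sGF; apply/fsubsetP => X; rewrite /span => /imfsetP[H /=].
by rewrite !inE fpowersetE => /andP[sHG H0] ->; apply: ucF => //; apply: fsubset_trans sGF.
Qed.

Lemma span_union_closed G : union_closed (span G).
Proof.
move=> H /fsubsetP sH /fset0Pn[Y YH]; apply/spanP; split.
  have /spanP[[g gG gY] _] := sH _ YH; exists g => //.
  apply: fsubset_trans gY _; apply/fsubsetP => x xY.
  by apply/bigfcupP; exists Y; rewrite ?YH.
move=> x /bigfcupP[Z /andP[ZH _] xZ].
have /spanP[_ /(_ _ xZ) [g [gG xg gZ]]] := sH _ ZH; exists g; split=> //.
apply: fsubset_trans gZ _; apply/fsubsetP => y yZ.
by apply/bigfcupP; exists Z; rewrite ?ZH.
Qed.

Lemma union_closedU F X Y : union_closed F -> X \in F -> Y \in F -> X `|` Y \in F.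
Proof.
move=> ucF XF YF; have -> : X `|` Y = fcover [fset X; Y].
  apply/fsetP => x; rewrite inE; apply/orP/bigfcupP => [[xX|xY]|[Z]].
  - by exists X; rewrite // !inE eqxx.
  - by exists Y; rewrite // !inE eqxx orbT.
  - by rewrite !inE andbT => /orP[]/eqP->; [left|right].
apply: ucF; last by apply/fset0Pn; exists X; rewrite !inE eqxx.
by apply/fsubsetP => Z; rewrite !inE => /orP[]/eqP->.
Qed.

Lemma in_dist x P Q : (x \in (P `\` Q) `|` (Q `\` P)) = (x \in P) (+) (x \in Q).
Proof. by rewrite !inE; case: (x \in P) (x \in Q) => [] []. Qed.

Lemma dist_sym P Q : dist P Q = dist Q P.
Proof. by rewrite /dist fsetUC. Qed.

Lemma dist_triangle P Q X : dist P X <= dist P Q + dist Q X.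
Proof.
rewrite /dist; apply: leq_trans (leq_card_fsetU _ _).
apply: fsubset_leq_card; apply/fsubsetP => x; rewrite !(in_fsetU, in_fsetD).
by case: (x \in P) (x \in Q) (x \in X) => [] [] [].
Qed.

Lemma dist_path P s : path (fun X Y => dist X Y == 1) P s -> dist P (last P s) <= size s.
Proof.
elim: s P => [|Y s IH] P /=; first by rewrite /dist fsetDv fsetU0 cardfs0.
move=> /andP[/eqP d1 /IH h]; apply: leq_trans (dist_triangle _ Y _) _.
by rewrite d1 add1n ltnS.
Qed.

(** The first step of a tight path from H to the union of H and Q brings it nearer to that union, so
    it changes an element where the two differ, that is, an element of Q outside H. This is how a
    competing well-graded family is forced in the minimality proof. *)
Lemma wg_step F H Q : union_closed F -> well_graded F -> H \in F -> Q \in F ->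
  ~~ (Q `<=` H) -> exists z, [/\ z \in Q, z \notin H & z |` H \in F].
Proof.
move=> ucF wgF HF QF nQH; have HQF := union_closedU ucF HF QF.
have neq : H != H `|` Q by apply: contra nQH => /eqP->; apply: fsubsetUr.
have [[|Y s] /and4P[al /eqP la /eqP sz pth]] := wgF _ _ HF HQF neq.
  by move: neq; rewrite -la /= eqxx.
move: al pth sz la => /= /and3P[_ YF _] /andP[d1 pth] sz la.
have dY : dist Y (H `|` Q) <= size s by rewrite -la dist_path.
move: d1; rewrite /dist => /cardfs1P[z Ez].
have zE x : (x \in H) (+) (x \in Y) = (x == z) by rewrite -in_dist Ez inE.
(* Otherwise changing z leaves Y at least as far from the union as H was, while the rest of the path
   is one step shorter. *)
have zQ : (z \in Q) && (z \notin H).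
  apply: contraLR dY => nz; rewrite -ltnNge sz /dist.
  apply: fsubset_leq_card; apply/fsubsetP => x; rewrite !in_dist inE.
  have := zE x; have := nz; case: (eqVneq x z) => [->|_].
    by case: (z \in H) (z \in Q) (z \in Y) => [] [] [].
  by case: (x \in H) (x \in Q) (x \in Y) => [] [] [].
case/andP: zQ => zQ zH; exists z; split=> //; suff -> : z |` H = Y by [].
apply/fsetP => x; rewrite !inE; have := zE x; case: eqVneq => [->|_].
  by rewrite (negbTE zH) => /=.
by case: (x \in H) (x \in Y) => [] [].
Qed.

Lemma up_path F X Q : union_closed F ->
  (forall X Q, X \in F -> Q \in F -> ~~ (Q `<=` X) ->
     exists z, [/\ z \in Q, z \notin X & z |` X \in F]) ->
  X \in F -> Q \in F ->
  exists s, [/\ all (mem F) s, last X s = X `|` Q, size s = #|` Q `\` X| &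
    path (fun X Y => dist X Y == 1) X s].
Proof.
move=> ucF step; have [k] := ubnP #|` Q `\` X|; elim: k X => // k IH X hk XF QF.
case: (boolP (Q `<=` X)) => [sQX|nQX].
  exists [::]; split=> //=; first by apply/esym/fsetUidPl.
  by apply/esym/eqP; rewrite cardfs_eq0 fsetD_eq0.
have [z [zQ zX zF]] := step _ _ XF QF nQX.
have E : Q `\` X = z |` (Q `\` (z |` X)).
  apply/fsetP => x; rewrite !inE; case: eqVneq => [->|_] /=; first by rewrite zX zQ.
  by [].
have card : #|` Q `\` X| = #|` Q `\` (z |` X)|.+1.
  by rewrite E cardfsU1 !inE eqxx.
have [|s [al la sz pth]] := IH _ _ zF QF; first by rewrite -ltnS -card.
exists ((z |` X) :: s); split=> /=.
- by rewrite zF.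
- rewrite la; apply/fsetP => x; rewrite !inE.
  by case: eqVneq => [->|] //=; rewrite zQ orbT.
- by rewrite sz card.
- rewrite pth andbT; apply/cardfs1P; exists z; apply/fsetP => x; rewrite in_dist !inE.
  by case: eqVneq => [->|_] /=; rewrite ?(negbTE zX) //; case: (x \in X).
Qed.

(** The ascents from P and from Q to their union are glued, the second one reversed; their lengths
    are the cardinalities of the two differences, which sum to the distance. *)
Lemma step_well_graded F : union_closed F ->
  (forall X Q, X \in F -> Q \in F -> ~~ (Q `<=` X) ->
     exists z, [/\ z \in Q, z \notin X & z |` X \in F]) -> well_graded F.
Proof.
move=> ucF step P Q PF QF neq.
have [s1 [al1 la1 sz1 p1]] := up_path ucF step PF QF.
have [s2 [al2 la2 sz2 p2]] := up_path ucF step QF PF.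
exists (s1 ++ rev (belast Q s2)); apply/and4P; split.
- rewrite /= PF all_cat al1 /=; apply/allP => Y; rewrite mem_rev => /mem_belast.
  by rewrite inE => /predU1P[->|/(allP al2)].
- rewrite last_cat la1; case: s2 {al2 sz2 p2} la2 => [|Y s2] /= la2.
    by rewrite fsetUC -la2.
  by rewrite rev_cons last_rcons.
- rewrite size_cat size_rev size_belast sz1 sz2 /dist cardfsU addnC.
  suff -> : (P `\` Q) `&` (Q `\` P) = fset0 by rewrite cardfs0 subn0.
  by apply/fsetP => x; rewrite !inE; case: (x \in P) (x \in Q) => [] [].
- rewrite cat_path p1 la1 fsetUC -la2 rev_path.
  by rewrite (eq_path (e' := fun X Y => dist X Y == 1)) // => X Y; rewrite dist_sym.
Qed.

End Families.

(** * Membership in a span, for lists of lists *)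

Definition inspan (gs : seq (seq nat)) (X : seq nat) : Prop :=
  (exists2 g, g \in gs & {subset g <= X}) /\
  forall x, x \in X -> exists g, [/\ g \in gs, x \in g & {subset g <= X}].

Lemma inspan_gen gs g : g \in gs -> inspan gs g.
Proof. by move=> h; split; [exists g|move=> x xg; exists g; split]. Qed.

Lemma inspan_eq gs X Y : X =i Y -> inspan gs X -> inspan gs Y.
Proof.
move=> E [[g gG gX] cov]; split; first by exists g => // x /gX; rewrite E.
move=> x; rewrite -E => /cov[h [hG xh hX]]; exists h; split=> // y /hX.
by rewrite E.
Qed.

Lemma inspan_sub gs gs' X : {subset gs <= gs'} -> inspan gs X -> inspan gs' X.
Proof.
move=> s [[g gG gX] cov]; split; first by exists g => //; apply: s.
by move=> x /cov[h [hG xh hX]]; exists h; split=> //; apply: s.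
Qed.

Lemma inspan_cat gs X Y : inspan gs X -> inspan gs Y -> inspan gs (X ++ Y).
Proof.
move=> [[g gG gX] cov] [_ cov']; split.
  by exists g => // x /gX; rewrite mem_cat => ->.
move=> x; rewrite mem_cat => /orP[/cov|/cov'] [h [hG xh hX]];
  by exists h; split=> // y /hX; rewrite mem_cat => ->; rewrite ?orbT.
Qed.

(** The set [z :: H] is then the union of [H] and [Y]. *)
Lemma inspan_cons gs H Y z : inspan gs H -> inspan gs Y -> z \in Y ->
  {subset Y <= z :: H} -> inspan gs (z :: H).
Proof.
move=> hH hY zY sY; apply: inspan_eq (inspan_cat hH hY) => x.
rewrite mem_cat inE orbC; apply/orP/orP => -[].
- by move=> /sY; rewrite inE => /orP[->|->]; [left|right].
- by move=> ->; right.
- by move=> /eqP->; left.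
- by move=> ->; right.
Qed.

Section SetsOfSeqs.

Local Open Scope fset_scope.

Definition fset_of (s : seq nat) : {fset nat} := [fset x in s].
Definition family (gs : seq (seq nat)) : {fset {fset nat}} :=
  [fset X in [seq fset_of s | s <- gs]].

Lemma in_fset_of s x : (x \in fset_of s) = (x \in s).
Proof. by rewrite /fset_of !inE. Qed.

Lemma eq_fset_of s s' : s =i s' -> fset_of s = fset_of s'.
Proof. by move=> E; apply/fsetP => x; rewrite !in_fset_of E. Qed.

Lemma fset_of_cons x s : fset_of (x :: s) = x |` fset_of s.
Proof. by apply/fsetP => y; rewrite !inE. Qed.

Lemma fset_of_enum (X : {fset nat}) : fset_of (enum_fset X) = X.
Proof. by apply/fsetP => y; rewrite in_fset_of. Qed.

Lemma familyP gs X : reflect (exists2 g, g \in gs & X = fset_of g) (X \in family gs).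
Proof. by rewrite /family !inE; apply: mapP. Qed.

Lemma mem_family gs g : g \in gs -> fset_of g \in family gs.
Proof. by move=> h; apply/familyP; exists g. Qed.

Lemma in_span gs X : inspan gs X <-> fset_of X \in span (family gs).
Proof.
split=> [[[g gG gX] cov]|/spanP[[_ /familyP[g gG ->] /fsubsetP gX] cov]].
  have sub h : {subset h <= X} -> fset_of h `<=` fset_of X.
    by move=> s; apply/fsubsetP => y; rewrite !in_fset_of; apply: s.
  apply/spanP; split; first by exists (fset_of g); [apply: mem_family|apply: sub].
  move=> x; rewrite in_fset_of => /cov[h [hG xh hX]]; exists (fset_of h).
  by rewrite in_fset_of mem_family // sub.
split; first by exists g => // x xg; rewrite -in_fset_of gX ?in_fset_of.
move=> x; rewrite -in_fset_of => /cov[_ [/familyP[h hG ->]]]; rewrite in_fset_of => xh /fsubsetP hX.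
by exists h; split=> // y yh; rewrite -in_fset_of hX ?in_fset_of.
Qed.

Lemma in_span_enum gs (X : {fset nat}) :
  inspan gs (enum_fset X) <-> X \in span (family gs).
Proof. by rewrite in_span fset_of_enum. Qed.

End SetsOfSeqs.

(** * Chains *)

Section Chains.

Variable ss : seq (seq nat).
Hypothesis uniq_ss : all uniq ss.
Let n := size ss.
Let P i := nth [::] ss i.

Variable rank : nat -> nat.
Hypothesis rank_inj : forall i j x y, x \in P i -> y \in P j -> rank x = rank y -> x = y.

Implicit Types (f : nat -> seq nat) (A : seq (seq nat)) (u v i j : nat).

(* Head u stands for the pair (P (u %/ n), P (u %% n)); f u lists its chain. *)
Definition src u := P (u %/ n).
Definition tgt u := P (u %% n).

(* A lists the new generators in order of creation. new_log records for each of
   them the head H and the target P j it was created for, and that among the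
   extensions of H by an element of P j it is still the only one in the span;
   k and r bound the size of H and the rank of the added element. *)
Record chain_inv f A k r : Prop := ChainInv {
  chain_shape : forall u, u < n * n ->
    exists c, [/\ f u = src u ++ c, uniq (f u) & {subset c <= tgt u}];
  chain_span : forall u t, u < n * n -> size (src u) <= t ->
    inspan (ss ++ A) (take t (f u));
  new_chain : forall g, g \in A -> exists u t,
    [/\ u < n * n, size (src u) <= t, t <= size (f u) & g = take t (f u)];
  new_log : forall A1 X A2, A = A1 ++ X :: A2 -> exists H j x,
    [/\ [/\ X =i x :: H, x \notin H, uniq H, j < n & x \in P j],
        inspan (ss ++ A1) H, ~ inspan (ss ++ A1) X,
        forall z, z \in P j -> z \notin H -> inspan (ss ++ A) (z :: H) -> z = x &
        [/\ forall z, z \in P j -> z \notin H -> rank x <= rank z,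
            size H <= k & size H = k -> r <= rank x]] }.

(** The admissible changes of [k] and [r] follow the order of the visits: sizes increase and, at
    equal size, ranks decrease. *)
Lemma chain_inv_mono f A k r k' r' : chain_inv f A k r ->
  k < k' \/ k = k' /\ r' <= r -> chain_inv f A k' r'.
Proof.
case=> h1 h2 h3 h4 hk; split=> // A1 X A2 /h4[H [j [x [a1 a2 a3 a4 [b1 b2 b3]]]]].
exists H, j, x; split=> //; split=> //; clear -hk b2 b3; lia.
Qed.

Lemma uniq_P i : uniq (P i).
Proof.
have [h|h] := ltnP i n; last by rewrite /P nth_default.
by apply: (allP uniq_ss); apply: mem_nth.
Qed.

Lemma P_in i : i < n -> P i \in ss.
Proof. exact: mem_nth. Qed.

Lemma n_gt0 u : u < n * n -> 0 < n.
Proof. by case: n. Qed.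

Lemma src_lt u : u < n * n -> u %/ n < n.
Proof. by move=> h; rewrite ltn_divLR // (n_gt0 h). Qed.

Lemma tgt_lt u : u < n * n -> u %% n < n.
Proof. by move=> h; rewrite ltn_mod (n_gt0 h). Qed.

Lemma head_lt i j : i < n -> j < n -> i * n + j < n * n.
Proof. by move=> hi hj; clear -hi hj; nia. Qed.

Lemma srcE i j : j < n -> src (i * n + j) = P i.
Proof. by move=> h; rewrite /src divnMDl ?divn_small ?addn0 //; apply: leq_ltn_trans h. Qed.

Lemma tgtE i j : j < n -> tgt (i * n + j) = P j.
Proof. by move=> h; rewrite /tgt modnMDl modn_small. Qed.

Section Invariant.

Variables (f : nat -> seq nat) (A : seq (seq nat)) (k r : nat).
Hypothesis inv : chain_inv f A k r.

Lemma chain_head u : u < n * n -> inspan (ss ++ A) (f u).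
Proof.
move=> h; rewrite -[f u]take_size; apply: (chain_span inv) => //.
by have [c [-> _ _]] := chain_shape inv h; rewrite size_cat leq_addr.
Qed.

Lemma chain_uniq u : u < n * n -> uniq (f u).
Proof. by move=> h; have [c [_ ->]] := chain_shape inv h. Qed.

Lemma nth_chain_tgt u p : u < n * n -> size (src u) <= p -> p < size (f u) ->
  nth 0 (f u) p \in tgt u.
Proof.
move=> h; have [c [-> _ s]] := chain_shape inv h; rewrite size_cat nth_cat => h1 h2.
by rewrite ltnNge h1 /=; apply: s; apply: mem_nth; rewrite ltn_subLR.
Qed.

(** The prefix of length p + 1 lies in H except possibly for its last element, so its union with H
    adds at most that element. The lower bound on p keeps the prefix from cutting into the source,
    where it need not be in the span. *)
Lemma first_missing H u p : u < n * n -> inspan (ss ++ A) H ->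
  size (src u) <= p -> p < size (f u) -> {subset take p (f u) <= H} ->
  inspan (ss ++ A) (nth 0 (f u) p :: H).
Proof.
move=> hu hH h1 h2 sub.
apply: (inspan_cons (Y := take p.+1 (f u))) => //.
- by apply: (chain_span inv) => //; apply: leqW.
- by rewrite (take_nth 0) // mem_rcons inE eqxx.
- by move=> x; rewrite (take_nth 0) // mem_rcons !inE => /orP[->|/sub ->]; rewrite ?orbT.
Qed.

(** An input set is the initial part of the chain of the pair formed by that set twice; this is what
    the diagonal pairs are for. *)
Lemma chain_gen g : g \in ss ++ A -> exists u t,
  [/\ u < n * n, size (src u) <= t & g = take t (f u)].
Proof.
rewrite mem_cat => /orP[gss|/(new_chain inv)[u [t [hu ht _ Eg]]]]; last by exists u, t.
have hi : index g ss < n by rewrite index_mem.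
have hv := head_lt hi hi.
exists (index g ss * n + index g ss), (size (src (index g ss * n + index g ss))); split=> //.
by have [c [-> _ _]] := chain_shape inv hv; rewrite take_size_cat // srcE // /P nth_index.
Qed.

(** What the program can check in constant time once the pointer stands at p. If p lies in the
    source of v, the bound on the count says that z is the only element of that source missing from
    the head; if p lies beyond, the head contains the source and the bound holds by itself. *)
Definition available u v p z :=
  [/\ v < n * n, p < size (f v), {subset take p (f v) <= f u} &
      [/\ nth 0 (f v) p = z, z \notin f u & count [pred x | x \notin f u] (src v) <= 1]].

Lemma available_sound u v p z : u < n * n -> available u v p z ->
  inspan (ss ++ A) (z :: f u).
Proof.
move=> hu [hv hp sub [Ez zu hc]].
have [le|lt] := leqP (size (src v)) p.
  by rewrite -Ez; apply: first_missing => //; apply: chain_head.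
have [c [Ef _ _]] := chain_shape inv hv.
have zs : z \in src v by rewrite -Ez Ef nth_cat lt mem_nth.
apply: (inspan_cons (Y := src v)) => //; first exact: chain_head.
  by apply: inspan_gen; rewrite mem_cat P_in // src_lt.
move=> x xs; rewrite inE; case: eqVneq => //= xz.
(* If x were missing too, x and z would be two missing elements of the source. *)
apply: contraTT hc => xu; rewrite -ltnNge.
have := uniq_P (v %/ n); rewrite -/(src v) => us.
have /(uniq_leq_size _) : {subset [:: x; z] <= filter [pred x | x \notin f u] (src v)}.
  by move=> y; rewrite mem_filter !inE => /orP[]/eqP->; rewrite ?xs ?zs ?xu ?zu.
by rewrite size_filter /= inE xz; apply.
Qed.

(** A generator that contains z and lies in [z :: f u] is a prefix of some chain v, and z is its
    only element missing from the head; so the position of z is the first missing one in v. *)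
Lemma available_complete u z : u < n * n -> z \notin f u ->
  inspan (ss ++ A) (z :: f u) -> exists v p, available u v p z.
Proof.
move=> hu zu [_ /(_ z)]; rewrite inE eqxx => /(_ isT)[g [gG zg gs]].
have suff_ v t : v < n * n -> size (src v) <= t -> g = take t (f v) -> exists v p, available u v p z.
  move=> hv ht Eg; exists v, (index z g).
  have lt : index z g < size g by rewrite index_mem.
  have c1 : count [pred x | x \notin f u] g <= 1.
    rewrite -size_filter; have ug : uniq g by rewrite Eg take_uniq // chain_uniq.
    have := uniq_leq_size (filter_uniq [pred x | x \notin f u] ug) (s2 := [:: z]); apply => x.
    by rewrite mem_filter /= inE => /andP[xu /gs]; rewrite inE (negbTE xu) orbF.
  have lt' : index z g < t by apply: leq_trans lt _; rewrite Eg size_take_min geq_minl.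
  have pre : take (index z g) (f v) = take (index z g) g.
    by rewrite [X in _ = take _ X]Eg take_takel // ltnW.
  have lf : index z g < size (f v).
    by apply: leq_trans lt _; rewrite Eg size_take_min geq_minr.
  split=> //.
  - rewrite pre => x xt; have := gs _ (mem_take xt); rewrite inE => /orP[/eqP Ex|//].
    by move: xt; rewrite Ex in_take_leq ?ltnn // ltnW.
  - split=> //; first by rewrite -(nth_take _ lt') -Eg nth_index.
    apply: leq_trans c1; rewrite Eg -(cat_take_drop (size (src v)) (take t (f v))).
    rewrite count_cat take_takel //; have [c [-> _ _]] := chain_shape inv hv.
    by rewrite take_size_cat // leq_addr.
have [v [t [hv ht Eg]]] := chain_gen gG; exact: (suff_ v t).
Qed.

End Invariant.

Definition upd f u X : nat -> seq nat := fun v => if v == u then X else f v.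

Lemma move_inv f A k r u z : chain_inv f A k r -> u < n * n ->
  z \in tgt u -> z \notin f u -> inspan (ss ++ A) (z :: f u) ->
  chain_inv (upd f u (rcons (f u) z)) A k r.
Proof.
move=> inv hu zt zf zs; split; last exact: new_log inv.
- move=> v hv; rewrite /upd; case: eqP => [->|_]; last exact: (chain_shape inv).
  have [c [E uf s]] := chain_shape inv hu; exists (rcons c z); split.
  + by rewrite E rcons_cat.
  + by rewrite rcons_uniq zf.
  + by move=> x; rewrite mem_rcons inE => /predU1P[->|/s].
- move=> v t hv ht; rewrite /upd; case: eqP => [Ev|_]; last exact: (chain_span inv).
  rewrite {v}Ev in hv ht.
  have [le|lt] := leqP t (size (f u)).
    by rewrite -cats1 takel_cat //; apply: (chain_span inv).
  rewrite take_oversize ?size_rcons //; apply: inspan_eq zs => x.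
  by rewrite mem_rcons.
- move=> g /(new_chain inv)[v [t [hv h1 h2 Eg]]]; exists v, t; rewrite /upd; case: eqP => Ev //.
  rewrite Ev in h1 h2 Eg *; rewrite size_rcons; split=> //; first exact: leqW.
  by rewrite -cats1 takel_cat.
Qed.

(** The delicate part is the log: a new generator enlarges the span, and no older entry may gain a
    second extension. The order of the visits enters through [rank x = r], against the lower bound
    [r] recorded in the log for entries of the same size. *)
Lemma add_inv f A k r u x : chain_inv f A k r -> u < n * n -> size (f u) = k ->
  x \in tgt u -> x \notin f u -> rank x = r ->
  (forall z, z \in tgt u -> z \notin f u -> rank x <= rank z) ->
  (forall z, z \in tgt u -> z \notin f u -> ~ inspan (ss ++ A) (z :: f u)) ->
  chain_inv (upd f u (rcons (f u) x)) (rcons A (rcons (f u) x)) k r.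
Proof.
move=> inv hu sk xt xf rx minx nosp.
set Y := rcons (f u) x; set A' := rcons A Y.
have sub : {subset ss ++ A <= ss ++ A'}.
  by move=> g; rewrite !mem_cat mem_rcons inE => /orP[->|->]; rewrite ?orbT.
have uf := chain_uniq inv hu.
have fin := chain_head inv hu.
have YE : Y =i x :: f u by move=> y; rewrite mem_rcons.
(* A one-element extension of H that enters the span together with Y must use Y to cover z. *)
have gA' H z : inspan (ss ++ A') (z :: H) -> inspan (ss ++ A) H ->
    ~ inspan (ss ++ A) (z :: H) -> z \in Y /\ {subset Y <= z :: H}.
  move=> [_ /(_ z)]; rewrite inE eqxx => /(_ isT)[g [gG zg gs]] hH nH.
  move: gG; rewrite mem_cat mem_rcons inE orbCA -mem_cat => /orP[/eqP<-//|gG].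
  by case: nH; apply: (inspan_cons hH (inspan_gen gG)).
split.
- move=> v hv; rewrite /upd; case: eqP => [->|_]; last exact: (chain_shape inv).
  have [c [E _ s]] := chain_shape inv hu; exists (rcons c x); split.
  + by rewrite /Y E rcons_cat.
  + by rewrite rcons_uniq xf.
  + by move=> y; rewrite mem_rcons inE => /predU1P[->|/s].
- move=> v t hv ht; rewrite /upd; case: eqP => [Ev|_]; last first.
    by apply: inspan_sub sub _; apply: (chain_span inv).
  rewrite {v}Ev in hv ht.
  have [le|lt] := leqP t (size (f u)).
    by rewrite /Y -cats1 takel_cat //; apply: inspan_sub sub _; apply: (chain_span inv).
  rewrite take_oversize ?size_rcons //; apply: inspan_gen.
  by rewrite mem_cat mem_rcons inE eqxx orbT.
- move=> g; rewrite mem_rcons inE => /predU1P[->|gA].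
    exists u, (size Y); rewrite /upd eqxx take_size size_rcons; split=> //.
    have [c [-> _ _]] := chain_shape inv hu; rewrite size_cat; lia.
  have [v [t [hv h1 h2 Eg]]] := new_chain inv gA; exists v, t; rewrite /upd; case: eqP => Ev //.
  rewrite Ev in h1 h2 Eg *; rewrite size_rcons; split=> //; first exact: leqW.
  by rewrite /Y -cats1 takel_cat.
- move=> A1 X A2; case/lastP: A2 => [|A2 X'].
    rewrite cats1 => /rcons_inj[<- <-].
    have nY : ~ inspan (ss ++ A) Y.
      by move=> /(inspan_eq YE); apply: nosp.
    exists (f u), (u %% n), x; split=> //.
    + by split=> //; apply: tgt_lt.
    + move=> z zt zf /gA'/(_ fin (nosp _ zt zf))[].
      by rewrite YE inE (negbTE zf) orbF => /eqP.
    + by split=> //; rewrite ?sk ?rx.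
  rewrite -rcons_cons -rcons_cat => /rcons_inj[EA _].
  (* An older entry; assume that the extension of its H by z belongs to the enlarged span. *)
  have [H [j [w [[XE wH uH jn wj] sH nX uniqz [minw hk hr]]]]] := new_log inv EA.
  exists H, j, w; split=> // z zj zH spz.
  have sH' : inspan (ss ++ A) H.
    by apply: inspan_sub sH => g h; rewrite EA catA mem_cat h.
  (* Membership can be decided by a finite search: with H in the span, it amounts to a generator
     that contains z and lies in [z :: H]. *)
  have cases : inspan (ss ++ A) (z :: H) \/ ~ inspan (ss ++ A) (z :: H).
    pose b := has (fun g => (z \in g) && all (mem (z :: H)) g) (ss ++ A).
    have [/hasP[g gG /andP[zg /allP gs]]|/hasPn nb] := boolP b.
      by left; apply: (inspan_cons sH' (inspan_gen gG)).
    right=> -[_ /(_ z)]; rewrite inE eqxx => /(_ isT)[g [gG zg gs]].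
    by have := nb _ gG; rewrite zg /= => /negP; apply; apply/allP.
  case: cases => [|nsp]; first exact: uniqz.
  have [zY sY] := gA' _ _ spz sH' nsp.
  (* Y has k + 1 elements and lies in [z :: H], while H has at most k; hence the two sets
     coincide. *)
  have uY : uniq Y by rewrite rcons_uniq xf.
  have szY : size Y = k.+1 by rewrite size_rcons sk.
  have szH : size H = k.
    by have := uniq_leq_size uY sY; rewrite szY /= ltnS => le; apply/eqP; rewrite eqn_leq hk.
  have EY : Y =i z :: H.
    by have [] := uniq_min_size uY sY; rewrite //= szY szH.
  (* If H is not inside the head, Y is the union of the head and H and was in the span before,
     against [nosp]. *)
  have [sub1|nsub] := boolP (all (mem (f u)) H); last first.
    case: (nosp _ xt xf); apply: (inspan_eq YE).
    apply: (inspan_eq (X := f u ++ H)); last exact: inspan_cat.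
    have /allPn[y yH /= yf] := nsub => y'; rewrite mem_cat.
    have xy : y = x.
      by have := EY y; rewrite YE !inE yH orbT (negbTE yf) orbF => /eqP.
    rewrite xy in yH.
    apply/orP/idP => [[h|h]|]; first by rewrite YE inE h orbT.
      by rewrite EY inE h orbT.
    by rewrite YE inE => /predU1P[->|]; [right|left].
  have EH : H =i f u.
    by have [] := uniq_min_size uH (allP sub1); rewrite // sk szH.
  have xz : z = x.
    by move: zY; rewrite YE inE -EH (negbTE zH) orbF => /eqP.
  (* The log bounds the rank of w below by r, the rank of x; conversely w has the least rank among
     the elements of P j missing from H, and x is one of these. *)
  rewrite xz; apply: (rank_inj (i := u %% n) (j := j)) => //.
  apply/eqP; rewrite eqn_leq {1}rx hr //=.
  by rewrite -xz minw.
Qed.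

(** * The final family: well-graded, minimal, listed without repetition *)

Section Final.

Local Open Scope fset_scope.

Variables (f : nat -> seq nat) (A : seq (seq nat)) (k r : nat).
Hypothesis inv : chain_inv f A k r.
Hypothesis complete : forall u, u < n * n -> {subset tgt u <= f u}.
Hypothesis uniq_sets : uniq [seq fset_of s | s <- ss].

Let F := span (family (ss ++ A)).

(** The first element of the prefix missing from X lies beyond the source, which X contains; so it
    comes from the target, and adding it to X stays in the span by [first_missing]. *)
Lemma chain_step X u t : X \in F -> u < n * n -> fset_of (src u) `<=` X ->
  ~~ (fset_of (take t (f u)) `<=` X) -> size (src u) <= t ->
  exists z, [/\ z \in take t (f u), z \in tgt u, z \notin X & z |` X \in F].
Proof.
move=> XF hu /fsubsetP sX nt ht.
have hs : has (fun y => y \notin X) (take t (f u)).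
  apply: contraR nt => /hasPn h; apply/fsubsetP => y; rewrite in_fset_of => /h.
  by rewrite negbK.
set p := find (fun y => y \notin X) (take t (f u)).
have lp : p < size (take t (f u)) by rewrite -has_find.
have pt : p < t by apply: leq_trans lp _; rewrite size_take_min geq_minl.
have pf : p < size (f u) by apply: leq_trans lp _; rewrite size_take_min geq_minr.
set z := nth 0 (f u) p.
have zE : z = nth 0 (take t (f u)) p by rewrite nth_take.
have zX : z \notin X by rewrite zE (nth_find 0 hs).
have sp : size (src u) <= p.
  rewrite leqNgt; apply: contra zX => lt; apply: sX; rewrite in_fset_of /z.
  by have [c [-> _ _]] := chain_shape inv hu; rewrite nth_cat lt mem_nth.
exists z; split=> //; first by rewrite zE mem_nth.
- exact: (nth_chain_tgt inv).
- have /in_span h : inspan (ss ++ A) (z :: enum_fset X).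
    apply: (first_missing inv) => //; first exact/in_span_enum.
    move=> y yt; have lq : index y (take p (f u)) < p.
      by rewrite -[X in _ < X](size_takel (ltnW pf)) index_mem.
    have := before_find 0 lq; rewrite nth_take; last exact: ltn_trans pt.
    by rewrite -(nth_take 0 lq) nth_index // => /negbFE.
  by move: h; rewrite fset_of_cons fset_of_enum.
Qed.

Lemma src_take u t : u < n * n -> size (src u) <= t -> {subset src u <= take t (f u)}.
Proof.
move=> hu ht x xs; have [c [-> _ _]] := chain_shape inv hu.
by rewrite take_cat ltnNge ht /= mem_cat xs.
Qed.

(** A generator g inside Q but not inside X is a prefix of some chain v. If X contains the source of
    v, the first element of g missing from X serves. If not, X contains the source of some chain w,
    and the complete chain from there to the source of v supplies a missing element, which lies in
    the source of v and so in g. *)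
Lemma final_step X Q : X \in F -> Q \in F -> ~~ (Q `<=` X) ->
  exists z, [/\ z \in Q, z \notin X & z |` X \in F].
Proof.
move=> XF /spanP[_ covQ] nQX.
have [y yQ yX] : exists2 y, y \in Q & y \notin X.
  by case/fsubsetPn: nQX => y; exists y.
have [_ [/familyP[g gG ->]]] := covQ _ yQ; rewrite in_fset_of => yg gQ.
have [v [t [hv ht Eg]]] := chain_gen inv gG.
have sub : {subset g <= Q} by move=> x xg; apply: (fsubsetP gQ); rewrite in_fset_of.
have [sX|nsX] := boolP (fset_of (src v) `<=` X).
  have [|z [zt _ zX zF]] := chain_step (t := t) XF hv sX _ ht.
    apply/fsubsetPn; exists y => //; by rewrite in_fset_of -Eg.
  by exists z; split=> //; apply: sub; rewrite Eg.
have /spanP[[_ /familyP[g0 g0G ->] g0X] _] := XF.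
have [w [t0 [hw ht0 Eg0]]] := chain_gen inv g0G.
have hu := head_lt (src_lt hw) (src_lt hv).
set u := (w %/ n * n + v %/ n)%N in hu.
have Es : src u = src w by rewrite srcE ?src_lt.
have Et : tgt u = src v by rewrite tgtE ?src_lt.
have [||//|z [zt]] := chain_step (t := size (f u)) XF hu.
- rewrite Es; apply: fsubset_trans g0X; apply/fsubsetP => x.
  by rewrite !in_fset_of Eg0; apply: src_take.
- rewrite take_size; have /fsubsetPn[x xs xX] := nsX; apply/fsubsetPn; exists x => //.
  by rewrite in_fset_of; apply: complete => //; rewrite Et -in_fset_of.
- by have [c [-> _ _]] := chain_shape inv hu; rewrite size_cat leq_addr.
rewrite Et => zv zX zF; exists z; split=> //; apply: sub; rewrite Eg; exact: src_take.
Qed.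

Lemma final_minimal : minimal_wg_extension (family ss) F.
Proof.
have ucF : union_closed F by apply: span_union_closed.
have ssA : family ss `<=` family (ss ++ A).
  by apply/fsubsetP => X /familyP[g gss ->]; apply: mem_family; rewrite mem_cat gss.
split=> //; [exact: step_well_graded final_step|exact: fsubset_trans (sub_span _)|].
move=> F' ucF' BF' /andP[sF' nF'] wgF'; case/negP: nF'.
apply: span_sub => //.
(* Induction along the order of creation: the log places H in the span of the generators that
   precede X. *)
suff h A1 A2 : A = A1 ++ A2 -> family (ss ++ A1) `<=` F' by apply: (h A [::]); rewrite cats0.
elim/last_ind: A1 A2 => [|A1 X IH] A2; first by rewrite cats0.
rewrite cat_rcons => EA; have sA1 := IH _ EA.
apply/fsubsetP => _ /familyP[g gA ->].
move: gA; rewrite mem_cat mem_rcons inE orbCA -mem_cat => /orP[/eqP->|gA]; last first.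
  by apply: (fsubsetP sA1); apply: mem_family.
have [H [j [x [[XE xH uH jn xj] /in_span sH nX uniqz _]]]] := new_log inv EA.
have HF' : fset_of H \in F' by apply: (fsubsetP (span_sub ucF' sA1)).
have QF' : fset_of (P j) \in F'.
  by apply: (fsubsetP BF'); apply: mem_family; apply: P_in.
have [|z [zQ zH zF']] := wg_step ucF' wgF' HF' QF'.
  by apply/fsubsetPn; exists x; rewrite in_fset_of.
rewrite !in_fset_of in zQ zH; rewrite -fset_of_cons in zF'.
have E : z = x by apply: uniqz => //; apply/in_span; apply: (fsubsetP sF').
suff -> : fset_of X = fset_of (z :: H) by [].
by rewrite E; apply: eq_fset_of.
Qed.

(** A new generator was outside the span when it was created, so it differs, as a set, from all
    earlier generators. *)
Lemma final_lists : lists_family (ss ++ A) (family (ss ++ A)).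
Proof.
split=> //.
- rewrite all_cat uniq_ss; apply/allP => g /(new_chain inv)[u [t [hu _ _ ->]]].
  by apply: take_uniq; apply: (chain_uniq inv).
- suff h A1 A2 : A = A1 ++ A2 -> uniq [seq fset_of s | s <- ss ++ A1].
    by apply: (h A [::]); rewrite cats0.
  elim/last_ind: A1 A2 => [|A1 X IH] A2; first by rewrite cats0.
  rewrite cat_rcons => EA; rewrite -rcons_cat map_rcons rcons_uniq (IH _ EA) andbT.
  have [H [j [x [_ _ nX _ _]]]] := new_log inv EA.
  apply/negP => /mapP[g gG Eg]; apply: nX; apply: (inspan_eq (X := g)); last exact: inspan_gen.
  by move=> y; rewrite -in_fset_of -Eg in_fset_of.
Qed.

End Final.

End Chains.

(** * A structured language compiled to the machine *)

(* Addr a e is the address of entry e of the array a. Sixteen arrays, all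
   unbounded, are interleaved in the cells above the address [base]. *)
Inductive expr : Type :=
  | Var of nat
  | Cst of nat
  | Plus of expr & expr
  | Minus of expr & expr
  | Peek of expr
  | Addr of nat & expr.

Inductive cmd : Type :=
  | Skip
  | Asg of nat & expr
  | Store of expr & expr
  | Seq of cmd & cmd
  | If of expr & cmd & cmd
  | While of expr & cmd.

(** The clock has no counterpart in the machine state. It advances by one at each assignment, store
    and test, and compilation turns it into machine steps up to a constant factor. *)
Record cstate : Type := CState { vars : nat -> nat; memory : nat -> nat; clock : nat }.

Definition base (s : cstate) : nat := vars s 1.

Fixpoint eval (s : cstate) (e : expr) : nat :=
  match e with
  | Var r => vars s r
  | Cst c => c
  | Plus e1 e2 => eval s e1 + eval s e2
  | Minus e1 e2 => eval s e1 - eval s e2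
  | Peek e1 => memory s (eval s e1)
  | Addr a e1 => base s + (16 * eval s e1 + a)
  end.

Definition tick (s : cstate) := CState (vars s) (memory s) (clock s).+1.
Definition asg (s : cstate) r v := CState [eta vars s with r |-> v] (memory s) (clock s).+1.
Definition store (s : cstate) p v := CState (vars s) [eta memory s with p |-> v] (clock s).+1.

Inductive run : cmd -> cstate -> cstate -> Prop :=
  | RunSkip s : run Skip s s
  | RunAsg r e s : run (Asg r e) s (asg s r (eval s e))
  | RunStore e1 e2 s : run (Store e1 e2) s (store s (eval s e1) (eval s e2))
  | RunSeq c1 c2 s1 s2 s3 : run c1 s1 s2 -> run c2 s2 s3 -> run (Seq c1 c2) s1 s3
  | RunIfT e c1 c2 s s' : eval s e != 0 -> run c1 (tick s) s' -> run (If e c1 c2) s s'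
  | RunIfF e c1 c2 s s' : eval s e = 0 -> run c2 (tick s) s' -> run (If e c1 c2) s s'
  | RunWhileT e c s1 s2 s3 : eval s1 e != 0 -> run c (tick s1) s2 ->
      run (While e c) s2 s3 -> run (While e c) s1 s3
  | RunWhileF e c s : eval s e = 0 -> run (While e c) s (tick s).

(* Variable r lives in register 2r, the d-th temporary in register 2d+1. *)
Fixpoint cexpr (d : nat) (e : expr) : seq instr :=
  let t := d.*2.+1 in let t' := d.+1.*2.+1 in
  match e with
  | Var r => [:: Const t 0; Add t t r.*2]
  | Cst c => [:: Const t c]
  | Plus e1 e2 => cexpr d e1 ++ cexpr d.+1 e2 ++ [:: Add t t t']
  | Minus e1 e2 => cexpr d e1 ++ cexpr d.+1 e2 ++ [:: Sub t t t']
  | Peek e1 => cexpr d e1 ++ [:: Read t t]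
  | Addr a e1 => cexpr d e1 ++ nseq 4 (Add t t t) ++
                 [:: Add t t 2; Const t' a; Add t t t']
  end.

(** Jump targets are absolute, hence the argument [pos]. An expression at depth 0 leaves its value
    in register 1; setting that register to zero makes [Jz] an unconditional jump. *)
Fixpoint ccmd (pos : nat) (c : cmd) : seq instr :=
  match c with
  | Skip => [::]
  | Asg r e => cexpr 0 e ++ [:: Const r.*2 0; Add r.*2 r.*2 1]
  | Store e1 e2 => cexpr 0 e1 ++ cexpr 1 e2 ++ [:: Write 1 3]
  | Seq c1 c2 => let k1 := ccmd pos c1 in k1 ++ ccmd (pos + size k1) c2
  | If e c1 c2 =>
      let ke := cexpr 0 e in
      let k1 := ccmd (pos + size ke + 1) c1 in
      let l := pos + size ke + 1 + size k1 + 2 in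
      let k2 := ccmd l c2 in
      ke ++ [:: Jz 1 l] ++ k1 ++ [:: Const 1 0; Jz 1 (l + size k2)] ++ k2
  | While e c1 =>
      let ke := cexpr 0 e in
      let k1 := ccmd (pos + size ke + 1) c1 in
      ke ++ [:: Jz 1 (pos + size ke + 1 + size k1 + 2)] ++ k1 ++
      [:: Const 1 0; Jz 1 pos]
  end.

(** * Correctness of the compiler *)

Definition steps (prog : program) (k : nat) (s s' : state) : Prop :=
  iter k (obind (step prog)) (Some s) = Some s'.

Lemma steps_trans prog k1 k2 s1 s2 s3 :
  steps prog k1 s1 s2 -> steps prog k2 s2 s3 -> steps prog (k1 + k2) s1 s3.
Proof. by rewrite /steps addnC iterD => -> ->. Qed.

Definition at_code (prog : program) (pos : nat) (code : seq instr) : Prop :=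
  forall i, i < size code -> onth prog (pos + i) = onth code i.

Lemma at_code_cat prog pos k1 k2 : at_code prog pos (k1 ++ k2) ->
  at_code prog pos k1 /\ at_code prog (pos + size k1) k2.
Proof.
move=> H; split=> i hi.
  rewrite H; last by rewrite size_cat ltn_addr.
  by rewrite !onthE map_cat nth_cat size_map hi.
rewrite -addnA H; last by rewrite size_cat ltn_add2l.
by rewrite !onthE map_cat nth_cat size_map ltnNge leq_addr /= addKn.
Qed.

Lemma step_at prog i code s : at_code prog (pc s) (i :: code) ->
  steps prog 1 s (exec i s) /\ at_code prog (pc s).+1 code.
Proof.
move=> H; split; first by rewrite /steps /= /step -[pc s]addn0 H.
by move=> k hk; rewrite addSnnS H.
Qed.

Definition sim (s : cstate) (ms : state) : Prop :=
  (forall r, regs ms r.*2 = vars s r) /\ cells ms =1 memory s.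

Lemma doubleS_neq r d : (r.*2 == d.*2.+1) = false.
Proof. lia. Qed.

(** The last clause protects the temporaries of smaller depth, so that a left operand survives the
    evaluation of the right one. *)
Lemma cexpr_correct e d prog ms s : at_code prog (pc ms) (cexpr d e) -> sim s ms ->
  exists ms', [/\ steps prog (size (cexpr d e)) ms ms',
    pc ms' = pc ms + size (cexpr d e), sim s ms', regs ms' d.*2.+1 = eval s e &
    forall d', d' < d -> regs ms' d'.*2.+1 = regs ms d'.*2.+1].
Proof.
have bin op opf e1 e2 : (forall t a b (q : state), exec (op t a b) q =
    State (pc q).+1 [eta regs q with t |-> opf (regs q a) (regs q b)] (cells q)) ->
  (forall d prog ms s, at_code prog (pc ms) (cexpr d e1) -> sim s ms ->
  exists ms', [/\ steps prog (size (cexpr d e1)) ms ms',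
    pc ms' = pc ms + size (cexpr d e1), sim s ms', regs ms' d.*2.+1 = eval s e1 &
    forall d', d' < d -> regs ms' d'.*2.+1 = regs ms d'.*2.+1]) ->
  (forall d prog ms s, at_code prog (pc ms) (cexpr d e2) -> sim s ms ->
  exists ms', [/\ steps prog (size (cexpr d e2)) ms ms',
    pc ms' = pc ms + size (cexpr d e2), sim s ms', regs ms' d.*2.+1 = eval s e2 &
    forall d', d' < d -> regs ms' d'.*2.+1 = regs ms d'.*2.+1]) ->
  forall d prog ms s, let k := cexpr d e1 ++ cexpr d.+1 e2 ++ [:: op d.*2.+1 d.*2.+1 d.+1.*2.+1] in
    at_code prog (pc ms) k -> sim s ms ->
  exists ms', [/\ steps prog (size k) ms ms',
    pc ms' = pc ms + size k, sim s ms', regs ms' d.*2.+1 = opf (eval s e1) (eval s e2) &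
    forall d', d' < d -> regs ms' d'.*2.+1 = regs ms d'.*2.+1].
  move=> hop IH1 IH2 {}d {}prog {}ms {}s /= /at_code_cat[h1 /at_code_cat[h2 h3]] hs.
  have [m1 [r1 p1 s1 v1 f1]] := IH1 _ _ _ _ h1 hs.
  rewrite -p1 in h2 h3; have [m2 [r2 p2 s2 v2 f2]] := IH2 _ _ _ _ h2 s1.
  rewrite -p2 in h3; have [st _] := step_at h3.
  exists (exec (op d.*2.+1 d.*2.+1 d.+1.*2.+1) m2); rewrite !size_cat /= hop /=; split.
  - by apply: steps_trans r1 (steps_trans r2 _); rewrite -hop.
  - by rewrite p2 p1 addn1 !addnA addnS.
  - case: s2 => s2 s2'; split=> //= r.
    by rewrite doubleS_neq s2.
  - by rewrite eqxx v2 f2 // v1.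
  - move=> d' hd'; have -> : (d'.*2.+1 == d.*2.+1) = false by lia.
    by rewrite f2 ?f1 //; apply: ltnW.
elim: e d prog ms s => [r|c|e1 IH1 e2 IH2|e1 IH1 e2 IH2|e1 IH1|a e1 IH1] d prog ms s.
- move=> /= h hs; have [st1 h1] := step_at h.
  have [|st2 _] := step_at (prog := prog) (s := exec (Const d.*2.+1 0) ms) (i := Add d.*2.+1 d.*2.+1 r.*2) (code := [::]).
    by case: ms {st1 hs h} h1.
  eexists; split; first exact: steps_trans st1 st2.
  + by case: ms {st1 st2 hs h h1} => /= *; rewrite addn2.
  + case: ms hs {st1 st2 h h1} => /= p rg ce [/= hs1 hs2]; split=> //= r'.
    by rewrite !doubleS_neq hs1.
  + case: ms hs {st1 st2 h h1} => /= p rg ce [/= hs1 hs2].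
    by rewrite !eqxx doubleS_neq hs1.
  + case: ms hs {st1 st2 h h1} => /= p rg ce [/= hs1 hs2] d' hd'.
    by have -> : (d'.*2.+1 == d.*2.+1) = false by lia.
- move=> /= h hs; have [st1 h1] := step_at h.
  eexists; split; first exact: st1.
  + by case: ms {st1 hs h h1} => /= *; rewrite addn1.
  + case: ms hs {st1 h h1} => /= p rg ce [/= hs1 hs2]; split=> //= r'.
    by rewrite !doubleS_neq hs1.
  + by case: ms hs {st1 h h1} => /= p rg ce [/= hs1 hs2]; rewrite eqxx.
  + case: ms hs {st1 h h1} => /= p rg ce [/= hs1 hs2] d' hd'.
    by have -> : (d'.*2.+1 == d.*2.+1) = false by lia.
- by apply: (bin Add addn) => // t a b [].
- by apply: (bin Sub subn) => // t a b [].
- move=> /= /at_code_cat[h1 h2] hs.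
  have [m1 [r1 p1 s1 v1 f1]] := IH1 _ _ _ _ h1 hs.
  rewrite -p1 in h2; have [st _] := step_at h2.
  exists (exec (Read d.*2.+1 d.*2.+1) m1); rewrite size_cat; split.
  + exact: steps_trans r1 st.
  + by rewrite addn1 addnS -p1; case: m1 {st h2 f1 v1 s1 p1 r1}.
  + case: m1 s1 {st h2 r1 p1 v1 f1} => /= p rg ce [/= hs1 hs2]; split=> //= r'.
    by rewrite !doubleS_neq hs1.
  + by case: m1 s1 v1 {st h2 r1 p1 f1} => /= p rg ce [/= hs1 hs2] v1; rewrite eqxx hs2 v1.
  + case: m1 s1 v1 f1 {st h2 r1 p1} => /= p rg ce [/= hs1 hs2] v1 f1 d' hd'.
    have -> : (d'.*2.+1 == d.*2.+1) = false by lia.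
    exact: f1.
(* The address case: four doublings replace the multiplication by 16, and register 2 is variable 1,
   the base. *)
- move=> h hs; rewrite [cexpr _ _]/= in h; have /at_code_cat[h1 h2] := h.
  have [m1 [r1 p1 s1 v1 f1]] := IH1 _ _ _ _ h1 hs.
  rewrite -p1 in h2.
  have ex1 : forall q i code, at_code prog (pc q) (i :: code) -> pc (exec i q) = (pc q).+1 ->
      steps prog 1 q (exec i q) /\ at_code prog (pc (exec i q)) code.
    by move=> q i code hq ->; apply: step_at.
  have [|st2 h3] := ex1 _ _ _ h2; first by case: (m1).
  have [|st3 h4] := ex1 _ _ _ h3; first by case: (m1).
  have [|st4 h5] := ex1 _ _ _ h4; first by case: (m1).
  have [|st5 h6] := ex1 _ _ _ h5; first by case: (m1).
  have [|st6 h7] := ex1 _ _ _ h6; first by case: (m1).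
  have [|st7 h8] := ex1 _ _ _ h7; first by case: (m1).
  have [|st8 h9] := ex1 _ _ _ h8; first by case: (m1).
  have st := steps_trans r1 (steps_trans st2 (steps_trans st3 (steps_trans st4
      (steps_trans st5 (steps_trans st6 (steps_trans st7 st8)))))).
  have n1 : (d.*2.+1 == d.+1.*2.+1) = false by lia.
  have n2 : (d.+1.*2.+1 == d.*2.+1) = false by lia.
  have n3 : (2 == d.*2.+1) = false by rewrite -(doubleS_neq 1 d).
  clear - st p1 s1 v1 f1 n1 n2 n3.
  eexists; split; first by rewrite [cexpr _ _]/= size_cat; exact: st.
  + rewrite [cexpr _ _]/= size_cat addnA -p1; case: (m1) => /= p _ _; lia.
  + case: m1 s1 {st p1 f1 v1} => /= p rg ce [/= hs1 hs2]; split=> //= r'.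
    by rewrite !doubleS_neq hs1.
  + case: m1 s1 v1 {st p1 f1} => /= p rg ce [/= hs1 hs2] v1.
    rewrite !eqxx ?n1 ?n2 ?n3 /= v1 (hs1 1) /base; lia.
  + case: m1 s1 v1 f1 {st p1} => /= p rg ce [/= hs1 hs2] v1 f1 d' hd'.
    have -> : (d'.*2.+1 == d.*2.+1) = false by lia.
    have -> : (d'.*2.+1 == d.+1.*2.+1) = false by lia.
    exact: f1.
Qed.

Lemma step_at_next prog i code s : at_code prog (pc s) (i :: code) ->
  pc (exec i s) = (pc s).+1 ->
  steps prog 1 s (exec i s) /\ at_code prog (pc (exec i s)) code.
Proof. by move=> h ->; apply: step_at. Qed.

Lemma ccmd_if pos e c1 c2 :
  let l1 := pos + size (cexpr 0 e) + 1 in let k1 := ccmd l1 c1 in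
  let l2 := l1 + size k1 + 2 in let k2 := ccmd l2 c2 in
  ccmd pos (If e c1 c2) = cexpr 0 e ++ [:: Jz 1 l2] ++ k1 ++
    [:: Const 1 0; Jz 1 (l2 + size k2)] ++ k2.
Proof. by []. Qed.

Lemma ccmd_while pos e c :
  let l1 := pos + size (cexpr 0 e) + 1 in let k1 := ccmd l1 c in
  ccmd pos (While e c) = cexpr 0 e ++ [:: Jz 1 (l1 + size k1 + 2)] ++ k1 ++
    [:: Const 1 0; Jz 1 pos].
Proof. by []. Qed.

(** Each tick of the clock pays for at most b instructions. The bound b is kept apart from the size
    of the code, so that one b serves for all subcommands; adding [k] on the left avoids a truncated
    subtraction. *)
Lemma ccmd_correct c s s' : run c s s' -> forall prog ms b,
    at_code prog (pc ms) (ccmd (pc ms) c) -> size (ccmd (pc ms) c) <= b -> sim s ms ->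
  exists k ms', [/\ steps prog k ms ms', pc ms' = pc ms + size (ccmd (pc ms) c),
    sim s' ms' & k + b * clock s <= b * clock s'].
Proof.
elim=> {c s s'}.
- by move=> s prog ms b _ _ hs; exists 0, ms; rewrite /= addn0.
- move=> r e s prog ms b /= /at_code_cat[h1 h2]; rewrite size_cat /= => hb hs.
  have [m1 [r1 p1 s1 v1 _]] := cexpr_correct h1 hs.
  rewrite -p1 in h2.
  have [|st2 h3] := step_at_next h2; first by case: (m1).
  have [|st3 h4] := step_at_next h3; first by case: (m1).
  have st := steps_trans r1 (steps_trans st2 st3).
  exists (size (cexpr 0 e) + 2); eexists; split; first exact: st.
  + by rewrite addnA -p1; case: (m1) => /= *; rewrite addn2.
  + case: m1 s1 v1 {st st2 h3 st3 h4 h2 p1 r1} => /= p rg ce [/= hs1 hs2] v1; split=> //= r'.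
    have e2 : (1 == r.*2) = false by lia.
    rewrite !eqxx e2 v1 add0n -[r'.*2 == _]/(r'.*2 == r.*2).
    have -> : (r'.*2 == r.*2) = (r' == r) by lia.
    by case: eqP => // _; rewrite hs1.
  + by rewrite /= mulnS leq_add2r.
- move=> e1 e2 s prog ms b /= /at_code_cat[h1 /at_code_cat[h2 h3]]; rewrite !size_cat /= => hb hs.
  have [m1 [r1 p1 s1 v1 _]] := cexpr_correct h1 hs.
  rewrite -p1 in h2 h3; have [m2 [r2 p2 s2 v2 f2]] := cexpr_correct h2 s1.
  rewrite -p2 in h3.
  have [|st h4] := step_at_next h3; first by case: (m2).
  have {}st := steps_trans r1 (steps_trans r2 st).
  exists (size (cexpr 0 e1) + (size (cexpr 1 e2) + 1)); eexists; split; first exact: st.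
  + by rewrite !addnA -p1 -p2; case: (m2) => /= *; rewrite addn1.
  + case: m2 s2 v2 f2 {st h3 h4 p2 r2} => /= p rg ce [/= hs1 hs2] v2 f2; split=> //= a.
    have w1 : rg 1 = eval s e1 by rewrite -v1 -(f2 0).
    by rewrite w1 (v2 : rg 3 = _) /= hs2.
  + by rewrite /= mulnS leq_add2r.
- move=> c1 c2 s1 s2 s3 _ IH1 _ IH2 prog ms b /= /at_code_cat[h1 h2]; rewrite size_cat => hb hs.
  have [|k1 [m1 [r1 p1 d1 b1]]] := IH1 _ _ b h1 _ hs; first by apply: leq_trans hb; apply: leq_addr.
  rewrite -p1 in h2 hb *.
  have [|k2 [m2 [r2 p2 d2 b2]]] := IH2 _ _ b h2 _ d1; first by apply: leq_trans hb; apply: leq_addl.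
  exists (k1 + k2), m2; split=> //; first exact: steps_trans r1 r2.
  + by rewrite p2 p1 addnA.
  + by rewrite [k1 + k2]addnC -addnA; apply: leq_trans b2; rewrite leq_add2l.
- move=> e c1 c2 s s' he _ IH prog ms b; rewrite ccmd_if.
  set l1 := pc ms + _ + 1; set k1 := ccmd l1 c1; set l2 := l1 + size k1 + 2; set k2 := ccmd l2 c2.
  move=> /at_code_cat[h1 /at_code_cat[h2 /at_code_cat[h3 h4]]]; rewrite !size_cat /= => hb hs.
  have [m1 [r1 p1 s1 v1 _]] := cexpr_correct h1 hs.
  rewrite -p1 in h2; have hz : (regs m1 1 == 0) = false by rewrite v1 (negbTE he).
  have hp1 : pc (exec (Jz 1 l2) m1) = l1.
    by move: hz p1; case: (m1) => /= p rg ce -> ->; rewrite /l1 addn1.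
  have [|st1 _] := step_at_next h2; first by rewrite hp1 p1 /l1 addn1.
  have sm1 : sim (tick s) (exec (Jz 1 l2) m1) by case: (m1) s1.
  set q := exec _ _ in st1 sm1 hp1.
  have h3' : at_code prog (pc q) (ccmd (pc q) c1) by rewrite hp1.
  have [|k [m2 [r2 p2 d2 b2]]] := IH _ _ b h3' _ sm1.
    by rewrite hp1 -/k1; lia.
  rewrite hp1 -/k1 in p2.
  have [h41 _] := at_code_cat (h4 : at_code prog (l1 + size k1) _); rewrite -p2 in h41.
  have [|st2 h5] := step_at_next h41; first by case: (m2).
  have [st3 _] := step_at h5.
  exists (size (cexpr 0 e) + (1 + (k + (1 + 1)))); eexists; split.
  + exact: steps_trans r1 (steps_trans st1 (steps_trans r2 (steps_trans st2 st3))).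
  + case: (m2) => /= *; rewrite /l2 /l1; lia.
  + case: m2 d2 {st2 st3 h5 h41 r2 p2} => /= p rg ce [/= hs1 hs2]; split=> //= r.
    have -> : (r.*2 == 1) = false by lia.
    by rewrite hs1.
  + move: b2 hb; rewrite [clock (tick s)]/= mulnS; clear. lia.
- move=> e c1 c2 s s' he _ IH prog ms b; rewrite ccmd_if.
  set l1 := pc ms + _ + 1; set k1 := ccmd l1 c1; set l2 := l1 + size k1 + 2; set k2 := ccmd l2 c2.
  move=> /at_code_cat[h1 /at_code_cat[h2 /at_code_cat[h3 /at_code_cat[_ h4]]]]; rewrite !size_cat /= => hb hs.
  have [m1 [r1 p1 s1 v1 _]] := cexpr_correct h1 hs.
  rewrite -p1 in h2; have hz : (regs m1 1 == 0) by rewrite v1 he.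
  have hp1 : pc (exec (Jz 1 l2) m1) = l2.
    by move: hz; case: (m1) => /= p rg ce ->.
  have [st1 _] := step_at h2.
  have sm1 : sim (tick s) (exec (Jz 1 l2) m1) by case: (m1) s1.
  set q := exec _ _ in st1 sm1 hp1.
  have h4' : at_code prog (pc q) (ccmd (pc q) c2) by rewrite hp1.
  have [|k [m2 [r2 p2 d2 b2]]] := IH _ _ b h4' _ sm1; first by rewrite hp1 -/k2; lia.
  rewrite hp1 -/k2 in p2.
  exists (size (cexpr 0 e) + (1 + k)), m2; split=> //.
  + exact: steps_trans r1 (steps_trans st1 r2).
  + rewrite p2 /l2 /l1; lia.
  + move: b2 hb; rewrite [clock (tick s)]/= mulnS; clear. lia.
- move=> e c s1 s2 s3 he _ IH1 _ IH2 prog ms b hw; move: (hw); rewrite ccmd_while.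
  set l1 := pc ms + _ + 1; set k1 := ccmd l1 c; set l2 := l1 + size k1 + 2.
  move=> /at_code_cat[h1 /at_code_cat[h2 /at_code_cat[h3 h4]]]; rewrite !size_cat /= => hb hs.
  have [m1 [r1 p1 d1 v1 _]] := cexpr_correct h1 hs.
  rewrite -p1 in h2; have hz : (regs m1 1 == 0) = false by rewrite v1 (negbTE he).
  have hp1 : pc (exec (Jz 1 l2) m1) = l1.
    by move: hz p1; case: (m1) => /= p rg ce -> ->; rewrite /l1 addn1.
  have [|st1 _] := step_at_next h2; first by rewrite hp1 p1 /l1 addn1.
  have sm1 : sim (tick s1) (exec (Jz 1 l2) m1) by case: (m1) d1.
  set q := exec _ _ in st1 sm1 hp1.
  have h3' : at_code prog (pc q) (ccmd (pc q) c) by rewrite hp1.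
  have [|k [m2 [r2 p2 d2 b2]]] := IH1 _ _ b h3' _ sm1; first by rewrite hp1 -/k1; lia.
  rewrite hp1 -/k1 in p2.
  have h41 : at_code prog (l1 + size k1) _ := h4; rewrite -p2 in h41.
  have [|st2 h5] := step_at_next h41; first by case: (m2).
  have [st3 _] := step_at h5.
  set m3 := exec _ (exec _ m2) in st3.
  have p3 : pc m3 = pc ms by rewrite /m3; case: (m2).
  have s3' : sim s2 m3.
    rewrite /m3; case: m2 d2 {st2 st3 h5 h41 r2 p2 p3 m3} => /= p rg ce [/= hs1 hs2]; split=> //= r.
    have -> : (r.*2 == 1) = false by lia.
    by rewrite hs1.
  (* Control is back at the test, so the remaining iterations run the same code from the same
     position. *)
  have hw' : at_code prog (pc m3) (ccmd (pc m3) (While e c)) by rewrite p3.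
  have [|k' [m4 [r4 p4 d4 b4]]] := IH2 _ _ b hw' _ s3'.
    rewrite p3 ccmd_while !size_cat /= -/l1 -/k1; lia.
  exists (size (cexpr 0 e) + (1 + (k + (1 + (1 + k'))))), m4; split=> //.
  + exact: steps_trans r1 (steps_trans st1 (steps_trans r2 (steps_trans st2 (steps_trans st3 r4)))).
  + rewrite p4 p3 ccmd_while !size_cat /= -/l1 -/k1; lia.
  + move: b2 b4 hb; rewrite [clock (tick s1)]/= mulnS; clear. lia.
- move=> e c s he prog ms b; rewrite ccmd_while.
  set l1 := pc ms + _ + 1; set k1 := ccmd l1 c; set l2 := l1 + size k1 + 2.
  move=> /at_code_cat[h1 /at_code_cat[h2 _]]; rewrite !size_cat /= => hb hs.
  have [m1 [r1 p1 d1 v1 _]] := cexpr_correct h1 hs.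
  rewrite -p1 in h2; have hz : (regs m1 1 == 0) by rewrite v1 he.
  have [st1 _] := step_at h2.
  exists (size (cexpr 0 e) + 1), (exec (Jz 1 l2) m1); split.
  + exact: steps_trans r1 st1.
  + move: hz; case: (m1) => /= p rg ce ->; rewrite /l2 /l1; lia.
  + by case: (m1) d1.
  + by rewrite /= mulnS leq_add2r; move: hb; clear; lia.
Qed.

Lemma compiled_run c ss s' : run c (CState (fun=> 0) (nth 0 (encode ss)) 0) s' ->
  exists k ms, [/\ halts_in (ccmd 0 c) (init_state ss) k ms,
    k <= size (ccmd 0 c) * clock s', regs ms 0 = vars s' 0 & cells ms =1 memory s'].
Proof.
move=> hr.
have h0 : at_code (ccmd 0 c) (pc (init_state ss)) (ccmd (pc (init_state ss)) c) by [].
have [//|k [ms [r1 p1 [s1 s2] b1]]] := ccmd_correct hr h0 (leqnn _) _.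
exists k, ms; split=> //.
- split=> //; rewrite /step p1 add0n.
  by rewrite onth_default.
- by move: b1; rewrite muln0 addn0.
- exact: (s1 0).
Qed.

(** * Program logic *)

Definition arr (s : cstate) (a i : nat) : nat := memory s (base s + (16 * i + a)).
Definition store_arr (s : cstate) (a i v : nat) := store s (base s + (16 * i + a)) v.
Notation Get a e := (Peek (Addr a e)).
Notation Put a e1 e2 := (Store (Addr a e1) e2).
(** The bound e is evaluated anew before each round; a round costs two ticks besides the body. *)
Definition For i e c :=
  Seq (Asg i (Cst 0))
      (While (Minus e (Var i)) (Seq c (Asg i (Plus (Var i) (Cst 1))))).

Lemma vars_asg s r v r' : vars (asg s r v) r' = if r' == r then v else vars s r'.
Proof. by []. Qed.
Lemma vars_tick s r : vars (tick s) r = vars s r. Proof. by []. Qed.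
Lemma vars_store_arr s a i v r : vars (store_arr s a i v) r = vars s r. Proof. by []. Qed.
Lemma clock_asg s r v : clock (asg s r v) = (clock s).+1. Proof. by []. Qed.
Lemma clock_tick s : clock (tick s) = (clock s).+1. Proof. by []. Qed.
Lemma clock_store_arr s a i v : clock (store_arr s a i v) = (clock s).+1. Proof. by []. Qed.
Lemma arr_tick s a i : arr (tick s) a i = arr s a i. Proof. by []. Qed.
Lemma arr_asg s r v a i : r != 1 -> arr (asg s r v) a i = arr s a i.
Proof. by rewrite /arr /base /asg /= eq_sym => /negbTE->. Qed.
Lemma arr_store_arr s a i v a' i' : (a < 16) && (a' < 16) ->
  arr (store_arr s a i v) a' i' = if (a' == a) && (i' == i) then v else arr s a' i'.
Proof.
case/andP=> h h'; rewrite /arr /store_arr /base /store /= eqn_add2l.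
by have -> : (16 * i' + a' == 16 * i + a) = (a' == a) && (i' == i) by lia.
Qed.

Lemma eval_var s r : eval s (Var r) = vars s r. Proof. by []. Qed.
Lemma eval_cst s c : eval s (Cst c) = c. Proof. by []. Qed.
Lemma eval_plus s e1 e2 : eval s (Plus e1 e2) = eval s e1 + eval s e2. Proof. by []. Qed.
Lemma eval_minus s e1 e2 : eval s (Minus e1 e2) = eval s e1 - eval s e2. Proof. by []. Qed.
Lemma eval_get s a e : eval s (Get a e) = arr s a (eval s e). Proof. by []. Qed.
Arguments eval : simpl never.
Arguments asg : simpl never.
Arguments tick : simpl never.
Arguments store_arr : simpl never.
Arguments arr : simpl never.
Definition evalE := (eval_var, eval_cst, eval_plus, eval_minus, eval_get).
Definition stateE := (vars_asg, vars_tick, vars_store_arr, clock_asg, clock_tick,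
  clock_store_arr, arr_tick).

(** Total correctness: termination is part of the claim, since [run] is a finite derivation. *)
Definition wp c (Q : cstate -> Prop) s := exists2 s', run c s s' & Q s'.

Lemma wp_conseq c (Q Q' : cstate -> Prop) s : wp c Q s -> (forall s', Q s' -> Q' s') -> wp c Q' s.
Proof. by move=> [s' r q] h; exists s' => //; apply: h. Qed.

Lemma wp_skip (Q : cstate -> Prop) s : Q s -> wp Skip Q s.
Proof. by move=> h; exists s => //; apply: RunSkip. Qed.

Lemma wp_asg r e (Q : cstate -> Prop) s : Q (asg s r (eval s e)) -> wp (Asg r e) Q s.
Proof. by move=> h; eexists; [apply: RunAsg|]. Qed.

Lemma wp_put a e1 e2 (Q : cstate -> Prop) s :
  Q (store_arr s a (eval s e1) (eval s e2)) -> wp (Put a e1 e2) Q s.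
Proof. by move=> h; eexists; [apply: RunStore|]. Qed.

Lemma wp_seq c1 c2 (Q : cstate -> Prop) s : wp c1 (wp c2 Q) s -> wp (Seq c1 c2) Q s.
Proof. by move=> [s1 r1 [s2 r2 q]]; exists s2 => //; apply: RunSeq r1 r2. Qed.

Lemma wp_if e c1 c2 (Q : cstate -> Prop) s :
  (eval s e != 0 -> wp c1 Q (tick s)) -> (eval s e = 0 -> wp c2 Q (tick s)) ->
  wp (If e c1 c2) Q s.
Proof.
move=> h1 h2; have [h|h] := eqVneq (eval s e) 0.
  by have [s' r q] := h2 h; exists s' => //; apply: RunIfF.
by have [s' r q] := h1 h; exists s' => //; apply: RunIfT.
Qed.

Lemma wp_while (I : cstate -> Prop) (M : cstate -> nat) e c (Q : cstate -> Prop) s :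
  I s ->
  (forall s, I s -> eval s e != 0 -> wp c (fun s' => I s' /\ M s' < M s) (tick s)) ->
  (forall s, I s -> eval s e = 0 -> Q (tick s)) ->
  wp (While e c) Q s.
Proof.
move=> Is step fin; have [m] := ubnP (M s); elim: m s Is => // m IH s Is hm.
have [h|h] := eqVneq (eval s e) 0.
  by exists (tick s); [apply: RunWhileF|apply: fin].
have [s1 r1 [I1 m1]] := step _ Is h.
have [|s2 r2 q] := IH _ I1; first by apply: leq_trans m1 _.
by exists s2 => //; apply: RunWhileT r1 r2.
Qed.

(** * Frames: what a command leaves unchanged *)

Fixpoint mvars c : seq nat :=
  match c with
  | Asg r _ => [:: r]
  | Seq c1 c2 | If _ c1 c2 => mvars c1 ++ mvars c2
  | While _ c1 => mvars c1
  | _ => [::]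
  end.

Fixpoint marrs c : seq nat :=
  match c with
  | Store (Addr a _) _ => [:: a]
  | Seq c1 c2 | If _ c1 c2 => marrs c1 ++ marrs c2
  | While _ c1 => marrs c1
  | _ => [::]
  end.

(** Stores must go through an array address, which is never below the base, and the base must not be
    assigned; so a framed command cannot alter the input cells. *)
Fixpoint framed c : bool :=
  match c with
  | Skip => true
  | Asg r _ => r != 1
  | Store (Addr a _) _ => a < 16
  | Store _ _ => false
  | Seq c1 c2 | If _ c1 c2 => framed c1 && framed c2
  | While _ c1 => framed c1
  end.

Record same (vs aa : seq nat) (s s' : cstate) : Prop := Same {
  same_var : forall r, r \notin vs -> vars s' r = vars s r;
  same_arr : forall a i, (a < 16) && (a \notin aa) -> arr s' a i = arr s a i;
  same_base : base s' = base s;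
  same_in : forall p, p < base s -> memory s' p = memory s p }.

Lemma same_refl vs aa s : same vs aa s s. Proof. by []. Qed.

Lemma same_tick vs aa s s' : same vs aa s s' -> same vs aa s (tick s').
Proof. by case=> *; split. Qed.

Lemma same_tickl vs aa s s' : same vs aa (tick s) s' -> same vs aa s s'.
Proof. by case=> *; split. Qed.

Lemma same_trans vs aa s1 s2 s3 : same vs aa s1 s2 -> same vs aa s2 s3 -> same vs aa s1 s3.
Proof.
move=> [a1 b1 c1 d1] [a2 b2 c2 d2]; split=> //.
- by move=> r h; rewrite a2 // a1.
- by move=> a i h; rewrite b2 // b1.
- by rewrite c2.
- by move=> p h; rewrite d2 ?c1 // d1.
Qed.

Lemma same_mono vs aa vs' aa' s s' : {subset vs <= vs'} -> {subset aa <= aa'} ->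
  same vs aa s s' -> same vs' aa' s s'.
Proof.
move=> h1 h2 [a b c d]; split=> //.
- by move=> r h; apply: a; apply: contra h; apply: h1.
- by move=> x i /andP[hx h]; apply: b; rewrite hx; apply: contra h; apply: h2.
Qed.

Lemma same_asg vs aa s s' r v : r != 1 -> r \in vs -> same vs aa s s' -> same vs aa s (asg s' r v).
Proof.
move=> r1 h [a b c d]; split=> //.
- by move=> r' h'; rewrite vars_asg; case: eqP => [E|_]; [rewrite E h in h'|apply: a].
- by move=> x i hx; rewrite arr_asg // b.
- by rewrite /base vars_asg eq_sym (negbTE r1).
Qed.

Lemma same_store_arr vs aa s s' a i v : a < 16 -> a \in aa ->
  same vs aa s s' -> same vs aa s (store_arr s' a i v).
Proof.
move=> ha aaa [h1 h2 h3 h4]; split=> //.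
- move=> b j /andP[hb nb]; rewrite arr_store_arr ?ha //.
  by case: eqP nb => [->|_ nb /=]; rewrite ?aaa // h2 // hb.
- move=> p hp; rewrite /store_arr /store /= h3; case: eqP => [E|_]; last exact: h4.
  by move: hp; rewrite E ltnNge leq_addr.
Qed.

Lemma run_same c s s' : run c s s' -> framed c -> same (mvars c) (marrs c) s s'.
Proof.
elim=> {c s s'} //=.
- by move=> r e s r1; apply: same_asg => //; rewrite inE.
- move=> [] // a e1 e2 s ha.
  by apply: (@same_store_arr _ _ s s a (eval s e1)) => //; rewrite inE.
- move=> c1 c2 s1 s2 s3 _ IH1 _ IH2 /andP[/IH1 h1 /IH2 h2].
  by apply: (same_trans (s2 := s2)); [apply: same_mono h1|apply: same_mono h2] => x;
    rewrite mem_cat => ->; rewrite ?orbT.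
- move=> e c1 c2 s s' _ _ IH /andP[/IH h _]; apply: same_tickl.
  by apply: same_mono h => x; rewrite mem_cat => ->.
- move=> e c1 c2 s s' _ _ IH /andP[_ /IH h]; apply: same_tickl.
  by apply: same_mono h => x; rewrite mem_cat => ->; rewrite orbT.
- by move=> e c s1 s2 s3 _ _ IH1 _ IH2 h; apply: same_tickl; apply: same_trans (IH1 h) (IH2 h).
Qed.

Lemma wp_same c (Q : cstate -> Prop) s : framed c -> wp c Q s ->
  wp c (fun s' => same (mvars c) (marrs c) s s' /\ Q s') s.
Proof. by move=> f [s' r q]; exists s' => //; split=> //; apply: run_same. Qed.

(** The frame of the body is handed to the premises, so that an invariant need only mention what the
    body changes. As the loop keeps evaluating its bound, the bound must equal N in every state
    within the frame. After a round the invariant is required with the counter already increased. *)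
Lemma wp_for i e c (Q : cstate -> Prop) s N (I : nat -> cstate -> Prop) :
  framed c -> (i != 1) && (i \notin mvars c) ->
  (forall s', same (i :: mvars c) (marrs c) s s' -> eval s' e = N) ->
  I 0 (asg s i 0) ->
  (forall k s1, k < N -> same (i :: mvars c) (marrs c) s s1 -> vars s1 i = k -> I k s1 ->
     wp c (fun s2 => same (mvars c) (marrs c) s1 s2 -> I k.+1 (asg s2 i k.+1)) (tick s1)) ->
  (forall s', same (i :: mvars c) (marrs c) s s' -> I N s' -> Q (tick s')) ->
  wp (For i e c) Q s.
Proof.
move=> fc /andP[i1 ic] eE I0 step fin; apply: wp_seq; apply: wp_asg; rewrite evalE.
pose J s' := exists k, [/\ k <= N, same (i :: mvars c) (marrs c) s s', vars s' i = k & I k s'].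
apply: (wp_while (I := J) (M := fun s' => N - vars s' i)).
- exists 0; split=> //; last by rewrite vars_asg eqxx.
  by apply: same_asg => //; rewrite inE eqxx.
- move=> s1 [k [kN sm vk Ik]]; rewrite !evalE eE // vk => hk; have {}hk : k < N by lia.
  apply: wp_seq; apply: wp_conseq (wp_same fc (step _ _ hk sm vk Ik)) _ => s2 [sm2 h2].
  apply: wp_asg; rewrite !evalE (same_var sm2) // vars_tick vk addn1; split.
    have sm' : same (i :: mvars c) (marrs c) s1 s2.
      by apply: same_tickl; apply: same_mono sm2 => // x h; rewrite inE h orbT.
    exists k.+1; split=> //; last by apply: h2; apply: same_tickl.
    + by apply: same_asg => //; [rewrite inE eqxx|apply: same_trans sm sm'].
    + by rewrite vars_asg eqxx.
  by rewrite vars_asg eqxx; lia.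
- move=> s1 [k [kN sm vk Ik]]; rewrite !evalE eE // vk => hk.
  by apply: fin => //; have -> : N = k by lia.
Qed.

(** * Growing the chains *)

(* Variables:  1 base   2 n   3 n^2   4 W   5 number of elements   6 l
     7 length of the output   8 pointer   10 j (target)   12 x (element)
     13 u (head)   14 k (level)   15 rank   17 found   18, 19 y, z
     9, 16, 20, 21, 22 loop counters.
   Arrays:  0 membership of x in P i, at i * W + x      1 distinct elements
     2 elements met so far    3 sizes of the input sets    4 their addresses
     5 multiples of W         6 source of each head
     7 chain of head u, at u * W + t                    8 its length
     9 membership of x in head u, at u * W + x
     10 #|P i - head u|, at u * W + i
     11 pointer of head u into chain v, at u * W + v
     12 see [seen_count]      13 output.
   The row width W exceeds n^2 and every element. *)
Definition append : cmd :=
  Seq (Put 7 (Plus (Get 5 (Var 13)) (Get 8 (Var 13))) (Var 18))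
 (Seq (Put 8 (Var 13) (Plus (Get 8 (Var 13)) (Cst 1)))
 (Seq (Put 9 (Plus (Get 5 (Var 13)) (Var 18)) (Cst 1))
 (For 22 (Var 2)
   (If (Get 0 (Plus (Get 5 (Var 22)) (Var 18)))
     (Put 10 (Plus (Get 5 (Var 13)) (Var 22))
        (Minus (Get 10 (Plus (Get 5 (Var 13)) (Var 22))) (Cst 1)))
     Skip)))).

(** Truncated subtraction encodes Boolean connectives: [1 - a] negates, a sum is a disjunction, and
    a difference is nonzero exactly for a strict inequality. What is read at a pointer past the end
    of the chain cannot affect the test. There is no early exit: all chains are scanned, and a later
    find replaces an earlier one. *)
Definition search : cmd :=
  For 16 (Var 3)
   (Seq (Asg 8 (Get 11 (Plus (Get 5 (Var 13)) (Var 16))))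
   (Seq (While (Minus (Cst 1) (Plus
                  (Minus (Cst 1) (Minus (Get 8 (Var 16)) (Var 8)))
                  (Minus (Cst 1) (Get 9 (Plus (Get 5 (Var 13))
                     (Get 7 (Plus (Get 5 (Var 16)) (Var 8))))))))
          (Asg 8 (Plus (Var 8) (Cst 1))))
   (Seq (Put 11 (Plus (Get 5 (Var 13)) (Var 16)) (Var 8))
   (If (Minus (Get 8 (Var 16)) (Var 8))
      (Seq (Asg 19 (Get 7 (Plus (Get 5 (Var 16)) (Var 8))))
      (If (Get 0 (Plus (Get 5 (Var 10)) (Var 19)))
        (If (Minus (Cst 2) (Get 10 (Plus (Get 5 (Var 13)) (Get 6 (Var 16)))))
          (Seq (Asg 17 (Cst 1)) (Asg 18 (Var 19)))
          Skip)
        Skip))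
      Skip)))).

Definition emit : cmd :=
  Seq (Put 13 (Cst 0) (Plus (Get 13 (Cst 0)) (Cst 1)))
 (Seq (Put 13 (Var 7) (Get 8 (Var 13)))
 (Seq (Asg 7 (Plus (Var 7) (Cst 1)))
 (For 20 (Get 8 (Var 13))
   (Seq (Put 13 (Var 7) (Get 7 (Plus (Get 5 (Var 13)) (Var 20))))
        (Asg 7 (Plus (Var 7) (Cst 1))))))).

(** The element x is the default; a successful search replaces it by one whose extension is already
    in the span, and then nothing is output. *)
Definition process : cmd :=
  Seq (Asg 17 (Cst 0)) (Seq (Asg 18 (Var 12))
 (Seq search (Seq append (If (Var 17) Skip emit)))).

(** A sum of the two opposite differences vanishes exactly when the numbers agree. The counter of
    array 12 is compared with the number of all missing elements of the target: equality singles out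
    the last of them to pass, and the counter is then cleared for the next level. *)
Definition visit : cmd :=
  If (Minus (Cst 1) (Plus (Minus (Get 8 (Var 13)) (Var 14)) (Minus (Var 14) (Get 8 (Var 13)))))
    (If (Get 9 (Plus (Get 5 (Var 13)) (Var 12)))
      Skip
      (Seq (Put 12 (Var 13) (Plus (Get 12 (Var 13)) (Cst 1)))
      (If (Plus (Minus (Get 12 (Var 13)) (Get 10 (Plus (Get 5 (Var 13)) (Var 10))))
                (Minus (Get 10 (Plus (Get 5 (Var 13)) (Var 10))) (Get 12 (Var 13))))
        Skip
        (Seq (Put 12 (Var 13) (Cst 0)) process))))
    Skip.

(** The heads with target j are j, j + n, j + 2n and so on, reached by additions alone. *)
Definition visit_target : cmd :=
  Seq (Asg 13 (Var 10)) (For 9 (Var 2) (Seq visit (Asg 13 (Plus (Var 13) (Var 2))))).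

Definition visit_element : cmd :=
  For 10 (Var 2) (If (Get 0 (Plus (Get 5 (Var 10)) (Var 12))) visit_target Skip).

Definition do_level : cmd :=
  For 15 (Var 5) (Seq (Asg 12 (Get 1 (Var 15))) visit_element).

(** A head of size $2\ell$ already contains its target, so the levels below $2\ell$ suffice. *)
Definition do_levels : cmd := For 14 (Plus (Var 6) (Var 6)) do_level.

(** * Memory layout and the commands on a single head *)

Section Program.

Variables (ss : seq (seq nat)) (W L : nat) (nm : seq nat).
Let n := size ss.
Let U := n * n.
Let P i := nth [::] ss i.
Hypothesis uniq_ss : all uniq ss.
Hypothesis ltW : forall i x, x \in P i -> x < W.
Hypothesis ltUW : U < W.

Record static (s : cstate) : Prop := Static {
  st_n : vars s 2 = n;
  st_U : vars s 3 = U;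
  st_E : vars s 5 = size nm;
  st_L : vars s 6 = L;
  st_row : forall v, v < U -> arr s 5 v = v * W;
  st_pa : forall v, v < U -> arr s 6 v = v %/ n;
  st_bit : forall i x, i < n -> x < W -> arr s 0 (i * W + x) = (x \in P i);
  st_nm : forall r, r < size nm -> arr s 1 r = nth 0 nm r }.

Record heads (s : cstate) (f : nat -> seq nat) : Prop := Heads {
  hd_len : forall u, u < U -> arr s 8 u = size (f u);
  hd_fc : forall u t, u < U -> t < size (f u) -> arr s 7 (u * W + t) = nth 0 (f u) t;
  hd_in : forall u x, u < U -> x < W -> arr s 9 (u * W + x) = (x \in f u);
  hd_cnt : forall u i, u < U -> i < n ->
    arr s 10 (u * W + i) = count [pred x | x \notin f u] (P i) }.

Definition bounded (f : nat -> seq nat) :=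
  forall u, u < U -> uniq (f u) /\ forall x, x \in f u -> x < W.

Definition out (s : cstate) gs :=
  vars s 7 = size (encode gs) /\
  forall q, q < size (encode gs) -> arr s 13 q = nth 0 (encode gs) q.

Definition pointers (s : cstate) (f : nat -> seq nat) :=
  forall u v, u < U -> v < U -> arr s 11 (u * W + v) <= size (f v) /\
    {subset take (arr s 11 (u * W + v)) (f v) <= f u}.

Lemma same_static vs aa s s' : same vs aa s s' ->
  all (fun r => r \notin vs) [:: 2; 3; 5; 6] -> all (fun a => a \notin aa) [:: 0; 1; 5; 6] ->
  static s -> static s'.
Proof.
move=> sm /and5P[v2 v3 v5 v6 _] /and5P[a0 a1 a5 a6 _] [s1 s2 s3 s4 s5 s6 s7 s8].
by split; rewrite ?(same_var sm) //= => *; rewrite (same_arr sm) ?s5 ?s6 ?s7 ?s8.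
Qed.

Lemma idx_eq u x u' x' : x < W -> x' < W ->
  (u * W + x == u' * W + x') = (u == u') && (x == x').
Proof.
move=> h h'; have W0 : 0 < W by apply: leq_ltn_trans h.
apply/eqP/andP => [E|[/eqP-> /eqP->]//].
have := congr1 (divn^~ W) E; rewrite !divnMDl // !divn_small // !addn0 => Eu.
by move: E; rewrite Eu => /addnI ->.
Qed.

Lemma nU i : i < n -> i < U.
Proof. by rewrite /U => h; apply: (leq_trans h); rewrite leq_pmulr //; apply: leq_ltn_trans h. Qed.

Lemma size_bounded f u : bounded f -> u < U -> size (f u) <= W.
Proof.
move=> b hu; have [uf lf] := b _ hu; rewrite -(size_iota 0 W).
by apply: uniq_leq_size => // x /lf; rewrite mem_iota.
Qed.

(** Room in the row: the position at which y is appended stays below the row width. *)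
Lemma size_bounded_lt f u y : bounded f -> u < U -> y < W -> y \notin f u -> size (f u) < W.
Proof.
move=> b hu hy ny; have [uf lf] := b _ hu; rewrite -(size_iota 0 W).
apply: (uniq_leq_size (s1 := y :: f u)); first by rewrite /= ny.
by move=> x; rewrite inE mem_iota => /predU1P[->|/lf].
Qed.

Lemma count_rcons_notin (s : seq nat) y (Q : seq nat) : uniq Q -> y \notin s ->
  count [pred x | x \notin rcons s y] Q = count [pred x | x \notin s] Q - (y \in Q).
Proof.
move=> uQ ny.
have -> : count [pred x | x \notin s] Q =
    count [pred x | x \notin rcons s y] Q + count (pred1 y) Q.
  have z : count (predI [pred x | x \notin rcons s y] (pred1 y)) Q = 0.
    rewrite -[RHS](count_pred0 Q); apply: eq_count => x /=; rewrite mem_rcons inE.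
    by case: eqP => //= _; rewrite andbF.
  rewrite -count_predUI z addn0; apply: eq_count => x /=; rewrite mem_rcons inE.
  by case: eqVneq => [->|_] /=; rewrite ?orbF ?ny.
by rewrite count_uniq_mem // addnK.
Qed.

Lemma uniq_Pi i : uniq (P i).
Proof. exact: uniq_P. Qed.

Lemma append_spec s f u y : static s -> heads s f -> bounded f -> u < U ->
  vars s 13 = u -> vars s 18 = y -> y < W -> y \notin f u ->
  wp append (fun s' => heads s' (upd f u (rcons (f u) y)) /\
     clock s' <= clock s + (4 * n + 5)) s.
Proof.
move=> st hd bd hu vu vy yW ny.
have szW := size_bounded_lt bd hu yW ny.
apply: wp_seq; apply: wp_put; rewrite !evalE.
apply: wp_seq; apply: wp_put; rewrite !evalE.
apply: wp_seq; apply: wp_put; rewrite !evalE.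
rewrite !(stateE, arr_store_arr) //= vu vy (st_row st) // (hd_len hd) //.
set s1 := store_arr _ 9 _ _.
(* The counts of row u, updated for the first k sets only. *)
pose c k u' i := if (u' == u) && (i < k) then count [pred x | x \notin rcons (f u) y] (P i)
  else count [pred x | x \notin f u'] (P i).
have st1 : static s1.
  by case: st => *; split => *; rewrite /s1 !(stateE, arr_store_arr) //=; auto.
pose I k s2 := (forall u' i, u' < U -> i < n -> arr s2 10 (u' * W + i) = c k u' i) /\
  clock s2 <= clock s + 4 * k + 4.
apply: (wp_for (N := n) (I := I)) => //.
- by move=> s' sm; rewrite evalE (same_var sm) // (st_n st1).
- split; last by rewrite /s1 !stateE; lia.
  move=> u' i hu' hi; rewrite arr_asg // /c ltn0 andbF /s1 !arr_store_arr //=.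
  exact: (hd_cnt hd).
- move=> k s2 hk sm vk [Ic It].
  have st2 : static s2 by apply: same_static sm _ _ st1.
  have e13 : vars s2 13 = u by rewrite (same_var sm) // /s1 !stateE.
  have e18 : vars s2 18 = y by rewrite (same_var sm) // /s1 !stateE.
  have kU := nU hk; have kW := ltn_trans kU ltUW.
  have Ec : c k.+1 u k = c k u k - (y \in P k).
    by rewrite /c eqxx ltnn ltnSn /= count_rcons_notin ?uniq_Pi.
  have Ec' u' i : (u' == u) && (i == k) = false -> c k.+1 u' i = c k u' i.
    by rewrite /c ltnS (leq_eqVlt i); case: (u' == u) => //= ->.
  have E0 : eval (tick s2) (Get 0 (Plus (Get 5 (Var 22)) (Var 18))) = (y \in P k).
    by rewrite !(evalE, stateE) vk e18 (st_row st2) // (st_bit st2).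
  apply: wp_if; rewrite E0 => hy.
    apply: wp_put; rewrite !evalE !stateE e13 vk (st_row st2) // => _.
    split; last by rewrite !stateE; lia.
    move=> u' i hu' hi; rewrite arr_asg // arr_store_arr //=.
    have iW := ltn_trans (nU hi) ltUW; rewrite idx_eq //.
    case: ifP => [/andP[/eqP-> /eqP->]|/Ec' ->]; last by rewrite !stateE Ic.
    by rewrite Ec Ic // [in RHS](_ : y \in P k = 1%N :> nat) //; case: (_ \in _) hy.
  apply: wp_skip => _; split; last by rewrite !stateE; lia.
  move=> u' i hu' hi; rewrite arr_asg // !stateE Ic //.
  case: (boolP ((u' == u) && (i == k))) => [/andP[/eqP-> /eqP->]|/negbTE/Ec' -> //].
  by rewrite Ec hy subn0.
- move=> s' sm [Ic It]; split; last first.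
    by move: It; rewrite !stateE; lia.
  have A a i : a \in [:: 7; 8; 9] -> arr (tick s') a i = arr s1 a i.
    by rewrite stateE; move=> h; rewrite (same_arr sm) //; move: h; rewrite !inE => /or3P[]/eqP->.
  split.
  + move=> u' hu'; rewrite A // /s1 !arr_store_arr //= /upd.
    by case: eqVneq => [_|_]; rewrite ?size_rcons ?addn1 ?(hd_len hd).
  + move=> u' t hu'; rewrite A // /s1 !arr_store_arr //= /upd.
    have szu := size_bounded bd hu'.
    case: eqVneq => [->|nu] ht.
      rewrite nth_rcons; move: ht; rewrite size_rcons ltnS leq_eqVlt.
      case: eqVneq => [->|nt /= lt]; first by rewrite eqxx ltnn.
      rewrite lt idx_eq ?eqxx ?(negbTE nt) //; last by apply: ltn_trans szW.
      exact: (hd_fc hd).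
    rewrite idx_eq ?(negbTE nu) //; last by apply: leq_trans szu.
    exact: (hd_fc hd).
  + move=> u' x hu' xW; rewrite A // /s1 !arr_store_arr //= /upd idx_eq //.
    case: eqVneq => [->|_] /=; last exact: (hd_in hd).
    by rewrite mem_rcons inE; case: eqP => //= _; apply: (hd_in hd).
  + move=> u' i hu' hi; rewrite stateE Ic // /c hi andbT /upd.
    by case: eqP.
Qed.

(* Potential paying for the inner loop of [search]: it increases by one in every
   iteration of that loop. *)
Definition psi s := \sum_(u < U) \sum_(v < U) arr s 11 (u * W + v).

Lemma psi_eq s s' :
  (forall u v, u < U -> v < U -> arr s' 11 (u * W + v) = arr s 11 (u * W + v)) ->
  psi s' = psi s.
Proof. by move=> h; apply: eq_bigr => u _; apply: eq_bigr => v _; apply: h. Qed.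

(** The old value of the pointer is added on the left rather than subtracted on the right. *)
Lemma psi_upd s s' u v q : u < U -> v < U ->
  (forall u' v', u' < U -> v' < U -> arr s' 11 (u' * W + v') =
     if (u' == u) && (v' == v) then q else arr s 11 (u' * W + v')) ->
  psi s' + arr s 11 (u * W + v) = psi s + q.
Proof.
move=> hu hv h.
have row_u : \sum_(v' < U) arr s' 11 (u * W + v') + arr s 11 (u * W + v) =
    \sum_(v' < U) arr s 11 (u * W + v') + q.
  rewrite (bigD1 (Ordinal hv)) //= [in RHS](bigD1 (Ordinal hv)) //= h // !eqxx /=.
  have -> : \sum_(i < U | i != Ordinal hv) arr s' 11 (u * W + i) =
      \sum_(i < U | i != Ordinal hv) arr s 11 (u * W + i).
    apply: eq_bigr => i ne; rewrite h // eqxx /=.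
    by have /negbTE -> : val i != v by [].
  by rewrite -addnA addnC; congr (_ + _); apply: addnC.
rewrite /psi (bigD1 (Ordinal hu)) //= [in RHS](bigD1 (Ordinal hu)) //=.
have rest : \sum_(i < U | i != Ordinal hu) \sum_(j < U) arr s' 11 (i * W + j) =
    \sum_(i < U | i != Ordinal hu) \sum_(j < U) arr s 11 (i * W + j).
  apply: eq_bigr => i ne; apply: eq_bigr => j _; rewrite h //.
  by have /negbTE -> : val i != u by [].
by rewrite rest addnAC row_u addnAC.
Qed.

(** Because the first missing position is unique, testing the one where the pointer stops settles
    [available] for the whole chain. *)
Lemma first_missing_eq (s t : seq nat) p q : {subset take p s <= t} -> {subset take q s <= t} ->
  nth 0 s p \notin t -> nth 0 s q \notin t -> p < size s -> q < size s -> p = q.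
Proof.
have w a b : a < b -> b < size s -> {subset take b s <= t} -> nth 0 s a \notin t -> False.
  move=> ab bs sub /negP; apply; apply: sub; rewrite -(nth_take 0 ab).
  by rewrite mem_nth // size_takel // ltnW.
by move=> sp sq np nq hp hq; case: (ltngtP p q) => // h; case: (w _ _ h).
Qed.

(** Twice the growth of [psi] pays for the pointer loop, whose rounds take one test and one
    assignment; everything else costs at most 12 ticks per chain. *)
Lemma search_spec s f u j : static s -> heads s f -> bounded f -> pointers s f ->
  u < U -> j < n -> vars s 13 = u -> vars s 10 = j -> vars s 17 = 0 ->
  wp search (fun s' => [/\ pointers s' f,
    clock s' + 2 * psi s <= clock s + (12 * U + 2) + 2 * psi s' &
    (vars s' 17 = 0 /\ vars s' 18 = vars s 18 /\
       forall v p z, available ss f u v p z -> z \notin P j) \/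
    (vars s' 17 <> 0 /\ vars s' 18 \in P j /\ exists v p, available ss f u v p (vars s' 18))]) s.
Proof.
move=> st hd bd pt hu hj v13 v10 v17.
pose R k s1 := (vars s1 17 = 0 /\ vars s1 18 = vars s 18 /\
       forall v p z, v < k -> available ss f u v p z -> z \notin P j) \/
    (vars s1 17 <> 0 /\ vars s1 18 \in P j /\ exists v p, available ss f u v p (vars s1 18)).
pose I k s1 := [/\ pointers s1 f,
    clock s1 + 2 * psi s <= clock s + 12 * k + 1 + 2 * psi s1 & R k s1].
apply: (wp_for (N := U) (I := I)) => //.
- by move=> s' sm; rewrite evalE (same_var sm) // (st_U st).
- split=> //; last by left.
  by rewrite clock_asg [psi (asg _ _ _)](psi_eq (s := s)) //; lia.
- move=> v s1 hv sm vv [pt1 t1 R1].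
  have st1 : static s1 by apply: same_static sm _ _ st.
  have vW : v < W by apply: ltn_trans ltUW.
  have hd1 : heads s1 f.
    by case: hd => h1 h2 h3 h4; split=> *; rewrite (same_arr sm) //; auto.
  have e13 : vars s1 13 = u by rewrite (same_var sm).
  have e10 : vars s1 10 = j by rewrite (same_var sm).
  have [uv lv] := bd _ hv; have szv := size_bounded bd hv.
  have [p0s p0u] := pt1 _ _ hu hv.
  set p0 := arr s1 11 (u * W + v) in p0s p0u.
  apply: wp_seq; apply: wp_asg; rewrite !(evalE, stateE) e13 vv (st_row st1) // -/p0.
  pose J s2 := [/\ same [:: 8] [::] s1 s2, p0 <= vars s2 8 <= size (f v),
    {subset take (vars s2 8) (f v) <= f u} & clock s2 = clock s1 + 2 + 2 * (vars s2 8 - p0)].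
  have condE s2 : J s2 -> eval s2 (Minus (Cst 1) (Plus
                  (Minus (Cst 1) (Minus (Get 8 (Var 16)) (Var 8)))
                  (Minus (Cst 1) (Get 9 (Plus (Get 5 (Var 13))
                     (Get 7 (Plus (Get 5 (Var 16)) (Var 8)))))))) =
      (vars s2 8 < size (f v)) && (nth 0 (f v) (vars s2 8) \in f u) :> nat.
    move=> [sm2 _ _ _]; rewrite !evalE (same_var sm2 (r := 13)) // (same_var sm2 (r := 16)) // e13 vv.
    rewrite (same_arr sm2 (a := 8)) // (hd_len hd1) // !(same_arr sm2 (a := 5)) // !(st_row st1) //.
    case: ltnP => h; last by move/eqP: h => ->; lia.
    rewrite (same_arr sm2 (a := 7)) // (hd_fc hd1) // (same_arr sm2 (a := 9)) // (hd_in hd1) //.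
      by case: (_ \in _); lia.
    by apply: lv; rewrite mem_nth.
  apply: wp_seq; apply: (wp_while (I := J) (M := fun s2 => size (f v) - vars s2 8)).
  + split.
    * by apply: same_asg => //; apply: same_tick; apply: same_refl.
    * by rewrite !stateE leqnn.
    * by rewrite !stateE.
    * by rewrite !stateE /= subnn; lia.
  + move=> s2 J2; rewrite (condE _ J2); case: andP => // -[lt nin] _.
    case: J2 => sm2 /andP[le1 le2] sub2 t2.
    apply: wp_asg; rewrite !(evalE, stateE) addn1; split; last by rewrite /=; lia.
    split; rewrite ?stateE /=.
    * by apply: same_asg => //; apply: same_tick.
    * lia.
    * by move=> y; rewrite (take_nth 0) // mem_rcons inE => /predU1P[->|/sub2].
    * lia.
  + move=> s2 J2; rewrite (condE _ J2); move: J2 => [sm2 /andP[le1 le2] sub2 t2] stop.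
    set p := vars s2 8 in le1 le2 sub2 t2 stop.
    have A2 a i : a < 16 -> arr s2 a i = arr s1 a i by move=> h; rewrite (same_arr sm2) // h.
    apply: wp_seq; apply: wp_put; rewrite !(evalE, stateE) (same_var sm2 (r := 13)) // (same_var sm2 (r := 16)) // A2 // e13 vv (st_row st1) // -/p.
    set s3 := store_arr _ _ _ _.
    have V3 r : r != 8 -> vars s3 r = vars s1 r.
      by move=> h; rewrite /s3 !stateE (same_var sm2) // inE.
    have V3' : vars s3 8 = p by rewrite /s3 !stateE.
    have A3 a i : a < 16 -> a != 11 -> arr s3 a i = arr s1 a i.
      by move=> h h'; rewrite /s3 arr_store_arr ?h // (negbTE h') stateE A2.
    have A3' u' v' : u' < U -> v' < U -> arr s3 11 (u' * W + v') =
        if (u' == u) && (v' == v) then p else arr s1 11 (u' * W + v').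
      by move=> h h'; rewrite /s3 arr_store_arr //= idx_eq ?stateE ?A2 //; apply: ltn_trans ltUW.
    have pt3 : pointers s3 f.
      move=> u' v' hu' hv'; rewrite A3' //; case: ifP => [/andP[/eqP-> /eqP->]|_] //.
      exact: pt1.
    have ps3 : psi s3 + p0 = psi s1 + p by apply: psi_upd A3'.
    have T3 : clock s3 = clock s1 + 4 + 2 * (p - p0) by rewrite /s3 !stateE t2; lia.
    have st3 : static s3.
      by case: st1 => *; split=> *; rewrite ?V3 ?A3 //; auto.
    have hd3 : heads s3 f.
      by case: hd1 => *; split=> *; rewrite ?V3 ?A3 //; auto.
    clearbody s3.
    (* Common end of all branches: the pointer is stored, and at most seven ticks follow. *)
    have fin s4 : (forall a i, arr s4 a i = arr s3 a i) -> clock s4 <= clock s3 + 7 -> R v.+1 s4 -> I v.+1 s4.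
      move=> A4 T4 R4; split=> //.
        by move=> u' v' hu' hv'; rewrite A4; apply: pt3.
      rewrite (psi_eq (s := s3) (s' := s4)) //.
      by lia.
    (* If chain v offers nothing, the earlier outcome stands. *)
    have notfound s4 : vars s4 17 = vars s3 17 -> vars s4 18 = vars s3 18 ->
       (forall q z, available ss f u v q z -> z \notin P j) -> R v.+1 s4.
      move=> E17 E18 nav; rewrite /R E17 E18 !V3 //.
      case: R1 => [[h1 [h2 h3]]|h]; [left|by right].
      split=> //; split=> // w q z; rewrite ltnS leq_eqVlt => /predU1P[->|].
        exact: nav.
      exact: h3.
    have dE : eval s3 (Minus (Get 8 (Var 16)) (Var 8)) = size (f v) - p.
      by rewrite !evalE V3' V3 // vv (hd_len hd3).
    apply: wp_if; rewrite dE => hd'; last first.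
      apply: wp_skip => _; apply: fin; first by move=> a i; rewrite !arr_asg.
        by rewrite !stateE; lia.
      apply: notfound => // q z [_ hq sub [<- nz _]].
      have Ep : p = size (f v) by lia.
      move: sub2; rewrite Ep take_size => sub2.
      by case/negP: nz; apply: sub2; apply: mem_nth.
    have pv : p < size (f v) by lia.
    rewrite pv in stop; have npu : nth 0 (f v) p \notin f u by case: (_ \in _) stop.
    have pE q z : available ss f u v q z -> nth 0 (f v) p = z.
      move=> [_ hq sub [<- nz _]].
      by rewrite (first_missing_eq sub sub2).
    set z := nth 0 (f v) p in npu pE *.
    have zW : z < W by apply: lv; apply: mem_nth.
    apply: wp_seq; apply: wp_asg; rewrite !(evalE, stateE) V3' V3 // vv (st_row st3) //.
    rewrite (hd_fc hd3) // -/z.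
    set s4 := asg _ _ _.
    have V4 r : r != 19 -> vars s4 r = vars s3 r by rewrite /s4 !stateE => /negbTE->.
    have bE : eval s4 (Get 0 (Plus (Get 5 (Var 10)) (Var 19))) = (z \in P j).
      by rewrite /s4 !(evalE, stateE) /= !arr_asg // V3 // e10 !stateE (st_row st3) ?nU // (st_bit st3).
    apply: wp_if; rewrite bE => zb; last first.
      apply: wp_skip => _; apply: fin; first by move=> a i; rewrite /s4 !arr_asg.
        by rewrite /s4 !stateE; lia.
      apply: notfound => // q z' /pE <-; by case: (z \in P j) zb.
    have cE : eval (tick s4) (Minus (Cst 2) (Get 10 (Plus (Get 5 (Var 13)) (Get 6 (Var 16))))) =
        2 - count [pred x | x \notin f u] (P (v %/ n)).
      rewrite /s4 !(evalE, stateE) /= !arr_asg // !stateE V3 // V3 // e13 vv (st_row st3) // (st_pa st3) //.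
      by rewrite (hd_cnt hd3) // src_lt.
    apply: wp_if; rewrite cE => hc; last first.
      apply: wp_skip => _; apply: fin; first by move=> a i; rewrite /s4 !arr_asg.
        by rewrite /s4 !stateE; lia.
      apply: notfound => // q z' [_ _ _ [_ _]]; rewrite /src -/n -/(P _); lia.
    apply: wp_seq; apply: wp_asg; apply: wp_asg => _; apply: fin; first by move=> a i; rewrite /s4 !arr_asg.
      by rewrite /s4 !stateE; lia.
    right; rewrite /s4 !(evalE, stateE) /=; split=> //; split; first by case: (z \in P j) zb.
    exists v, p; split=> //; split=> //; rewrite /src -/n -/(P _); lia.
- move=> s' sm [pt' t' R']; split=> //.
    by rewrite clock_tick [psi (tick _)](psi_eq (s := s')) //; lia.
  case: R' => [[h1 [h2 h3]]|h]; [left|by right].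
  by split=> //; split=> // w q z av; apply: h3 (av); case: av.
Qed.

Lemma encode_rcons gs X : encode (rcons gs X) =
  (size gs).+1 :: behead (encode gs) ++ size X :: X.
Proof. by rewrite /encode size_rcons map_rcons flatten_rcons. Qed.

Lemma size_encode_rcons gs X : size (encode (rcons gs X)) = size (encode gs) + (size X).+1.
Proof. by rewrite encode_rcons /= size_cat. Qed.

Lemma nth_encode_rcons gs X q : nth 0 (encode (rcons gs X)) q =
  if q == 0 then (size gs).+1 else if q < size (encode gs) then nth 0 (encode gs) q
  else nth 0 (size X :: X) (q - size (encode gs)).
Proof. by rewrite encode_rcons; case: q => //= q; rewrite nth_cat subSS ltnS. Qed.

Lemma emit_spec s f u gs : static s -> heads s f -> bounded f -> u < U -> vars s 13 = u -> out s gs ->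
  wp emit (fun s' => out s' (rcons gs (f u)) /\ clock s' <= clock s + (4 * size (f u) + 5)) s.
Proof.
move=> st hd bd hu v13 [o7 oA].
set N := size (encode gs) in o7 oA.
have N0 : 0 < N by [].
apply: wp_seq; apply: wp_put; rewrite !evalE.
apply: wp_seq; apply: wp_put; rewrite !(evalE, stateE) !arr_store_arr //= v13 (hd_len hd) //.
apply: wp_seq; apply: wp_asg; rewrite !(evalE, stateE) o7 oA // addn1.
set s1 := asg _ _ _.
have V1 r : r != 7 -> vars s1 r = vars s r by rewrite /s1 !stateE => /negbTE->.
have V7 : vars s1 7 = N.+1 by rewrite /s1 !stateE addn1.
have A1 a i : a < 16 -> a != 13 -> arr s1 a i = arr s a i.
  by move=> h h'; rewrite /s1 arr_asg // !arr_store_arr ?h // (negbTE h').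
have B1 q : q < N.+1 -> arr s1 13 q = nth 0 (encode (rcons gs (f u))) q.
  rewrite ltnS leq_eqVlt nth_encode_rcons /s1 arr_asg // !arr_store_arr //= -/N.
  case: eqVneq => [->|ne /=]; first by rewrite gtn_eqF // ltnn subnn.
  by case: eqVneq => // _ qN; rewrite qN oA.
have T1 : clock s1 = clock s + 3 by rewrite /s1 !stateE; lia.
have st1 : static s1.
  by case: st => *; split=> *; rewrite ?V1 ?A1 //; auto.
have hd1 : heads s1 f.
  by case: hd => *; split=> *; rewrite ?V1 ?A1 //; auto.
clearbody s1.
pose I k s2 := [/\ vars s2 7 = N.+1 + k,
  forall q, q < N.+1 + k -> arr s2 13 q = nth 0 (encode (rcons gs (f u))) q &
  clock s2 <= clock s + 4 * k + 4].
apply: (wp_for (N := size (f u)) (I := I)) => //.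
- by move=> s' sm; rewrite !evalE (same_var sm) // (same_arr sm) // V1 // v13 (hd_len hd1).
- by split; rewrite ?stateE ?addn0 //= T1; lia.
- move=> k s2 hk sm vk [I1 I2 I3].
  apply: wp_seq; apply: wp_put; rewrite !(evalE, stateE) vk I1.
  rewrite (same_var sm) // V1 // v13 !(same_arr sm) // (st_row st1) // (hd_fc hd1) //.
  apply: wp_asg => _; rewrite !(evalE, stateE) I1 addn1.
  split; rewrite ?stateE /=; [lia| |lia].
  move=> q; rewrite addnS ltnS leq_eqVlt !arr_asg // arr_store_arr //=.
  case: eqVneq => [-> _|ne /= hq]; last by rewrite stateE I2.
  rewrite nth_encode_rcons -/N addSn /= ltnNge -addnS leq_addr /= addKn //.
- move=> s' sm [I1 I2 I3]; split; last by rewrite stateE; lia.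
  rewrite /out stateE size_encode_rcons -/N addnS -addSn; split=> //.
Qed.

(** The head grows by one element whether or not the search succeeds, so both branches share the
    postcondition; they differ only in the list of generators. *)
Lemma process_spec s f A k r u j x (rank := fun y => size nm - index y nm) :
  (forall i j x y, x \in P i -> y \in P j -> rank x = rank y -> x = y) ->
  static s -> heads s f -> pointers s f -> out s (ss ++ A) ->
  chain_inv ss rank f A k r ->
  u < U -> j = u %% n -> vars s 13 = u -> vars s 10 = j -> vars s 12 = x ->
  x \in P j -> x \notin f u -> rank x = r -> size (f u) = k ->
  (forall z, z \in P j -> z \notin f u -> rank x <= rank z) ->
  wp process (fun s' => exists y A', let f' := upd f u (rcons (f u) y) in
    [/\ heads s' f', pointers s' f', out s' (ss ++ A'), chain_inv ss rank f' A' k r &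
        clock s' + 2 * psi s <= clock s + (12 * U + 4 * n + 4 * k + 20) + 2 * psi s']) s.
Proof.
move=> rank_inj st hd pt ou inv hu Ej v13 v10 v12 xj xf rx sk minx.
have bd : bounded f.
  move=> v hv; have [c [Ef uf sub]] := chain_shape inv hv; split=> // y.
  by rewrite Ef mem_cat => /orP[|/sub]; apply: ltW.
have hn : j < n by rewrite Ej; apply: tgt_lt hu.
have tE : tgt ss u = P j by rewrite Ej.
apply: wp_seq; apply: wp_asg; apply: wp_seq; apply: wp_asg; rewrite !(evalE, stateE) /= v12.
set s1 := asg _ _ _.
have V1 r' : r' \notin [:: 17; 18] -> vars s1 r' = vars s r'.
  by rewrite !inE => /norP[/negbTE h1 /negbTE h2]; rewrite /s1 !stateE h1 h2.
have A1 a i : arr s1 a i = arr s a i by rewrite /s1 !arr_asg.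
have V17 : vars s1 17 = 0 by rewrite /s1 !stateE.
have V18 : vars s1 18 = x by rewrite /s1 !stateE.
have T1 : clock s1 = clock s + 2 by rewrite /s1 !stateE; lia.
have st1 : static s1 by case: st => *; split=> *; rewrite ?V1 ?A1 //; auto.
have hd1 : heads s1 f by case: hd => *; split=> *; rewrite ?A1 //; auto.
have pt1 : pointers s1 f by move=> *; rewrite A1; apply: pt.
have ou1 : out s1 (ss ++ A) by case: ou => o1 o2; split=> *; rewrite ?V1 ?A1 //; apply: o2.
have ps1 : psi s1 = psi s by apply: psi_eq => *; rewrite A1.
have v13' : vars s1 13 = u by rewrite V1.
have v10' : vars s1 10 = j by rewrite V1.
clearbody s1.
apply: wp_seq.
apply: wp_conseq (wp_same _ (search_spec st1 hd1 bd pt1 hu hn v13' v10' V17)) _ => // s2 [sm [pt2 t2 R2]].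
have st2 : static s2 by apply: same_static sm _ _ st1.
have hd2 : heads s2 f by case: hd1 => *; split=> *; rewrite (same_arr sm) //; auto.
have ou2 : out s2 (ss ++ A).
  by case: ou1 => o1 o2; split=> *; rewrite ?(same_var sm) ?(same_arr sm) //; apply: o2.
have v13'' : vars s2 13 = u by rewrite (same_var sm).
set y := vars s2 18 in R2.
have [yj yf] : y \in P j /\ y \notin f u.
  by case: R2 => [[_ [-> _]]|[_ [h [v [p [_ _ _ [_ h' _]]]]]]]; rewrite ?V18.
have yW : y < W by apply: ltW yj.
apply: wp_seq.
apply: wp_conseq (wp_same _ (append_spec st2 hd2 bd hu v13'' erefl yW yf)) _ => // s3 [sm3 [hd3 t3]].
set f' := upd f u _ in hd3.
have f'u : f' u = rcons (f u) y by rewrite /f' /upd eqxx.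
have st3 : static s3 by apply: same_static sm3 _ _ st2.
have ou3 : out s3 (ss ++ A).
  by case: ou2 => o1 o2; split=> *; rewrite ?(same_var sm3) ?(same_arr sm3) //; apply: o2.
have v13_3 : vars s3 13 = u by rewrite (same_var sm3).
have ps3 : psi s3 = psi s2 by apply: psi_eq => *; rewrite (same_arr sm3).
have subf v : {subset f v <= f' v}.
  by move=> z; rewrite /f' /upd; case: eqP => [->|//]; rewrite mem_rcons inE => ->; rewrite orbT.
(* An old pointer stays within its chain, whose prefix is unchanged, and the head still contains
   that prefix. *)
have pt3 : pointers s3 f'.
  move=> a b ha hb; rewrite (same_arr sm3) //; have [le sub] := pt2 _ _ ha hb.
  have Et : take (arr s2 11 (a * W + b)) (f' b) = take (arr s2 11 (a * W + b)) (f b).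
    by rewrite /f' /upd; case: eqP le {sub} => [->|//] le; rewrite -cats1 takel_cat.
  split; last by rewrite Et => z /sub /subf.
  by apply: leq_trans le _; rewrite /f' /upd; case: eqP => [->|//]; rewrite size_rcons.
have bd' : bounded f'.
  move=> v hv; rewrite /f' /upd; case: eqP => [_|_]; last exact: bd.
  have [uf lf] := bd _ hu; split; first by rewrite rcons_uniq yf.
  by move=> z; rewrite mem_rcons inE => /predU1P[->|/lf].
have v17_3 : vars s3 17 = vars s2 17 by rewrite (same_var sm3).
apply: wp_if; rewrite !evalE v17_3 => v17.
  apply: wp_skip; exists y, A; rewrite -/f'; split.
  - by case: hd3 => *; split=> *; rewrite ?stateE //; auto.
  - by move=> a b ha hb; rewrite stateE; apply: pt3.
  - by case: ou3 => o1 o2; split=> *; rewrite ?stateE //; apply: o2.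
  - case: R2 => [[e17 _]|[_ [_ [v [p av]]]]]; first by rewrite e17 in v17.
    apply: move_inv => //; first by rewrite tE.
    exact: (available_sound uniq_ss inv hu av).
  - by rewrite [psi (tick _)](psi_eq (s := s3)) // ps3 stateE; lia.
have ou4 : out (tick s3) (ss ++ A).
  by case: ou3 => o1 o2; split=> *; rewrite ?stateE //; apply: o2.
have hd4 : heads (tick s3) f'.
  by case: hd3 => *; split=> *; rewrite ?stateE //; auto.
have st4 : static (tick s3).
  by case: st3 => *; split=> *; rewrite ?stateE //; auto.
apply: wp_conseq (wp_same _ (emit_spec st4 hd4 bd' hu _ ou4)) _ => // s5 [sm5 [ou5 t5]].
exists y, (rcons A (f' u)); rewrite -/f'; split.
- by case: hd4 => *; split=> *; rewrite (same_arr sm5) //; auto.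
- by move=> a b ha hb; rewrite (same_arr sm5) //; apply: pt3.
- by rewrite -rcons_cat.
- case: R2 => [[_ [Ey nav]]|[ne _]] //.
  have Exy : y = x by rewrite Ey V18.
  rewrite f'u /f' -/y Exy; apply: (add_inv uniq_ss rank_inj inv hu sk); rewrite ?tE //.
  (* A failed search over all chains means that no extension towards the target is in the span. *)
  move=> z zj zf /(available_complete inv hu zf)[v [p av]].
  by have := nav _ _ _ av; rewrite zj.
- rewrite (psi_eq (s := s3) (s' := s5)); last by move=> *; rewrite (same_arr sm5).
  by rewrite ps3; move: t5; rewrite f'u size_rcons stateE; lia.
Qed.

(** * Levels and the order of the visits *)

Hypothesis uniq_nm : uniq nm.
Hypothesis nm_all : forall i x, x \in P i -> x \in nm.
Hypothesis nmW : forall x, x \in nm -> x < W.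
Let E := size nm.
(** The last entry of [nm] has the least rank, so scanning [nm] meets the ranks in decreasing
    order. *)
Let rank y := E - index y nm.

Lemma rank_inj i j x y : x \in P i -> y \in P j -> rank x = rank y -> x = y.
Proof.
move=> /nm_all xn /nm_all yn e; by rewrite -(nth_index 0 xn) -(nth_index 0 yn); congr nth; move: xn yn e; rewrite -!index_mem /rank -/E; lia.
Qed.

(** When p reaches the number of elements the third case is void; this is how every incomplete head
    is seen to leave level k during its scan. *)
Definition todo (f : nat -> seq nat) k p u :=
  [\/ {subset tgt ss u <= f u}, k < size (f u) |
     size (f u) = k /\ exists x, [/\ x \in tgt ss u, x \notin f u & p <= index x nm]].

(* Elements are visited by increasing index: when as many of them have been seen
   as tgt u - f u contains, the current one has the least rank, the rank being
   the opposite of the index. *)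
Definition seen_count (f : nat -> seq nat) k p u :=
  if size (f u) == k
  then count [pred y | (y \notin f u) && (index y nm < p)] (tgt ss u) else 0.

(** While the r-th element is handled, some heads have been visited for it and others have not; [pr]
    records this head by head. The rank bound [E - r] is the rank of that element. *)
Record level_inv s f A k r (pr : nat -> nat) : Prop := LevelInv {
  lv_static : static s;
  lv_heads : heads s f;
  lv_ptr : pointers s f;
  lv_out : out s (ss ++ A);
  lv_inv : chain_inv ss rank f A k (E - r);
  lv_seen : forall u, u < U -> arr s 12 u = seen_count f k (pr u) u;
  lv_todo : forall u, u < U -> todo f k (pr u) u }.

Lemma level_inv_ext s s' f A k r pr : static s' ->
  (forall a i, a \in [:: 7; 8; 9; 10; 11; 12; 13] -> arr s' a i = arr s a i) -> vars s' 7 = vars s 7 ->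
  level_inv s f A k r pr -> level_inv s' f A k r pr.
Proof.
move=> st A0 V [_ [h1 h2 h3 h4] pt [o1 o2] inv se td]; split=> //.
- by split=> *; rewrite A0 //; auto.
- by move=> u v hu hv; rewrite A0 //; apply: pt.
- by split=> *; rewrite ?A0 ?V //; apply: o2.
- by move=> u hu; rewrite A0 //; apply: se.
Qed.

(** The r-th element may be passed over for any head on level k that does not miss it from its
    target. *)
Lemma level_inv_advance s f A k r pr pr' : level_inv s f A k r pr ->
  (forall u, u < U -> pr' u = pr u \/ [/\ pr u = r, pr' u = r.+1 &
     forall x, x \in tgt ss u -> x \notin f u -> size (f u) = k -> index x nm <> r]) ->
  level_inv s f A k r pr'.
Proof.
move=> [st hd pt ou inv se td] h; split=> // u hu; have [->|[e1 e2 e3]] := h _ hu; auto.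
- rewrite se // /seen_count e1 e2; case: eqP => // sk; apply: eq_in_count => x xt /=.
  have [//|xf /=] := boolP (x \in f u).
  by have := e3 _ xt xf sk; case: ltngtP => // *; lia.
- have := td _ hu; rewrite e1 e2 => -[h1|h2|[h3 [x [xt xf xr]]]].
  + exact: Or31.
  + exact: Or32.
  + by apply: Or33; split=> //; exists x; split=> //; have := e3 _ xt xf h3; lia.
Qed.

(** The second potential: each call of [process] raises it by one. *)
Definition gam (f : nat -> seq nat) := \sum_(u < U) size (f u).

Lemma gam_upd f u y : u < U -> gam (upd f u (rcons (f u) y)) = (gam f).+1.
Proof.
move=> hu; rewrite /gam (bigD1 (Ordinal hu)) //= [in RHS](bigD1 (Ordinal hu)) //=.
rewrite /upd eqxx size_rcons addSn; congr ((_ + _).+1).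
by apply: eq_bigr => i ne; have /negbTE -> : val i != u by [].
Qed.

(** The cost of [process] without the pointer loops, with the level replaced by its bound
    $2\ell$. *)
Let Cp := 12 * U + 4 * n + 8 * L + 20.

(** Amortised cost: the growth of the two potentials is paid for separately, and c covers the
    rest. *)
Definition cost_le s f s' f' c :=
  clock s' + 2 * psi s + Cp * gam f <= clock s + c + 2 * psi s' + Cp * gam f'.

Lemma visit_spec s f A k r pr u j x : level_inv s f A k r pr -> u < U -> j = u %% n ->
  k < L + L -> r < E -> pr u = r -> x = nth 0 nm r -> x \in P j ->
  vars s 13 = u -> vars s 10 = j -> vars s 12 = x -> vars s 14 = k ->
  wp visit (fun s' => exists f' A',
    level_inv s' f' A' k r [eta pr with u |-> r.+1] /\ cost_le s f s' f' 5) s.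
Proof.
move=> I hu Ej hk hr pu Ex xj v13 v10 v12 v14; case: (I) => st hd pt ou inv se td.
have xW : x < W by apply: ltW xj.
have ix : index x nm = r by rewrite Ex index_uniq.
have jn : j < n by rewrite Ej; apply: tgt_lt hu.
have tE : tgt ss u = P j by rewrite Ej.
(* Nothing to do for this head: x belongs to it, or its size is not k. *)
have skip s' c : (forall a i, arr s' a i = arr s a i) -> (forall v, vars s' v = vars s v) ->
    clock s' = clock s + c -> c <= 5 -> (x \in f u \/ size (f u) <> k) ->
  exists f' A', level_inv s' f' A' k r [eta pr with u |-> r.+1] /\ cost_le s f s' f' 5.
  move=> As Vs T c5 h; exists f, A; split.
    apply: (level_inv_ext (s := s)) => //; first by case: st => *; split=> *; rewrite ?Vs ?As; auto.
    apply: level_inv_advance I _ => v hv /=; case: eqP => [->|_]; [right|by left].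
    split=> // y yt yf sk iy; case: h => // xf.
    have yj : y \in P j by rewrite -tE.
    have Exy : y = x by apply: (rank_inj yj xj); rewrite /rank ix iy.
    by rewrite Exy xf in yf.
  by rewrite /cost_le T (psi_eq (s := s) (s' := s')) => [|*]; [lia|rewrite As].
apply: wp_if; rewrite !evalE v13 v14 (hd_len hd) // => szk; last first.
  by apply: wp_skip; apply: (skip _ 1) => //; rewrite ?stateE; lia.
have {}szk : size (f u) = k by lia.
apply: wp_if; rewrite !(evalE, stateE) v13 v12 (st_row st) // (hd_in hd) // => xin.
  apply: wp_skip; apply: (skip _ 2) => //; rewrite ?stateE; [lia|by left; case: (_ \in _) xin].
have {xin} xf : x \notin f u by case: (_ \in _) xin.
apply: wp_seq; apply: wp_put; rewrite !(evalE, stateE) v13 se //.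
set s1 := store_arr _ _ _ _.
have V1 v : vars s1 v = vars s v by rewrite /s1 !stateE.
have A1 a i : a < 16 -> a != 12 -> arr s1 a i = arr s a i.
  by move=> h h'; rewrite /s1 arr_store_arr ?h // (negbTE h').
have A12 v : arr s1 12 v = if v == u then seen_count f k r.+1 u else arr s 12 v.
  rewrite /s1 arr_store_arr //=; case: eqP => // _.
  rewrite /seen_count szk eqxx pu tE addn1.
  have -> : count [pred y | (y \notin f u) && (index y nm < r.+1)] (P j) =
      count [pred y | (y \notin f u) && (index y nm < r)] (P j) + count (pred1 x) (P j).
    have z : count (predI [pred y | (y \notin f u) && (index y nm < r)] (pred1 x)) (P j) = 0.
      rewrite -[RHS](count_pred0 (P j)); apply: eq_count => y /=.
      by case: eqVneq => [->|_]; rewrite ?andbF // ix ltnn andbF.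
    rewrite -count_predUI z addn0; apply: eq_in_count => y yj /=.
    case: eqVneq => [->|ne]; first by rewrite xf ix ltnS leqnn orbT.
    rewrite orbF ltnS leq_eqVlt; case: eqVneq => //= iy.
    by case/eqP: ne; apply: (rank_inj yj xj); rewrite /rank ix iy.
  by rewrite count_uniq_mem ?uniq_Pi // xj addn1.
have T1 : clock s1 = clock s + 3 by rewrite /s1 !stateE; lia.
have st1 : static s1 by case: st => *; split=> *; rewrite ?V1 ?A1 //; auto.
have hd1 : heads s1 f by case: hd => *; split=> *; rewrite ?V1 ?A1 //; auto.
have pt1 : pointers s1 f by move=> *; rewrite A1 //; apply: pt.
have ou1 : out s1 (ss ++ A) by case: ou => o1 o2; split=> *; rewrite ?V1 ?A1 //; apply: o2.
have ps1 : psi s1 = psi s by apply: psi_eq => *; rewrite A1.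
clearbody s1.
(* The missing elements split into those met so far, x included, and those still to come; the test
   that follows tells whether the second kind is empty. *)
have split_count : seen_count f k r.+1 u +
    count [pred y | (y \notin f u) && (r < index y nm)] (P j) =
    count [pred y | y \notin f u] (P j).
  rewrite /seen_count szk eqxx tE.
  have z : count (predI [pred y | (y \notin f u) && (index y nm < r.+1)]
      [pred y | (y \notin f u) && (r < index y nm)]) (P j) = 0.
    rewrite -[RHS](count_pred0 (P j)); apply: eq_count => y /=.
    by rewrite ltnS; case: leqP; rewrite ?andbF.
  rewrite -count_predUI z addn0; apply: eq_count => y /=.
  by rewrite ltnS; case: leqP; rewrite ?andbF ?andbT ?orbF.
apply: wp_if; rewrite !evalE !V1 v13 v10 (st_row st1) // (hd_cnt hd1) // A12 eqxx => neq.
  apply: wp_skip; exists f, A; split; last first.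
    by rewrite /cost_le [psi (tick _)](psi_eq (s := s1)) // ps1 stateE; lia.
  split=> //.
  - by case: st1 => *; split=> *; rewrite ?stateE; auto.
  - by case: hd1 => *; split=> *; rewrite ?stateE; auto.
  - move=> v hv; rewrite stateE A12 /=; case: eqP => [->//|_]; exact: se.
  - move=> v hv /=; case: eqP => [->|_]; last exact: td.
    apply: Or33; split=> //.
    have : 0 < count [pred y | (y \notin f u) && (r < index y nm)] (P j) by lia.
    rewrite -has_count => /hasP[y yj /andP[yf yr]]; exists y; split=> //.
    by rewrite tE.
(* No missing element comes later in the scan, so x has the least rank. *)
have minx z : z \in P j -> z \notin f u -> rank x <= rank z.
  move=> zj zf; apply: leq_sub2l; rewrite ix leqNgt; apply/negP => lt.
  have : 0 < count [pred y | (y \notin f u) && (r < index y nm)] (P j).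
    by rewrite -has_count; apply/hasP; exists z => //=; rewrite zf lt.
  by lia.
apply: wp_seq; apply: wp_put; rewrite !(evalE, stateE) V1 v13.
set s2 := store_arr _ _ _ _.
have V2 v : vars s2 v = vars s v by rewrite /s2 !stateE V1.
have A2 a i : a < 16 -> a != 12 -> arr s2 a i = arr s1 a i.
  by move=> h h'; rewrite /s2 arr_store_arr ?h // (negbTE h') stateE.
have A12' v : arr s2 12 v = if v == u then 0 else arr s 12 v.
  by rewrite /s2 arr_store_arr //= stateE A12; case: eqP.
have T2 : clock s2 = clock s + 5 by rewrite /s2 !stateE; lia.
have st2 : static s2 by case: st => *; split=> *; rewrite ?V2 ?A2 ?A1 //; auto.
have hd2 : heads s2 f by case: hd1 => *; split=> *; rewrite ?A2 //; auto.
have pt2 : pointers s2 f by move=> *; rewrite A2 //; apply: pt1.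
have ou2 : out s2 (ss ++ A).
  by case: ou1 => o1 o2; split=> *; rewrite ?V2 -?V1 ?A2 //; apply: o2.
have ps2 : psi s2 = psi s by rewrite -ps1; apply: psi_eq => *; rewrite A2.
have v13' : vars s2 13 = u by rewrite V2.
have v10' : vars s2 10 = j by rewrite V2.
have v12' : vars s2 12 = x by rewrite V2.
clearbody s2.
have rx : rank x = E - r by rewrite /rank ix.
apply: wp_conseq (wp_same _ (process_spec rank_inj st2 hd2 pt2 ou2 inv hu Ej v13' v10' v12' xj xf rx szk minx)) _ => //.
move=> s3 [sm [y [A' [hd3 pt3 ou3 inv3 t3]]]].
exists (upd f u (rcons (f u) y)), A'; split; last first.
  by rewrite /cost_le gam_upd // mulnS -ps2; rewrite /Cp; lia.
split=> //; first exact: same_static sm _ _ st2.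
(* The head has left level k, where a cleared counter is the correct value. *)
- move=> v hv; rewrite (same_arr sm) // A12' /seen_count /upd /=; case: eqP => [->|_].
    by rewrite size_rcons szk gtn_eqF.
  exact: se.
- move=> v hv; rewrite /todo /upd /=; case: eqP => [->|_]; last exact: td.
  by apply: Or32; rewrite size_rcons szk.
Qed.

Lemma cost_le_trans s1 f1 s2 f2 s3 f3 c d : cost_le s1 f1 s2 f2 c -> cost_le s2 f2 s3 f3 d ->
  cost_le s1 f1 s3 f3 (c + d).
Proof. by rewrite /cost_le; lia. Qed.

Lemma cost_le_clock s1 f1 s2 f2 s3 c d : cost_le s1 f1 s2 f2 c ->
  (forall i, arr s3 11 i = arr s2 11 i) -> clock s3 <= clock s2 + d -> cost_le s1 f1 s3 f2 (c + d).
Proof.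
move=> h1 h2 h3; apply: cost_le_trans h1 _; rewrite /cost_le (psi_eq (s := s2) (s' := s3)) //.
by lia.
Qed.

(* The number of elements already visited for head u, once the r-th element has
   been visited for the targets below j and for the sources below i of target j. *)
Definition progress r j i u := if (u %% n < j) || (u %% n == j) && (u %/ n < i) then r.+1 else r.

Lemma level_inv_eq s f A k r pr pr' : level_inv s f A k r pr ->
  (forall u, u < U -> pr' u = pr u) -> level_inv s f A k r pr'.
Proof. by move=> I h; apply: level_inv_advance I _ => u hu; left; apply: h. Qed.

Lemma level_inv_asg s f A k r pr v c : v \notin [:: 1; 2; 3; 5; 6; 7] ->
  level_inv s f A k r pr -> level_inv (asg s v c) f A k r pr.
Proof.
rewrite !inE !negb_or => /and5P[n1 n2 n3 n5 /andP[n6 n7]] I.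
apply: (level_inv_ext (s := s)) => //.
- case: I => st _ _ _ _ _ _; apply: (same_static (vs := [:: v]) (aa := [::])) st => //=.
    by apply: same_asg => //; rewrite inE eqxx.
  by rewrite !inE ![_ == v]eq_sym n2 n3 n5 n6.
- by move=> *; rewrite arr_asg.
- by rewrite vars_asg eq_sym (negbTE n7).
Qed.

Lemma level_inv_tick s f A k r pr : level_inv s f A k r pr -> level_inv (tick s) f A k r pr.
Proof.
move=> I; apply: (level_inv_ext (s := s)) => //.
by case: I => -[*] *; split=> *; rewrite ?stateE; auto.
Qed.

Lemma visit_target_spec s f A k r j x : level_inv s f A k r (progress r j 0) ->
  j < n -> k < L + L -> r < E -> x = nth 0 nm r -> x \in P j ->
  vars s 10 = j -> vars s 12 = x -> vars s 14 = k ->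
  wp visit_target (fun s' => exists f' A',
    level_inv s' f' A' k r (progress r j.+1 0) /\ cost_le s f s' f' (8 * n + 3)) s.
Proof.
move=> I hj hk hr Ex xj v10 v12 v14.
have n0 : 0 < n by apply: leq_ltn_trans hj.
apply: wp_seq; apply: wp_asg; rewrite evalE v10.
set s0 := asg _ _ _.
pose J i s1 := vars s1 13 = i * n + j /\ exists f' A',
  level_inv s1 f' A' k r (progress r j i) /\ cost_le s f s1 f' (8 * i + 2).
apply: (wp_for (N := n) (I := J)) => //.
- by move=> s' sm; rewrite evalE (same_var sm) // /s0 stateE; case: I => -[].
- split; first by rewrite /s0 !stateE.
  exists f, A; split; first by do 2 apply: level_inv_asg => //.
  rewrite /cost_le (psi_eq (s := s)) => [|*]; last by rewrite /s0 !arr_asg.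
  by rewrite /s0 !stateE; lia.
- move=> i s1 hi sm vi [v13 [f1 [A1 [I1 c1]]]].
  have hu := head_lt hi hj.
  apply: wp_seq; apply: wp_conseq (wp_same _ (visit_spec (level_inv_tick I1) hu _ hk hr _ Ex xj v13 _ _ _)) _ => //.
  + by rewrite modnMDl modn_small.
  + rewrite /progress modnMDl modn_small // divnMDl ?divn_small ?addn0 //.
    by rewrite !ltnn eqxx.
  + by rewrite stateE (same_var sm) // /s0 !stateE.
  + by rewrite stateE (same_var sm) // /s0 !stateE.
  + by rewrite stateE (same_var sm) // /s0 !stateE.
  move=> s2 [sm2 [f2 [A2 [I2 c2]]]]; apply: wp_asg => _.
  have n2 : vars s2 2 = n by case: I2 => -[].
  split; first by rewrite !(evalE, stateE) /= (same_var sm2) // stateE v13 n2; lia.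
  exists f2, A2; split.
    do 2 apply: level_inv_asg => //; apply: level_inv_eq I2 _ => u hu' /=.
    rewrite /progress; case: (u =P i * n + j) => [->|ne].
      rewrite modnMDl modn_small // divnMDl ?divn_small ?addn0 //.
      by rewrite ltnn eqxx ltnSn.
    congr (if _ || _ then _ else _); case: eqP => //= um; rewrite ltnS leq_eqVlt.
    by case: eqP => //= ud; case: ne; rewrite [LHS](divn_eq u n) um ud.
  have := cost_le_trans (cost_le_clock (s3 := tick s1) (d := 1) c1 (fun=> erefl) _) c2.
  rewrite stateE => /(_ ltac:(lia)) c3; have := cost_le_clock (d := 2) c3.
  rewrite (_ : 8 * i + 2 + 1 + 5 + 2 = 8 * i.+1 + 2); last by lia.
  by apply=> [a|]; rewrite ?arr_asg // !stateE addn2.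
- move=> s' sm [_ [f' [A' [I' c']]]]; exists f', A'; split.
    apply: level_inv_tick; apply: level_inv_eq I' _ => u hu; rewrite /progress andbF orbF.
    by rewrite (src_lt hu) andbT ltnS leq_eqVlt orbC.
  by rewrite (_ : 8 * n + 3 = 8 * n + 2 + 1); [apply: (cost_le_clock c'); rewrite // stateE addn1|lia].
Qed.

Lemma visit_element_spec s f A k r x : level_inv s f A k r (fun=> r) ->
  k < L + L -> r < E -> x = nth 0 nm r -> vars s 12 = x -> vars s 14 = k ->
  wp visit_element (fun s' => exists f' A', level_inv s' f' A' k r (fun=> r.+1) /\
    cost_le s f s' f' (3 * n + 2 + (8 * n + 3) * \sum_(j < n) (x \in P j))) s.
Proof.
move=> I hk hr Ex v12 v14.
pose J j s1 := exists f' A', level_inv s1 f' A' k r (progress r j 0) /\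
  cost_le s f s1 f' (3 * j + 1 + (8 * n + 3) * \sum_(j' < j) (x \in P j')).
have xW : x < W by apply: nmW; rewrite Ex mem_nth.
apply: (wp_for (N := n) (I := J)) => //.
- by move=> s' sm; rewrite evalE (same_var sm) //; case: I => -[].
- exists f, A; split.
    apply: level_inv_asg => //; apply: level_inv_eq I _ => u hu.
    by rewrite /progress ltn0 andbF.
  rewrite /cost_le (psi_eq (s := s)) => [|*]; last by rewrite arr_asg.
  by rewrite !stateE big_ord0; lia.
- move=> j s1 hj sm vj [f1 [A1 [I1 c1]]].
  have st1 : static s1 by case: I1.
  have n0 : 0 < n by apply: leq_ltn_trans hj.
  have v12' : vars s1 12 = x by rewrite (same_var sm).
  have v14' : vars s1 14 = k by rewrite (same_var sm).
  have bE : eval (tick s1) (Get 0 (Plus (Get 5 (Var 10)) (Var 12))) = (x \in P j).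
    by rewrite !(evalE, stateE) vj v12' (st_row st1) ?nU // (st_bit st1).
  apply: wp_if; rewrite bE => xj.
    have {}xj : x \in P j by case: (_ \in _) xj.
    apply: wp_conseq (visit_target_spec (level_inv_tick (level_inv_tick I1)) hj hk hr Ex xj _ _ _) _ => //.
    move=> s2 [f2 [A2 [I2 c2]]] _; exists f2, A2; split; first exact: level_inv_asg.
    have := cost_le_trans (cost_le_clock (s3 := tick (tick s1)) (d := 2) c1 (fun=> erefl) _) c2.
    rewrite !stateE => /(_ ltac:(lia)) c3; have := cost_le_clock (s3 := asg s2 10 j.+1) (d := 1) c3.
    rewrite big_ord_recr /= xj.
    set S := \sum_(_ < _) _; rewrite (_ : 3 * j.+1 + 1 + (8 * n + 3) * (S + true) =
      3 * j + 1 + (8 * n + 3) * S + 2 + (8 * n + 3) + 1); last by clear; lia.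
    by apply=> [a|]; rewrite ?arr_asg // ?stateE addn1.
  (* Here P j does not contain x, so none of the heads with this target misses x from it. *)
  apply: wp_skip => _; exists f1, A1; split.
    apply: level_inv_asg => //; do 2 apply: level_inv_tick.
    apply: level_inv_advance I1 _ => u hu; rewrite /progress !andbF !orbF ltnS leq_eqVlt orbC.
    case: (ltngtP (u %% n) j) => [_|_|um]; [by left|by left|right; split=> //].
    move=> y; rewrite /tgt um -/(P j) => yj _ _ iy.
    have Exy : x = y by rewrite Ex -iy nth_index //; apply: nm_all yj.
    by move: xj; rewrite Exy yj.
  have := cost_le_clock (s3 := asg (tick (tick s1)) 10 j.+1) (d := 3) c1.
  rewrite big_ord_recr /= xj addn0 (_ : 3 * j.+1 + 1 = 3 * j + 1 + 3); last by lia.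
  rewrite addnAC; apply=> [a|]; first by rewrite arr_asg.
  by rewrite ?stateE; lia.
- move=> s' sm [f' [A' [I' c']]]; exists f', A'; split.
    apply: level_inv_tick; apply: level_inv_eq I' _ => u hu.
    by rewrite /progress tgt_lt.
  rewrite (_ : 3 * n + 2 = 3 * n + 1 + 1); last by lia.
  by rewrite addnAC; apply: (cost_le_clock c') => //; rewrite stateE addn1.
Qed.

(** Summed over the elements it is at most m, which makes the scan of a level cost $O(nm)$. *)
Definition degree r := \sum_(j < n) (nth 0 nm r \in P j).

Lemma do_level_spec s f A k : level_inv s f A k 0 (fun=> 0) -> k < L + L -> vars s 14 = k ->
  wp do_level (fun s' => exists f' A', level_inv s' f' A' k E (fun=> E) /\
    cost_le s f s' f' (E * (3 * n + 5) + (8 * n + 3) * \sum_(r < E) degree r + 2)) s.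
Proof.
move=> I hk v14.
pose J r s1 := exists f' A', level_inv s1 f' A' k r (fun=> r) /\
  cost_le s f s1 f' (r * (3 * n + 5) + (8 * n + 3) * \sum_(r' < r) degree r' + 1).
apply: (wp_for (N := E) (I := J)) => //.
- by move=> s' sm; rewrite evalE (same_var sm) //; case: I => -[].
- exists f, A; split; first exact: level_inv_asg.
  rewrite /cost_le (psi_eq (s := s)) => [|*]; last by rewrite arr_asg.
  by rewrite !stateE big_ord0; lia.
- move=> r s1 hr sm vr [f1 [A1 [I1 c1]]].
  have st1 : static s1 by case: I1.
  have v14' : vars s1 14 = k by rewrite (same_var sm).
  apply: wp_seq; apply: wp_asg; rewrite !(evalE, stateE) vr (st_nm st1) //.
  set s2 := asg _ _ _.
  have I2 : level_inv s2 f1 A1 k r (fun=> r).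
    by apply: level_inv_asg => //; apply: level_inv_tick.
  have v12 : vars s2 12 = nth 0 nm r by rewrite /s2 stateE.
  have v14'' : vars s2 14 = k by rewrite /s2 !stateE.
  apply: wp_conseq (visit_element_spec I2 hk hr erefl v12 v14'') _ => // s3 [f3 [A3 [I3 c3]]] _.
  exists f3, A3; split.
    apply: level_inv_asg => //; case: I3 => a b c d e g h; split=> //.
    by apply: chain_inv_mono e _; right; split=> //; apply: leq_sub2l.
  rewrite (_ : _ + 1 = r * (3 * n + 5) + (8 * n + 3) * (\sum_(r' < r) degree r') + 1 + 2 +
    (3 * n + 2 + (8 * n + 3) * degree r) + 1).
    apply: (cost_le_clock (cost_le_trans (cost_le_clock c1 _ _) c3)) => [a||a|].
    + by rewrite /s2 arr_asg.
    + by rewrite /s2 !stateE addn2.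
    + by rewrite arr_asg.
    + by rewrite stateE addn1.
  by rewrite big_ord_recr /= mulSn mulnDr; clear; lia.
- move=> s' sm [f' [A' [I' c']]]; exists f', A'; split; first exact: level_inv_tick.
  rewrite (_ : 2 = 1 + 1) // addnA.
  by apply: (cost_le_clock c') => //; rewrite stateE addn1.
Qed.

Hypothesis size_P : forall i, size (P i) <= L.

(** Once all elements have passed, an incomplete head has more than k elements: it is on level k + 1
    with all its missing elements still to come, or beyond. The complete heads left on level k have
    no missing element to count. *)
Lemma level_inv_next s f A k : level_inv s f A k E (fun=> E) ->
  level_inv s f A k.+1 0 (fun=> 0).
Proof.
move=> [st hd pt ou inv se td].
have td' u : u < U -> {subset tgt ss u <= f u} \/ k < size (f u).
  move=> hu; case: (td _ hu) => [?|?|[sk [x [xt xf]]]]; [by left|by right|].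
  by rewrite leqNgt index_mem (nm_all xt).
split=> //; first by apply: chain_inv_mono inv _; left.
- move=> u hu; rewrite se // /seen_count; case: (size (f u) =P k) => [sk|_].
    rewrite [if _ then _ else _](_ : _ = 0); last first.
      by case: ifP => // _; apply/eqP; rewrite -leqn0 leqNgt -has_count; apply/hasPn => x _ /=; rewrite andbF.
    case: (td' _ hu) => [sub|]; last by rewrite sk ltnn.
    apply/eqP; rewrite -leqn0 leqNgt -has_count; apply/hasPn => x /sub xf /=.
    by rewrite xf.
  case: ifP => // _; apply/esym/eqP; rewrite -leqn0 leqNgt -has_count.
  by apply/hasPn => x _ /=; rewrite andbF.
- move=> u hu; have [sub|lt] := td' _ hu; first exact: Or31.
  have [sub|nsub] := boolP (all (mem (f u)) (tgt ss u)); first by apply: Or31; apply/allP.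
  case: (ltngtP (size (f u)) k.+1) => [|lt'|Ek]; [by rewrite ltnS leqNgt lt|exact: Or32|].
  by apply: Or33; split=> //; have /allPn[x xt xf] := nsub; exists x.
Qed.

Lemma do_levels_spec s f A : level_inv s f A 0 0 (fun=> 0) ->
  wp do_levels (fun s' => exists f' A' k r,
    [/\ static s', chain_inv ss rank f' A' k r, forall u, u < U -> {subset tgt ss u <= f' u},
       out s' (ss ++ A') &
       pointers s' f' /\ cost_le s f s' f' ((L + L) * (E * (3 * n + 5) + (8 * n + 3) * \sum_(r < E) degree r + 4) + 2)]) s.
Proof.
move=> I; set D := _ + _ + 4.
pose J k s1 := exists f' A', level_inv s1 f' A' k 0 (fun=> 0) /\ cost_le s f s1 f' (k * D + 1).
apply: (wp_for (N := L + L) (I := J)) => //.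
- by move=> s' sm; rewrite !evalE (same_var sm) //; case: I => -[_ _ _ ->].
- exists f, A; split; first exact: level_inv_asg.
  rewrite /cost_le (psi_eq (s := s)) => [|*]; last by rewrite arr_asg.
  by rewrite !stateE; lia.
- move=> k s1 hk sm vk [f1 [A1 [I1 c1]]].
  apply: wp_conseq (do_level_spec (level_inv_tick I1) hk _) _ => // s2 [f2 [A2 [I2 c2]]] _.
  exists f2, A2; split; first by apply: level_inv_asg => //; apply: level_inv_next.
  rewrite (_ : _ + 1 = k * D + 1 + 1 + (E * (3 * n + 5) + (8 * n + 3) * \sum_(r < E) degree r + 2) + 1).
    apply: (cost_le_clock (cost_le_trans (cost_le_clock c1 _ _) c2)) => [a||a|] //.
    + by rewrite stateE addn1.
    + by rewrite stateE addn1.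
  by rewrite mulSn /D; clear; lia.
- move=> s' sm [f' [A' [I' c']]]; exists f', A', (L + L), (E - 0).
  case: (level_inv_tick I') => st hd pt ou inv se td; split=> //.
  (* A head has at most $2\ell$ elements, and fewer if an element of its target is missing: the part
     added to the source, together with that element, fits into the target. *)
  - move=> u hu; case: (td _ hu) => [//|h|[h [x [xt xf _]]]].
    + have [c [Ef uf sub]] := chain_shape inv hu.
      have := size_P (u %/ n); have := size_P (u %% n).
      have : size c <= size (tgt ss u).
        by apply: uniq_leq_size => //; move: uf; rewrite Ef cat_uniq => /and3P[].
      by move: h; rewrite Ef size_cat /src /tgt -/n -!/(P _); lia.
    + have [c [Ef uf sub]] := chain_shape inv hu.
      have := size_P (u %/ n); have := size_P (u %% n).
      have : size (x :: c) <= size (tgt ss u).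
        apply: uniq_leq_size => [/=|y].
          move: uf xf; rewrite Ef cat_uniq mem_cat negb_or => /and3P[_ _ ->] /andP[_ ->] //.
        by rewrite inE => /predU1P[->|/sub].
      by move: h; rewrite Ef size_cat /src /tgt -/n -!/(P _) /=; lia.
  - split=> //; rewrite (_ : 2 = 1 + 1) // addnA.
    by apply: (cost_le_clock c') => //; rewrite stateE addn1.
Qed.

End Program.

(** * Reading the input *)

(** The base is the first cell past the input. From there on every cell is zero, so the arrays start
    out as zeros. *)
Definition find_base : cmd :=
  Seq (Asg 2 (Peek (Cst 0))) (Seq (Asg 8 (Cst 1))
 (Seq (For 9 (Var 2) (Asg 8 (Plus (Plus (Var 8) (Cst 1)) (Peek (Var 8)))))
      (Asg 1 (Var 8)))).

(** The output begins with the input family; the base, being the length of its encoding, is also the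
    position where the output continues. *)
Definition copy_input : cmd :=
  Seq (For 20 (Var 1) (Put 13 (Var 20) (Peek (Var 20)))) (Asg 7 (Var 1)).

Definition square : cmd :=
  Seq (Asg 3 (Cst 0)) (For 9 (Var 2) (Asg 3 (Plus (Var 3) (Var 2)))).

(** Array 2 marks the elements met, so that array 1 lists each of them once. Variable 4 adds all
    elements to its initial value $n^2+1$, which makes the row width exceed $n^2$ and every
    element. *)
Definition read_element : cmd :=
  Seq (Asg 12 (Peek (Var 8))) (Seq (Asg 4 (Plus (Var 4) (Var 12)))
 (Seq (Asg 8 (Plus (Var 8) (Cst 1)))
      (If (Get 2 (Var 12)) Skip
        (Seq (Put 2 (Var 12) (Cst 1)) (Seq (Put 1 (Var 5) (Var 12))
             (Asg 5 (Plus (Var 5) (Cst 1)))))))).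

(** Variable 6 becomes a maximum by adding a truncated difference. *)
Definition read_set : cmd :=
  Seq (Asg 11 (Peek (Var 8))) (Seq (Put 3 (Var 9) (Var 11))
 (Seq (Asg 8 (Plus (Var 8) (Cst 1))) (Seq (Put 4 (Var 9) (Var 8))
 (Seq (Asg 6 (Plus (Var 6) (Minus (Var 11) (Var 6))))
      (For 20 (Var 11) read_element))))).

Definition read_sets : cmd :=
  Seq (Asg 4 (Plus (Var 3) (Cst 1))) (Seq (Asg 8 (Cst 1)) (Seq (Asg 5 (Cst 0))
 (Seq (Asg 6 (Cst 0)) (For 9 (Var 2) read_set)))).

Section Setup.

Variable ss : seq (seq nat).
Let n := size ss.
Let P i := nth [::] ss i.
Let N := size (encode ss).

(** Address of the cell that holds the length of list i. *)
Definition offset i := size (encode (take i ss)).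

Lemma offset0 : offset 0 = 1.
Proof. by rewrite /offset take0. Qed.

Lemma offsetS i : i < n -> offset i.+1 = offset i + (size (P i)).+1.
Proof. by move=> hi; rewrite /offset (take_nth [::]) // size_encode_rcons. Qed.

Lemma offset_n : offset n = N.
Proof. by rewrite /offset take_size. Qed.

Lemma nth_encode i t : i < n -> t <= size (P i) ->
  nth 0 (encode ss) (offset i + t) = nth 0 (size (P i) :: P i) t.
Proof.
move=> hi ht; rewrite /encode -[in flatten _](cat_take_drop i ss) (drop_nth [::]) //.
rewrite map_cat flatten_cat addSn /= nth_cat ltnNge leq_addr /= addKn.
by case: t ht => //= t ht; rewrite nth_cat ht.
Qed.

Lemma offset_lt i t : i < n -> t <= size (P i) -> offset i + t < N.
Proof.
move=> hi ht; have [//|h] := ltnP (offset i + t) N.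
have mono j : i.+1 + j <= n -> offset i.+1 <= offset (i.+1 + j).
  elim: j => [|j IH] hj; first by rewrite addn0.
  rewrite addnS (offsetS (i := i.+1 + j)); last by lia.
  by apply: leq_trans (IH _) (leq_addr _ _); lia.
have := mono (n - i.+1); rewrite subnKC // offset_n offsetS // => /(_ (leqnn _)); lia.
Qed.

Definition input (s : cstate) :=
  base s = N /\ forall p, p < N -> memory s p = nth 0 (encode ss) p.

Lemma same_input vs aa s s' : same vs aa s s' -> input s -> input s'.
Proof.
move=> sm [h1 h2]; split; first by rewrite (same_base sm).
by move=> p hp; rewrite (same_in sm) ?h1 // h2.
Qed.

Lemma input_asg s r v : r != 1 -> input s -> input (asg s r v).
Proof. by move=> h [h1 h2]; split=> //; rewrite /base vars_asg eq_sym (negbTE h). Qed.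

Lemma read_input s i t : input s -> i < n -> t <= size (P i) ->
  memory s (offset i + t) = nth 0 (size (P i) :: P i) t.
Proof. by move=> [_ h] hi ht; rewrite h ?offset_lt // nth_encode. Qed.

Lemma eval_peek s e : eval s (Peek e) = memory s (eval s e). Proof. by []. Qed.

Lemma find_base_spec :
  wp find_base (fun s => [/\ input s, vars s 2 = n, vars s 0 = 0,
       forall a i, arr s a i = 0 & clock s <= 3 * n + 6])
    (CState (fun=> 0) (nth 0 (encode ss)) 0).
Proof.
apply: wp_seq; apply: wp_asg; rewrite eval_peek evalE; apply: wp_seq; apply: wp_asg; rewrite evalE.
set s0 := asg _ _ _.
pose I k s1 := [/\ vars s1 8 = offset k, memory s1 = nth 0 (encode ss), vars s1 0 = 0 &
  clock s1 <= 3 * k + 3].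
apply: wp_seq; apply: (wp_for (N := n) (I := I)) => //.
- by move=> s' sm; rewrite evalE (same_var sm) // /s0 !stateE.
- by split; rewrite ?offset0.
- move=> k s1 hk sm vk [I1 I2 I3 I4].
  apply: wp_asg => _; rewrite !evalE eval_peek evalE; split; rewrite ?stateE //=.
  + rewrite I1 I2 offsetS //; have := @nth_encode k 0 hk isT; rewrite addn0 => ->.
    by rewrite /=; lia.
  + by lia.
- move=> s' sm [I1 I2 I3 I4]; apply: wp_asg; rewrite evalE stateE I1 offset_n; split.
  + by split=> // p hp; rewrite [memory _]I2.
  + by rewrite !stateE (same_var sm) // /s0 !stateE.
  + by rewrite !stateE.
  + by move=> a i; rewrite /arr /base vars_asg /= I2 nth_default // leq_addr.
  + by rewrite !stateE; lia.
Qed.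

Lemma copy_input_spec s : input s -> wp copy_input (fun s' => out s' ss /\
  clock s' <= clock s + (3 * N + 3)) s.
Proof.
move=> inp.
pose I k s1 := (forall q, q < k -> arr s1 13 q = nth 0 (encode ss) q) /\
  clock s1 <= clock s + 3 * k + 1.
apply: wp_seq; apply: (wp_for (N := N) (I := I)) => //.
- by move=> s' sm; have [h _] := same_input sm inp.
- by split=> //; rewrite stateE; lia.
- move=> k s1 hk sm vk [I1 I2]; have inp1 := same_input sm inp.
  apply: wp_put => _; rewrite !(evalE, eval_peek, stateE) vk; split.
  + move=> q; rewrite ltnS leq_eqVlt arr_asg // arr_store_arr //=.
    case: eqVneq => [-> _|_ /= hq]; last by rewrite stateE I1.
    by case: inp1 => _ ->.
  + by rewrite !stateE; lia.
- move=> s' sm [I1 I2]; have [b _] := same_input sm inp.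
  apply: wp_asg; rewrite !(evalE, stateE) [vars s' 1]b; split; last by lia.
  by split=> [|q hq]; rewrite ?stateE // arr_asg // stateE I1.
Qed.

Lemma square_spec s : vars s 2 = n -> wp square (fun s' => vars s' 3 = n * n /\
  clock s' <= clock s + (3 * n + 3)) s.
Proof.
move=> v2; apply: wp_seq; apply: wp_asg; rewrite evalE.
pose I k s1 := vars s1 3 = k * n /\ clock s1 <= clock s + 3 * k + 2.
apply: (wp_for (N := n) (I := I)) => //.
- by move=> s' sm; rewrite evalE (same_var sm) // stateE.
- by split=> //; rewrite !stateE; lia.
- move=> k s1 hk sm vk [I1 I2]; apply: wp_asg => _; rewrite !evalE; split; rewrite !stateE /=.
  + by rewrite I1 (same_var sm) // stateE /= v2 mulSn addnC.
  + by lia.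
- by move=> s' sm [I1 I2]; split; rewrite stateE //; lia.
Qed.

(** Here [xs] is what has been read so far, with repetitions, and [c] is the initial value of
    variable 4. *)
Definition names_inv s (nm xs : seq nat) c :=
  [/\ uniq nm, nm =i xs, vars s 5 = size nm /\ vars s 4 = c + sumn xs,
   forall x, (arr s 2 x != 0) = (x \in nm) & forall r, r < size nm -> arr s 1 r = nth 0 nm r].

Lemma read_element_spec s nm xs c x : names_inv s nm xs c -> memory s (vars s 8) = x ->
  wp read_element (fun s' => (exists nm', names_inv s' nm' (rcons xs x) c) /\
     vars s' 8 = (vars s 8).+1 /\ clock s' <= clock s + 7) s.
Proof.
move=> [un nx [v5 v4] a2 a1] mx.
apply: wp_seq; apply: wp_asg; rewrite !(evalE, eval_peek) mx.
apply: wp_seq; apply: wp_asg; rewrite !(evalE, stateE) v4 /=.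
apply: wp_seq; apply: wp_asg; rewrite !(evalE, stateE) /= addn1.
apply: wp_if; rewrite !(evalE, stateE) /= !arr_asg // => h.
  apply: wp_skip; split; last by split; rewrite ?stateE //=; lia.
  have xin : x \in nm by rewrite -a2.
  exists nm; split=> //.
  - by move=> y; rewrite nx mem_rcons inE; case: eqP => // ->; rewrite -nx.
  - by rewrite !stateE /= v5 sumn_rcons addnA.
have xn : x \notin nm by rewrite -a2 h.
apply: wp_seq; apply: wp_put; apply: wp_seq; apply: wp_put; apply: wp_asg.
rewrite !(evalE, stateE) /= v5; split; last by split; rewrite ?stateE //=; lia.
exists (rcons nm x); split.
- by rewrite rcons_uniq xn.
- by move=> y; rewrite !mem_rcons !inE nx.
- by rewrite !stateE /= size_rcons sumn_rcons addnA addn1.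
- move=> y; rewrite arr_asg // !arr_store_arr //= mem_rcons inE.
  by case: (y =P x) => // _; rewrite ?stateE ?arr_asg // a2.
- move=> r; rewrite size_rcons ltnS nth_rcons leq_eqVlt arr_asg // !arr_store_arr //=.
  case: eqVneq => [->|_ /= hr]; first by rewrite ltnn.
  by rewrite hr ?stateE ?arr_asg // a1.
Qed.

Lemma names_inv_eq s s' nm xs c : vars s' 5 = vars s 5 -> vars s' 4 = vars s 4 ->
  (forall a i, a \in [:: 1; 2] -> arr s' a i = arr s a i) -> names_inv s nm xs c -> names_inv s' nm xs c.
Proof.
move=> v5 v4 A [un nx v a2 a1]; split=> //; first by rewrite v5 v4.
- by move=> x; rewrite A.
- by move=> r hr; rewrite A // a1.
Qed.

Lemma read_set_spec s nm c i : input s -> i < n -> vars s 9 = i -> vars s 8 = offset i ->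
  names_inv s nm (flatten (take i ss)) c ->
  wp read_set (fun s' => [/\ exists nm', names_inv s' nm' (flatten (take i.+1 ss)) c,
     vars s' 8 = offset i.+1, vars s' 6 = maxn (vars s 6) (size (P i)),
     forall j, arr s' 3 j = (if j == i then size (P i) else arr s 3 j) /\
               arr s' 4 j = (if j == i then (offset i).+1 else arr s 4 j) &
     clock s' <= clock s + (9 * size (P i) + 7)]) s.
Proof.
move=> inp hi v9 v8 nmi.
have m0 : memory s (offset i) = size (P i).
  by have := read_input (t := 0) inp hi isT; rewrite addn0.
apply: wp_seq; apply: wp_asg; rewrite !(evalE, eval_peek) v8 m0.
apply: wp_seq; apply: wp_put; rewrite !(evalE, stateE) /= v9.
apply: wp_seq; apply: wp_asg; rewrite !(evalE, stateE) /= v8 addn1.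
apply: wp_seq; apply: wp_put; rewrite !(evalE, stateE) /= v9.
apply: wp_seq; apply: wp_asg; rewrite !(evalE, stateE) /=.
set s0 := asg _ 6 _.
have V0 r : r \notin [:: 6; 8; 11] -> vars s0 r = vars s r.
  by rewrite !inE !negb_or /s0 !stateE => /and3P[/negbTE-> /negbTE-> /negbTE->].
have V8 : vars s0 8 = (offset i).+1 by rewrite /s0 !stateE.
have V6 : vars s0 6 = maxn (vars s 6) (size (P i)) by rewrite /s0 !stateE /= maxnE.
have V11 : vars s0 11 = size (P i) by rewrite /s0 !stateE.
have A0 a j : a < 16 -> a \notin [:: 3; 4] -> arr s0 a j = arr s a j.
  rewrite !inE !negb_or => h /andP[/negbTE h3 /negbTE h4].
  by rewrite /s0 arr_asg // arr_store_arr ?h // h4 /= arr_asg // arr_store_arr ?h // h3 /= arr_asg.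
have A3 j : arr s0 3 j = if j == i then size (P i) else arr s 3 j.
  by rewrite /s0 arr_asg // arr_store_arr //= arr_asg // arr_store_arr //= arr_asg.
have A4 j : arr s0 4 j = if j == i then (offset i).+1 else arr s 4 j.
  rewrite /s0 arr_asg // arr_store_arr //=; case: eqP => // _.
  by rewrite arr_asg // arr_store_arr //= arr_asg.
have T0 : clock s0 = clock s + 5 by rewrite /s0 !stateE; lia.
have inp0 : input s0.
  have sm : same [:: 6; 8; 11] [:: 3; 4] s s0.
    by rewrite /s0; do !(apply: same_asg => // || apply: same_store_arr => //).
  exact: same_input sm inp.
have nmi0 : names_inv s0 nm (flatten (take i ss)) c.
  by apply: names_inv_eq nmi; rewrite ?V0 // => a j; rewrite !inE => /orP[]/eqP->; rewrite A0.
clearbody s0.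
pose I k s1 := [/\ exists nm', names_inv s1 nm' (flatten (take i ss) ++ take k (P i)) c,
  vars s1 8 = offset i + k.+1 & clock s1 <= clock s + 9 * k + 6].
apply: (wp_for (N := size (P i)) (I := I)) => //.
- by move=> s' sm; rewrite evalE (same_var sm) // V11.
- split.
  + by exists nm; rewrite take0 cats0; apply: names_inv_eq nmi0 => // *; rewrite arr_asg.
  + by rewrite stateE V8 addn1.
  + by rewrite stateE; lia.
- move=> k s1 hk sm vk [[nm1 nmi1] I2 I3]; have inp1 := same_input sm inp0.
  have nmi1' : names_inv (tick s1) nm1 (flatten (take i ss) ++ take k (P i)) c.
    by apply: names_inv_eq nmi1 => // *; rewrite stateE.
  have mx : memory (tick s1) (vars (tick s1) 8) = nth 0 (P i) k.
    by rewrite stateE I2; apply: (read_input inp1 hi).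
  apply: wp_conseq (read_element_spec nmi1' mx) _ => s2 [[nm2 nmi2] [v8' t2]] _; split.
  + exists nm2; rewrite (take_nth 0) // -rcons_cat.
    by apply: names_inv_eq nmi2 => // *; rewrite arr_asg.
  + by rewrite stateE /= v8' stateE I2 [in RHS]addnS.
  + by rewrite stateE; move: t2; rewrite stateE; lia.
- move=> s' sm [[nm' nmi'] I2 I3]; split.
  + exists nm'; rewrite (take_nth [::]) // flatten_rcons -/(P i) -[X in _ ++ X]take_size.
    by apply: names_inv_eq nmi' => // *; rewrite stateE.
  + by rewrite stateE I2 offsetS.
  + by rewrite stateE (same_var sm).
  + by move=> j; rewrite !stateE !(same_arr sm) // A3 A4.
  + by rewrite stateE; lia.
Qed.

Let M := sumn (map size ss).
Let L := \max_(s <- ss) size s.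

Lemma read_sets_spec s : input s -> vars s 2 = n -> (forall i, arr s 2 i = 0) ->
  wp read_sets (fun s' => [/\ exists nm, names_inv s' nm (flatten ss) (vars s 3).+1,
     vars s' 6 = L,
     forall i, i < n -> arr s' 3 i = size (P i) /\ arr s' 4 i = (offset i).+1 &
     clock s' <= clock s + (9 * M + 9 * n + 6)]) s.
Proof.
move=> inp v2 z2.
do 4 (apply: wp_seq; apply: wp_asg); rewrite !(evalE, stateE) /=.
set s0 := asg _ 6 0.
have V0 r : r \notin [:: 4; 5; 6; 8] -> vars s0 r = vars s r.
  by rewrite !inE !negb_or /s0 !stateE => /and4P[/negbTE-> /negbTE-> /negbTE-> /negbTE->].
have inp0 : input s0 by do 4 apply: input_asg => //.
pose S k := sumn (map size (take k ss)).
pose I k s1 := [/\ exists nm, names_inv s1 nm (flatten (take k ss)) (vars s 3).+1,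
  vars s1 8 = offset k, vars s1 6 = \max_(x <- take k ss) size x,
  forall i, i < k -> arr s1 3 i = size (P i) /\ arr s1 4 i = (offset i).+1 &
  clock s1 <= clock s + 9 * S k + 9 * k + 5].
apply: (wp_for (N := n) (I := I)) => //.
- by move=> s' sm; rewrite evalE (same_var sm) // V0.
- split=> //.
  + exists [::]; rewrite take0; split=> //; first by rewrite !stateE /= addn0 addn1.
    by move=> x; rewrite /s0 !arr_asg // z2.
  + by rewrite /s0 !stateE /= offset0.
  + by rewrite take0 big_nil /s0 !stateE.
  + by rewrite /s0 !stateE; lia.
- move=> k s1 hk sm vk [[nm nmi] I2 I3 I4 I5]; have inp1 := same_input sm inp0.
  have nmi' : names_inv (tick s1) nm (flatten (take k ss)) (vars s 3).+1.
    by apply: names_inv_eq nmi => // *; rewrite stateE.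
  have inp1' : input (tick s1) by case: inp1.
  apply: wp_conseq (read_set_spec inp1' hk vk I2 nmi') _ => s2 [[nm2 nmi2] J2 J3 J4 J5] _; split.
  + by exists nm2; apply: names_inv_eq nmi2 => // *; rewrite arr_asg.
  + by rewrite stateE.
  + rewrite stateE /= J3 stateE I3 (take_nth [::]) // -cats1 big_cat /= big_seq1 //.
  + move=> i; rewrite ltnS !arr_asg //; have [-> ->] := J4 i; rewrite leq_eqVlt.
    by case: eqP => [->|_ /= /I4].
  + rewrite stateE /S (take_nth [::]) // map_rcons sumn_rcons -/(P k) -/(S k).
    by move: J5; rewrite stateE; lia.
- move=> s' sm [[nm nmi] I2 I3 I4 I5]; rewrite take_size in nmi I3; split.
  + by exists nm; apply: names_inv_eq nmi => // *; rewrite stateE.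
  + by rewrite stateE I3.
  + by [].
  + by move: I5; rewrite stateE /S take_size -/M; lia.
Qed.

End Setup.

(** * Tables and initial chains *)

Definition fill_rows : cmd :=
  Seq (Asg 21 (Cst 0))
      (For 16 (Var 3) (Seq (Put 5 (Var 16) (Var 21)) (Asg 21 (Plus (Var 21) (Var 4))))).

Definition fill_sources : cmd :=
  Seq (Asg 16 (Cst 0))
      (For 9 (Var 2) (For 10 (Var 2)
        (Seq (Put 6 (Var 16) (Var 9)) (Asg 16 (Plus (Var 16) (Cst 1)))))).

Definition fill_bits : cmd :=
  For 9 (Var 2) (For 20 (Get 3 (Var 9))
    (Put 0 (Plus (Get 5 (Var 9)) (Peek (Plus (Get 4 (Var 9)) (Var 20)))) (Cst 1))).

(** The heads are still empty at this stage; [append] lowers the counts when it copies the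
    sources. *)
Definition init_counts : cmd :=
  For 13 (Var 3) (For 22 (Var 2)
    (Put 10 (Plus (Get 5 (Var 13)) (Var 22)) (Get 3 (Var 22)))).

Definition init_chains : cmd :=
  For 13 (Var 3) (For 20 (Get 3 (Get 6 (Var 13)))
    (Seq (Asg 18 (Peek (Plus (Get 4 (Get 6 (Var 13))) (Var 20)))) append)).

Section Tables.

Variables (ss : seq (seq nat)) (W L : nat) (nm : seq nat).
Let n := size ss.
Let U := n * n.
Let P i := nth [::] ss i.

Lemma fill_rows_spec s : vars s 3 = U -> vars s 4 = W ->
  wp fill_rows (fun s' => (forall v, v < U -> arr s' 5 v = v * W) /\
     clock s' <= clock s + (4 * U + 3)) s.
Proof.
move=> v3 v4; apply: wp_seq; apply: wp_asg; rewrite evalE.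
pose I k s1 := [/\ vars s1 21 = k * W, forall v, v < k -> arr s1 5 v = v * W &
  clock s1 <= clock s + 4 * k + 2].
apply: (wp_for (N := U) (I := I)) => //.
- by move=> s' sm; rewrite evalE (same_var sm).
- by split=> //; rewrite !stateE; lia.
- move=> k s1 hk sm vk [I1 I2 I3].
  apply: wp_seq; apply: wp_put; rewrite !(evalE, stateE) vk I1.
  apply: wp_asg => _; rewrite !(evalE, stateE) I1 (same_var sm) // stateE /= v4; split.
  + by rewrite stateE /= mulSn addnC.
  + move=> v; rewrite ltnS leq_eqVlt !arr_asg // arr_store_arr //=.
    by case: eqVneq => [->//|_ /= hv]; rewrite stateE I2.
  + by rewrite !stateE; lia.
- by move=> s' sm [I1 I2 I3]; split=> // ; rewrite stateE; lia.
Qed.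

Lemma fill_sources_spec s : vars s 2 = n ->
  wp fill_sources (fun s' => (forall v, v < U -> arr s' 6 v = v %/ n) /\
     clock s' <= clock s + (4 * U + 4 * n + 3)) s.
Proof.
move=> v2; apply: wp_seq; apply: wp_asg; rewrite evalE.
pose I c v s1 := [/\ vars s1 16 = v, forall w, w < v -> arr s1 6 w = w %/ n &
  clock s1 <= clock s + 4 * v + c].
apply: (wp_for (N := n) (I := fun i => I (4 * i + 2) (i * n))) => //.
- by move=> s' sm; rewrite evalE (same_var sm).
- by split=> //; rewrite !stateE; lia.
- move=> i s1 hi sm vi [I1 I2 I3].
  apply: (wp_for (N := n) (I := fun j => I (4 * i + 4) (i * n + j))) => //.
  + by move=> s' sm'; rewrite evalE (same_var sm') // stateE (same_var sm).
  + split; rewrite ?addn0 // !stateE /=; lia.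
  + move=> j s2 hj sm' vj [J1 J2 J3].
    apply: wp_seq; apply: wp_put; rewrite !(evalE, stateE) J1.
    apply: wp_asg => _; rewrite !(evalE, stateE) J1; split.
    * by rewrite ?stateE /=; lia.
    * move=> v; rewrite addnS ltnS leq_eqVlt !arr_asg // arr_store_arr //=.
      case: eqVneq => [-> _|_ /= hv]; last by rewrite stateE J2.
      rewrite (same_var sm') // stateE vi divnMDl ?divn_small ?addn0 //.
      by apply: leq_ltn_trans hj.
    * by rewrite !stateE; lia.
  move=> s' sm' [J1 J2 J3] _; split.
  + by rewrite !stateE /= J1 mulSn addnC.
  + by move=> w hw; rewrite arr_asg // stateE J2 // addnC -mulSn.
  + by rewrite !stateE mulSn; lia.
- by move=> s' sm [I1 I2 I3]; split=> //; rewrite stateE; move: I3; rewrite -/U; lia.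
Qed.

Hypothesis ltW : forall i x, x \in P i -> x < W.
Hypothesis ltUW : U < W.

Definition read_tables s :=
  [/\ input ss s, vars s 2 = n, forall v, v < U -> arr s 5 v = v * W &
      forall i, i < n -> arr s 3 i = size (P i) /\ arr s 4 i = (offset ss i).+1].

Lemma same_read_tables vs aa s s' : same vs aa s s' -> 2 \notin vs ->
  all (fun a => a \notin aa) [:: 3; 4; 5] -> read_tables s -> read_tables s'.
Proof.
move=> sm v2 /and4P[a3 a4 a5 _] [h1 h2 h3 h4]; split.
- exact: same_input sm h1.
- by rewrite (same_var sm).
- by move=> v hv; rewrite (same_arr sm) // h3.
- by move=> i hi; rewrite !(same_arr sm) //; apply: h4.
Qed.

Lemma fill_bits_spec s B : read_tables s -> (forall i, arr s 0 i = 0) -> (forall i, size (P i) <= B) ->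
  wp fill_bits (fun s' => (forall i x, i < n -> x < W -> arr s' 0 (i * W + x) = (x \in P i)) /\
     clock s' <= clock s + ((3 * B + 4) * n + 2)) s.
Proof.
move=> rt z hB.
pose I i s1 := (forall i' x, i' < n -> x < W ->
  arr s1 0 (i' * W + x) = (i' < i) && (x \in P i') :> nat) /\ clock s1 <= clock s + (3 * B + 4) * i + 1.
apply: (wp_for (N := n) (I := I)) => //.
- by move=> s' sm; rewrite evalE (same_var sm) //; case: rt.
- split=> [i' x _ _|]; first by rewrite arr_asg // z.
  by rewrite stateE; lia.
- move=> i s1 hi sm vi [I1 I2].
  have rt1 : read_tables (tick s1).
    by exact: same_read_tables (same_tick sm) _ _ rt.
  have [inp1 n1 row1 st1] := rt1; have [sz1 of1] := st1 _ hi.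
  pose J k s2 := (forall i' x, i' < n -> x < W ->
    arr s2 0 (i' * W + x) = (i' < i) && (x \in P i') || (i' == i) && (x \in take k (P i)) :> nat) /\
    clock s2 <= clock s1 + 3 * k + 2.
  apply: (wp_for (N := size (P i)) (I := J)) => //.
  + by move=> s' sm'; rewrite !evalE (same_arr sm') // (same_var sm') // stateE vi.
  + split=> [i' x hi' hx|]; last by rewrite !stateE; lia.
    by rewrite take0 andbF orbF arr_asg // stateE I1.
  + move=> k s2 hk sm' vk [J1 J2].
    have rt2 : read_tables (tick s2) by exact: same_read_tables (same_tick sm') _ _ rt1.
    have [inp2 n2 row2 st2] := rt2; have [sz2 of2] := st2 _ hi.
    apply: wp_put; rewrite !(evalE, eval_peek) !stateE vk (same_var sm') // stateE vi.
    rewrite -arr_tick row2 ?nU // -(arr_tick s2 4) of2 addSnnS => _.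
    rewrite (read_input inp2) //= -/(P i).
    have mW : nth 0 (P i) k < W by apply: ltW (mem_nth _ hk).
    split=> [i' x hi' hx|]; last by rewrite !stateE; lia.
    rewrite arr_asg // arr_store_arr //= idx_eq // (take_nth 0) // mem_rcons inE stateE J1 //.
    by case: (i' == i); case: (x == nth 0 (P i) k); rewrite ?orbT ?andbF ?andbT.
  move=> s' sm' [J1 J2] _; split=> [i' x hi' hx|].
    rewrite arr_asg // stateE J1 // take_size [in RHS]ltnS [in RHS]leq_eqVlt.
    by case: eqVneq => [->|_] /=; rewrite ?ltnn ?orbF.
  by rewrite !stateE; have := hB i; lia.
- by move=> s' sm [I1 I2]; split=> [i x hi hx|]; rewrite stateE ?I1 ?hi //; lia.
Qed.

Lemma init_counts_spec s : read_tables s -> vars s 3 = U ->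
  wp init_counts (fun s' =>
     (forall u i, u < U -> i < n -> arr s' 10 (u * W + i) = size (P i)) /\
     clock s' <= clock s + ((3 * n + 4) * U + 2)) s.
Proof.
move=> rt v3.
pose I u s1 := (forall u' i, u' < u -> i < n -> arr s1 10 (u' * W + i) = size (P i)) /\
  clock s1 <= clock s + (3 * n + 4) * u + 1.
apply: (wp_for (N := U) (I := I)) => //.
- by move=> s' sm; rewrite evalE (same_var sm).
- by split=> //; rewrite stateE; lia.
- move=> u s1 hu sm vu [I1 I2].
  have rt1 : read_tables (tick s1).
    by exact: same_read_tables (same_tick sm) _ _ rt.
  pose J k s2 := (forall u' i, u' <= u -> i < n -> (u' < u) || (i < k) ->
      arr s2 10 (u' * W + i) = size (P i)) /\
    clock s2 <= clock s1 + 3 * k + 2.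
  have lW i : i < n -> i < W by move=> hi; apply: ltn_trans (nU hi) ltUW.
  apply: (wp_for (N := n) (I := J)) => //.
  + by move=> s' sm'; rewrite evalE (same_var sm') //; case: rt1.
  + split=> [u' i hu' hi|]; last by rewrite !stateE; lia.
    by rewrite orbF arr_asg // stateE => h; apply: I1.
  + move=> k s2 hk sm' vk [J1 J2].
    have rt2 : read_tables (tick s2) by exact: same_read_tables (same_tick sm') _ _ rt1.
    have [inp2 n2 row2 st2] := rt2; have [sz2 of2] := st2 _ hk.
    apply: wp_put; rewrite !evalE !stateE vk (same_var sm') // stateE vu.
    rewrite -(arr_tick s2 5) row2 // -(arr_tick s2 3) sz2 => _.
    split=> [u' i hu' hi|]; last by rewrite !stateE; lia.
    rewrite arr_asg // arr_store_arr //= idx_eq ?lW // ltnS (leq_eqVlt i).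
    case: (altP andP) => [[/eqP-> /eqP->] //|ne h]; rewrite stateE J1 //.
    by case: (ltngtP u' u) hu' ne h => //= _ _; case: eqP.
  move=> s' sm' [J1 J2] _; split=> [u' i hu' hi|].
    by rewrite arr_asg // stateE J1 // hi orbT.
  by rewrite !stateE; lia.
- by move=> s' sm [I1 I2]; split=> // ; rewrite stateE; lia.
Qed.

Lemma heads_ext s s' f f' : (forall a i, a \in [:: 7; 8; 9; 10] -> arr s' a i = arr s a i) ->
  (forall u, u < U -> f' u = f u) -> heads ss W s f -> heads ss W s' f'.
Proof.
move=> A F [h1 h2 h3 h4]; split.
- by move=> u hu; rewrite A // F //; apply: h1.
- by move=> u t hu; rewrite A // F //; apply: h2.
- by move=> u x hu hx; rewrite A // F //; apply: h3.
- by move=> u i hu hi; rewrite A // F //; apply: h4.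
Qed.

Hypothesis uniq_ss : all uniq ss.

Lemma init_chains_spec s B : read_tables s -> static ss W L nm s -> heads ss W s (fun=> [::]) ->
  (forall i, size (P i) <= B) ->
  wp init_chains (fun s' => heads ss W s' (src ss) /\
     clock s' <= clock s + ((B * (4 * n + 8) + 4) * U + 2)) s.
Proof.
move=> rt st hd hB.
pose I u s1 := heads ss W s1 (fun v => if v < u then src ss v else [::]) /\
  clock s1 <= clock s + (B * (4 * n + 8) + 4) * u + 1.
apply: (wp_for (N := U) (I := I)) => //.
- by move=> s' sm; rewrite evalE (same_var sm) //; case: st.
- split; last by rewrite stateE; lia.
  by apply: heads_ext hd => // *; rewrite arr_asg.
- move=> u s1 hu sm vu [I1 I2].
  have st1 : static ss W L nm (tick s1) by exact: same_static (same_tick sm) _ _ st.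
  have rt1 : read_tables (tick s1).
    by exact: same_read_tables (same_tick sm) _ _ rt.
  have [inp1 n1 row1 sz1] := rt1.
  have hi : u %/ n < n by apply: src_lt hu.
  (* The chains before u are filled, chain u up to k elements, and the later ones are empty. *)
  pose g k v := if v < u then src ss v else if v == u then take k (src ss u) else [::].
  pose J k s2 := heads ss W s2 (g k) /\ clock s2 <= clock s1 + (4 * n + 8) * k + 2.
  apply: (wp_for (N := size (src ss u)) (I := J)) => //.
  + move=> s' sm'; rewrite !evalE !(same_arr sm') // (same_var sm') // stateE vu.
    by rewrite (st_pa st1) //; have [E _] := sz1 _ hi; rewrite -(arr_tick s1 3) E.
  + split; last by rewrite !stateE; lia.
    apply: heads_ext I1 => [a i|v hv]; first by rewrite arr_asg // stateE.
    by rewrite /g take0; case: ifP => // _; case: eqP.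
  + move=> k s2 hk sm' vk [J1 J2].
    have st2 : static ss W L nm (tick s2) by exact: same_static (same_tick sm') _ _ st1.
    have rt2 : read_tables (tick s2) by exact: same_read_tables (same_tick sm') _ _ rt1.
    have [inp2 n2 row2 sz2] := rt2; have [_ of2] := sz2 _ hi.
    have vu2 : vars s2 13 = u by rewrite (same_var sm') // stateE.
    apply: wp_seq; apply: wp_asg.
    rewrite eval_peek !(evalE, stateE) vk vu2 -(arr_tick s2 6) (st_pa st2) // -(arr_tick s2 4) of2 addSnnS.
    rewrite (read_input inp2) //=.
    set y := nth 0 _ k; set s3 := asg _ _ _.
    have sm3 : same [:: 18] [::] (tick s2) s3 by apply: same_asg.
    have st3 : static ss W L nm s3 by apply: same_static sm3 _ _ st2.
    have hd3 : heads ss W s3 (g k).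
      by apply: heads_ext J1 => // *; rewrite /s3 arr_asg.
    have bd : bounded ss W (g k).
      move=> v hv; rewrite /g; case: ifP => _; first by split; [apply: uniq_P|move=> x; apply: ltW].
      case: eqP => // _; split; first by apply: take_uniq; apply: uniq_P.
      by move=> x /mem_take; apply: ltW.
    have gu : g k u = take k (src ss u) by rewrite /g ltnn eqxx.
    have yW : y < W by apply: ltW (mem_nth _ hk).
    have yn : y \notin g k u.
      have us : uniq (take k (src ss u) ++ drop k (src ss u)).
        by rewrite cat_take_drop; apply: uniq_P.
      by move: us; rewrite gu (drop_nth 0) // cat_uniq => /and3P[_ /norP[]].
    have v13 : vars s3 13 = u by rewrite /s3 !stateE.
    have v18 : vars s3 18 = y by rewrite /s3 !stateE.
    apply: wp_conseq (append_spec uniq_ss ltUW st3 hd3 bd hu v13 v18 yW yn) _ => s4 [hd4 t4] _; split.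
      apply: heads_ext hd4 => [a i ha|v hv]; first by rewrite arr_asg.
      rewrite /upd gu /g; case: eqVneq => [->|//].
      by rewrite ltnn (take_nth 0).
    by rewrite stateE; move: t4; rewrite /s3 !stateE -/n; lia.
  move=> s' sm' [J1 J2] _; split.
    apply: heads_ext J1 => [a i ha|v hv]; first by rewrite arr_asg.
    by rewrite /g ltnS leq_eqVlt take_size; case: eqP => [->|//]; rewrite ltnn.
  have := hB (u %/ n); rewrite -/(src ss u) => h.
  have : (4 * n + 8) * size (src ss u) <= B * (4 * n + 8) by rewrite mulnC leq_mul2r h orbT.
  by rewrite !stateE; lia.
- move=> s' sm [I1 I2]; split; last by rewrite stateE; lia.
  by apply: heads_ext I1 => // v hv; rewrite hv.
Qed.

End Tables.

Definition extend : cmd :=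
  Seq copy_input (Seq square (Seq read_sets (Seq fill_rows (Seq fill_sources
 (Seq fill_bits (Seq init_counts (Seq init_chains do_levels))))))).

(** Array 13 is spread out with stride 16, while the output must fill consecutive cells. The moves
    start at address 0 and overwrite the input, so they are raw stores outside the frame
    discipline. *)
Definition compact : cmd :=
  Seq (Asg 20 (Cst 0))
      (While (Minus (Var 7) (Var 20))
        (Seq (Store (Var 20) (Get 13 (Var 20))) (Asg 20 (Plus (Var 20) (Cst 1))))).

Definition extension_program : cmd := Seq find_base (Seq extend compact).

Lemma big_divmod n k (g : nat -> nat -> nat) : 0 < n ->
  \sum_(u < k * n) g (u %/ n) (u %% n) = \sum_(i < k) \sum_(j < n) g i j.
Proof.
move=> n0; elim: k => [|k IH]; first by rewrite mul0n !big_ord0.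
rewrite mulSnr big_split_ord big_ord_recr /= IH; congr (_ + _).
by apply: eq_bigr => j _; rewrite divnMDl // modnMDl divn_small ?modn_small ?addn0.
Qed.

(** * Total time *)

Section Bounds.

Variable ss : seq (seq nat).
Let n := size ss.
Let U := n * n.
Let P i := nth [::] ss i.
Let M := sumn (map size ss).
Let L := \max_(s <- ss) size s.

Lemma sum_size : \sum_(i < n) size (P i) = M.
Proof. by rewrite /M sumnE big_map (big_nth [::]) big_mkord. Qed.

(** Double counting of the pairs of an element and an input set containing it. *)
Lemma sum_degree (nm : seq nat) : uniq nm -> \sum_(r < size nm) degree ss nm r <= M.
Proof.
move=> un; rewrite /degree exchange_big -sum_size /=; apply: leq_sum => j _.
rewrite -(big_mkord xpredT (fun i => nat_of_bool (nth 0 nm i \in P j))).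
rewrite -(big_nth 0 xpredT (fun x => nat_of_bool (x \in P j))) -big_mkcond /=.
rewrite sum1_count -size_filter; apply: uniq_leq_size; first exact: filter_uniq.
by move=> x; rewrite mem_filter => /andP[].
Qed.

Lemma size_le_max i : size (P i) <= L.
Proof.
have [h|h] := ltnP i n; last by rewrite /P nth_default.
by rewrite /L (big_rem (P i)) ?mem_nth //= leq_maxl.
Qed.

Lemma max_le_sum : L <= M.
Proof.
rewrite /L /M; elim: (ss) => [|s t IH]; first by rewrite big_nil.
rewrite big_cons /= geq_max leq_addr /=; apply: leq_trans IH (leq_addl _ _).
Qed.

(** The sets are distinct, so at most one of them is empty. *)
Lemma size_le_sum : uniq ss -> n <= M.+1.
Proof.
move=> us; rewrite /n -(count_predC (pred1 [::]) ss) count_uniq_mem // -add1n.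
apply: leq_add; first by case: (_ \in _).
rewrite /M; elim: (ss) => //= s t IH; apply: leq_add => //.
by case: s.
Qed.

Variables (f : nat -> seq nat) (A : seq (seq nat)) (rank : nat -> nat) (k r : nat).
Hypothesis inv : chain_inv ss rank f A k r.

Lemma chain_size u : u < U -> size (f u) <= size (src ss u) + size (tgt ss u).
Proof.
move=> hu; have [c [E uf sub]] := chain_shape inv hu.
rewrite E size_cat leq_add2l; apply: uniq_leq_size => //.
by move: uf; rewrite E cat_uniq => /and3P[].
Qed.

(** A chain is no longer than its source and target together; over all $n^2$ pairs each input set
    occurs n times as a source and n times as a target. *)
Lemma gam_le : gam ss f <= 2 * n * M.
Proof.
have [E|n0] := posnP n.
  by rewrite /gam big1 // => -[u hu] _; exfalso; move: hu; rewrite -/n E.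
apply: (@leq_trans (\sum_(u < n * n) (size (P (u %/ n)) + size (P (u %% n))))).
  by apply: leq_sum => u _; apply: chain_size.
rewrite (big_divmod n (fun i j => size (P i) + size (P j))) //.
rewrite (eq_bigr (fun i : 'I_n => n * size (P i) + M)) => [|i _]; last first.
  by rewrite big_split /= sum_nat_const card_ord sum_size.
by rewrite big_split /= -big_distrr /= sum_size sum_nat_const card_ord; lia.
Qed.

Hypothesis uniq_ss : all uniq ss.

(** The new generators are distinct prefixes of chains; the chains have [gam + U] prefixes in all,
    empty ones included, and each generator takes at most $2\ell+1$ cells. *)
Lemma size_out : uniq [seq fset_of s | s <- ss] ->
  size (encode (ss ++ A)) <= 1 + n + M + (gam ss f + U) * (2 * L + 1).
Proof.
move=> us; have [_ usA _] := final_lists uniq_ss inv us.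
have uA : uniq A by have := map_uniq usA; rewrite cat_uniq => /and3P[].
have szX X : X \in A -> size X <= 2 * L.
  move=> /(new_chain inv)[u [t [hu _ ht ->]]].
  rewrite size_takel //; apply: (leq_trans ht); apply: leq_trans (chain_size hu) _.
  by have := size_le_max (u %/ n); have := size_le_max (u %% n); rewrite /src /tgt -/n -!/(P _); lia.
have szA : size A <= gam ss f + U.
  pose T := flatten [seq [seq take t (f u) | t <- iota 0 (size (f u)).+1] | u <- iota 0 U].
  have -> : gam ss f + U = size T.
    rewrite size_flatten /shape -map_comp sumnE big_map /gam -/n.
    rewrite -[X in _ + X](card_ord U) -sum1_card -big_split /=.
    rewrite -(big_mkord xpredT (fun u => size (f u) + 1)) /index_iota subn0.
    by apply: eq_bigr => u _; rewrite /= size_map size_iota addn1.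
  apply: uniq_leq_size => // X /(new_chain inv)[u [t [hu _ ht ->]]].
  apply/flatten_mapP; exists u; first by rewrite mem_iota.
  by apply/mapP; exists t; rewrite // mem_iota.
have szE gs : size (encode gs) = 1 + size gs + sumn (map size gs).
  rewrite /encode /= size_flatten /shape -map_comp.
  by elim: gs => //= s t; lia.
rewrite szE size_cat map_cat sumn_cat -/n -/M.
have : sumn (map size A) <= size A * (2 * L).
  elim: (A) szX => //= X t IH szX; rewrite mulSn leq_add ?szX ?mem_head // IH // => Y hY.
  by rewrite szX // inE hY orbT.
have : size A * (2 * L) <= (gam ss f + U) * (2 * L) by rewrite leq_mul2r szA orbT.
by lia.
Qed.

End Bounds.

(* Entry q of the output array lies above address q, so that it is read before
   being overwritten. *)
Lemma compact_spec s gs : out s gs -> vars s 0 = 0 -> wp compact (fun s' =>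
   vars s' 0 = 0 /\ (forall q, q < size (encode gs) -> memory s' q = nth 0 (encode gs) q) /\
   clock s' <= clock s + (3 * size (encode gs) + 2)) s.
Proof.
move=> [o7 o13] v0; apply: wp_seq; apply: wp_asg; rewrite evalE.
set O := size (encode gs) in o7 o13 *.
pose I s1 := exists q, [/\ q <= O /\ vars s1 20 = q, vars s1 7 = O /\ vars s1 0 = 0,
  forall q', q' < q -> memory s1 q' = nth 0 (encode gs) q',
  forall q', q <= q' < O -> arr s1 13 q' = nth 0 (encode gs) q' &
  clock s1 <= clock s + 3 * q + 1].
apply: (wp_while (I := I) (M := fun s1 => O - vars s1 20)).
- by exists 0; split=> //; rewrite stateE; lia.
- move=> s1 [q [[qO v20] [v7 v0'] m1 a1 t1]]; rewrite !evalE v20 v7 => h.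
  have {}h : q < O by lia.
  apply: wp_seq; exists (store (tick s1) q (arr s1 13 q)).
    by rewrite -v20; apply: RunStore.
  apply: wp_asg; rewrite !evalE [vars (store _ _ _) 20]v20 addn1; split; last first.
    by rewrite stateE /= ?v20; lia.
  exists q.+1; split=> //.
  + move=> q'; rewrite ltnS leq_eqVlt /=; case: eqVneq => [-> _|_ /= hq]; last exact: m1.
    by rewrite a1 // leqnn.
  + move=> q' /andP[h1 h2]; rewrite arr_asg // -(a1 q') ?h2 ?andbT 1?ltnW //.
    rewrite /arr /base /store /= ifN //; apply/eqP; lia.
  + by rewrite stateE /=; lia.
- move=> s1 [q [[qO v20] [v7 v0'] m1 a1 t1]]; rewrite !evalE v20 v7 => h.
  have Eq : q = O by lia.
  by rewrite Eq in m1 t1; split=> //; split=> //; rewrite stateE; lia.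
Qed.

(** * The whole algorithm *)

Section Algorithm.

Variable ss : seq (seq nat).
Let n := size ss.
Let U := n * n.
Let P i := nth [::] ss i.
Let M := sumn (map size ss).
Let L := \max_(s <- ss) size s.
Let N := size (encode ss).
Hypothesis uniq_ss : all uniq ss.

Lemma chain_inv_init rank e : chain_inv ss rank (src ss) [::] 0 e.
Proof.
split=> //; last by move=> [] //.
- by move=> u hu; exists [::]; rewrite cats0; split=> //; apply: uniq_P.
- move=> u t hu ht; rewrite cats0 take_oversize //; apply: inspan_gen; apply: P_in.
  exact: src_lt.
Qed.

Lemma level_inv_init s W nm : static ss W L nm s -> heads ss W s (src ss) ->
  (forall i, arr s 11 i = 0) -> (forall i, arr s 12 i = 0) -> out s ss ->
  level_inv ss W L nm s (src ss) [::] 0 0 (fun=> 0).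
Proof.
move=> st hd z11 z12 ou; split=> //.
- by move=> u v hu hv; rewrite z11 take0.
- by rewrite cats0.
- exact: chain_inv_init.
- move=> u hu; rewrite z12 /seen_count; case: ifP => // _.
  by apply/esym/eqP; rewrite -leqn0 leqNgt -has_count; apply/hasPn => x _ /=; rewrite andbF.
- move=> u hu; have [sub|nsub] := boolP (all (mem (src ss u)) (tgt ss u)).
    by apply: Or31; apply/allP.
  have [E|h] := posnP (size (src ss u)); last exact: Or32.
  by apply: Or33; split=> //; have /allPn[x xt xf] := nsub; exists x.
Qed.

Definition setup_time := 3 * N + 3 + (3 * n + 3) + (9 * M + 9 * n + 6) + (4 * U + 3) +
  (4 * U + 4 * n + 3) + ((3 * L + 4) * n + 2) + ((3 * n + 4) * U + 2) +
  ((L * (4 * n + 8) + 4) * U + 2).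
Definition levels_time := (L + L) * (M * (3 * n + 5) + (8 * n + 3) * M + 4) + 2.

Lemma extend_spec s : input ss s -> vars s 2 = n -> (forall a i, arr s a i = 0) ->
  wp extend (fun s' => exists f A rank k r,
    [/\ chain_inv ss rank f A k r, forall u, u < U -> {subset tgt ss u <= f u},
        out s' (ss ++ A) &
        clock s' <= clock s + setup_time + levels_time +
          (14 * U + 4 * n + 8 * L + 20) * gam ss f]) s.
Proof.
move=> inp v2 z.
apply: wp_seq; apply: wp_conseq (wp_same _ (copy_input_spec inp)) _ => // s1 [sm1 [ou1 t1]].
have inp1 := same_input sm1 inp.
have v2_1 : vars s1 2 = n by rewrite (same_var sm1).
apply: wp_seq; apply: wp_conseq (wp_same _ (square_spec v2_1)) _ => // s2 [sm2 [v3_2 t2]].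
have inp2 := same_input sm2 inp1.
have v2_2 : vars s2 2 = n by rewrite (same_var sm2).
have z2 i : arr s2 2 i = 0 by rewrite (same_arr sm2) // (same_arr sm1).
apply: wp_seq; apply: wp_conseq (wp_same _ (read_sets_spec inp2 v2_2 z2)) _ => // s3 [sm3 [[nm nmi] v6 tab t3]].
case: nmi => un nmE [v5 v4] _ nmA; rewrite v3_2 in v4.
set W := _ + sumn _ in v4.
have ltUW : U < W by rewrite /W addSn ltnS leq_addr.
have memP i x : x \in P i -> x \in flatten ss.
  move=> xi; have [h|h] := ltnP i n; last by rewrite /P nth_default in xi.
  by apply/flattenP; exists (P i) => //; apply: mem_nth.
have flW x : x \in flatten ss -> x < W.
  move=> xf; rewrite /W addSn ltnS; apply: leq_trans (leq_addl _ _).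
  by rewrite sumnE (big_rem x) //= leq_addr.
have ltW i x : x \in P i -> x < W by move=> /memP /flW.
have nm_all i x : x \in P i -> x \in nm by move=> /memP; rewrite nmE.
have nmW x : x \in nm -> x < W by rewrite nmE; apply: flW.
have szP i : size (P i) <= L by apply: size_le_max.
have inp3 := same_input sm3 inp2.
have v3_3 : vars s3 3 = U by rewrite (same_var sm3).
apply: wp_seq; apply: wp_conseq (wp_same _ (fill_rows_spec v3_3 v4)) _ => // s4 [sm4 [row4 t4]].
have v2_4 : vars s4 2 = n by rewrite (same_var sm4) // (same_var sm3).
apply: wp_seq; apply: wp_conseq (wp_same _ (fill_sources_spec v2_4)) _ => // s5 [sm5 [src5 t5]].
have rt5 : read_tables ss W s5.
  split.
  - exact: same_input sm5 (same_input sm4 inp3).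
  - by rewrite (same_var sm5).
  - by move=> v hv; rewrite (same_arr sm5) // row4.
  - by move=> i hi; rewrite !(same_arr sm5) // !(same_arr sm4) //; apply: tab.
have z5 a : a \in [:: 0; 7; 8; 9; 10; 11; 12] -> forall i, arr s5 a i = 0.
  rewrite !inE => h i.
  by do 6 (case/orP: h => [/eqP->|h]; first by
    rewrite (same_arr sm5) // (same_arr sm4) // (same_arr sm3) // (same_arr sm2) // (same_arr sm1));
   move/eqP: h => ->; rewrite (same_arr sm5) // (same_arr sm4) // (same_arr sm3) // (same_arr sm2) // (same_arr sm1).
apply: wp_seq; apply: wp_conseq (wp_same _ (fill_bits_spec ltW ltUW rt5 (z5 0 isT) szP)) _ => // s6 [sm6 [bit6 t6]].
have rt6 : read_tables ss W s6 by apply: same_read_tables sm6 _ _ rt5.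
have v3_6 : vars s6 3 = U by rewrite (same_var sm6) // (same_var sm5) // (same_var sm4).
have st6 : static ss W L nm s6.
  split=> //.
  - by case: rt6.
  - by rewrite (same_var sm6) // (same_var sm5) // (same_var sm4).
  - by rewrite (same_var sm6) // (same_var sm5) // (same_var sm4).
  - by case: rt6.
  - by move=> v hv; rewrite (same_arr sm6) // src5.
  - by move=> i hi; rewrite (same_arr sm6) // (same_arr sm5) // (same_arr sm4) // nmA.
apply: wp_seq; apply: wp_conseq (wp_same _ (init_counts_spec ltUW rt6 v3_6)) _ => // s7 [sm7 [cnt7 t7]].
have rt7 : read_tables ss W s7 by apply: same_read_tables sm7 _ _ rt6.
have st7 : static ss W L nm s7 by apply: same_static sm7 _ _ st6.
have z7 a i : a \in [:: 7; 8; 9; 11; 12] -> arr s7 a i = 0.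
  move=> h; rewrite (same_arr sm7) ?(same_arr sm6) ?z5 //;
  by move: h; rewrite !inE => /or4P[|||/orP[]] /eqP->.
have hd7 : heads ss W s7 (fun=> [::]).
  split.
  - by move=> u hu; rewrite z7.
  - by [].
  - by move=> u x hu hx; rewrite z7.
  - by move=> u i hu hi; rewrite cnt7 // -[RHS]/(count predT _) count_predT.
apply: wp_seq; apply: wp_conseq (wp_same _ (init_chains_spec ltW ltUW uniq_ss rt7 st7 hd7 szP)) _ => // s8 [sm8 [hd8 t8]].
have st8 : static ss W L nm s8 by apply: same_static sm8 _ _ st7.
have z8 a i : a \in [:: 11; 12] -> arr s8 a i = 0.
  move=> h; rewrite (same_arr sm8) ?z7 //; by move: h; rewrite !inE => /orP[] /eqP->.
have ou8 : out s8 ss.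
  case: ou1 => o1 o2; split=> [|q hq].
    by rewrite (same_var sm8) // (same_var sm7) // (same_var sm6) // (same_var sm5) // (same_var sm4) // (same_var sm3) // (same_var sm2).
  by rewrite (same_arr sm8) // (same_arr sm7) // (same_arr sm6) // (same_arr sm5) // (same_arr sm4) // (same_arr sm3) // (same_arr sm2) // o2.
have lv8 : level_inv ss W L nm s8 (src ss) [::] 0 0 (fun=> 0).
  by apply: level_inv_init => // i; rewrite z8.
apply: wp_conseq (do_levels_spec uniq_ss ltW ltUW un nm_all nmW szP lv8) _.
move=> s9 [f [A [k [r [st9 inv9 sub9 ou9 [pt9 t9]]]]]].
exists f, A, (fun y => size nm - index y nm), k, r; split=> //.
(* A pointer is at most the length of the chain it runs through, and $n^2$ pointers run through each
   chain. Paying [psi] twice adds 2 U to the 12 U of [Cp], hence the coefficient 14 U. *)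
have psi9 : psi ss W s9 <= U * gam ss f.
  rewrite /psi -/U; apply: (@leq_trans (\sum_(u < U) gam ss f)).
    apply: leq_sum => u _; apply: leq_sum => v _.
    by have [] := pt9 u v (ltn_ord u) (ltn_ord v).
  by rewrite sum_nat_const card_ord.
have D := sum_degree ss un.
have E : size nm <= M.
  rewrite /M -[map size ss]/(shape ss) -size_flatten; apply: uniq_leq_size => // x.
  by rewrite nmE.
have LT : (L + L) * (size nm * (3 * n + 5) + (8 * n + 3) * (\sum_(r0 < size nm) degree ss nm r0) + 4) + 2
    <= levels_time.
  rewrite /levels_time leq_add2r leq_mul2l; apply/orP; right.
  by rewrite leq_add2r leq_add // ?leq_mul2r ?E ?orbT // leq_mul2l D orbT.
move: t9 t8 t7 t6 t5 t4 t3 t2 t1 LT psi9; rewrite /cost_le /setup_time -/n -/U -/M -/L -/N.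
clear; lia.
Qed.

End Algorithm.

(** For positive m, n is at most 2m, which absorbs the monomial $n^2\ell$; bounding $\ell$ by m
    disposes of $n^3\ell$. The factor 1000 is generous. *)
Lemma total_time_bound (n M L T g : nat) (U := n * n) (N := 1 + n + M) :
  L <= M -> n <= M.+1 -> (n = 0 -> M = 0) -> g <= 2 * n * M ->
  T <= 3 * n + 6 +
    (3 * N + 3 + (3 * n + 3) + (9 * M + 9 * n + 6) + (4 * U + 3) +
     (4 * U + 4 * n + 3) + ((3 * L + 4) * n + 2) + ((3 * n + 4) * U + 2) +
     ((L * (4 * n + 8) + 4) * U + 2)) +
    ((L + L) * (M * (3 * n + 5) + (8 * n + 3) * M + 4) + 2) +
    (14 * U + 4 * n + 8 * L + 20) * g +
    (3 * (1 + n + M + (g + U) * (2 * L + 1)) + 2) ->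
  T <= 1000 * (n * M * L + n ^ 3 * M).+1.
Proof.
rewrite /U /N => L_le_M n_le_M M_gt0 hg hT.
(* Without elements n is at most 1 and the time is bounded by a constant, which the successor in the
   bound absorbs. *)
have [M0|Mp] := posnP M.
  have L0 : L = 0 by lia.
  have g0 : g = 0 by move: hg; rewrite M0 muln0; lia.
  rewrite M0 L0 g0 in n_le_M hT *.
  by clear -n_le_M hT; case: n n_le_M hT => [|[|]] // _; lia.
have np : 0 < n by case: (posnP n) => // /M_gt0; lia.
rewrite -[n ^ 3]/(n * (n * n)).
have n2 : n <= 2 * M by lia.
have y2 : n * (n * M) <= n * (n * (n * M)) by rewrite leq_pmull.
have y1 : n * M <= n * (n * M) by rewrite leq_pmull.
have y0 : M <= n * M by rewrite leq_pmull.
have y3 : n * (n * n) <= n * (n * (n * M)) by rewrite !leq_pmul2l // leq_pmulr.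
have y4 : n * n <= n * (n * n) by rewrite leq_pmull.
have y5 : n <= n * n by rewrite leq_pmull.
have x1 : L * M <= n * (L * M) by rewrite leq_pmull.
have x2 : n * L <= n * (L * M) by rewrite leq_pmul2l // leq_pmulr.
have x3 : L <= n * L by rewrite leq_pmull.
have x4 : n * L * n <= n * L * (2 * M) by rewrite leq_mul2l n2 orbT.
have xy := leq_mul L_le_M (leqnn (n * (n * n))).
have g1 : n * n * g <= n * n * (2 * n * M) by rewrite leq_mul2l hg orbT.
have g2 : n * g <= n * (2 * n * M) by rewrite leq_mul2l hg orbT.
have g3 : L * g <= L * (2 * n * M) by rewrite leq_mul2l hg orbT.
clear -hT hg y0 y1 y2 y3 y4 y5 x1 x2 x3 x4 xy g1 g2 g3; lia.
Qed.

(** * The parameters of a family, read off from a list of it *)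

Section Encoding.

Variables (B : {fset {fset nat}}) (ss : seq (seq nat)).
Hypothesis listB : lists_family ss B.

Let sets : seq {fset nat} := [seq fset_of s | s <- ss].

Lemma perm_enum_family : perm_eq (enum_fset B) sets.
Proof.
case: listB => _ us EB; apply: uniq_perm => //.
by move=> X; rewrite {1}EB !inE.
Qed.

Lemma card_fset_of s : uniq s -> #|` fset_of s|%fset = size s.
Proof.
move=> us; have : perm_eq (enum_fset (fset_of s)) s.
  by apply: uniq_perm => // x; rewrite in_fset_of.
exact: perm_size.
Qed.

Lemma card_family : #|` B|%fset = size ss.
Proof. by rewrite -[RHS](size_map (fun s => fset_of s)); apply: perm_size perm_enum_family. Qed.

Lemma total_card_family : total_card B = sumn (map size ss).
Proof.
have [us _ _] := listB; rewrite /total_card (perm_big _ perm_enum_family) big_map sumnE big_map.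
by apply: eq_big_seq => s /(allP us)/card_fset_of.
Qed.

Lemma max_card_family : max_card B = \max_(s <- ss) size s.
Proof.
have [us _ _] := listB; rewrite /max_card (perm_big _ perm_enum_family) big_map.
by apply: eq_big_seq => s /(allP us)/card_fset_of.
Qed.

End Encoding.

Theorem theorem27 :
  exists (prog : program) (C : nat),
    forall (B : {fset {fset nat}}) (ss : seq (seq nat)),
      lists_family ss B ->
      let n := #|` B| in
      let m := total_card B in
      let l := max_card B in
      exists (t : nat) (s : state) (B' : {fset {fset nat}}) (ss' : seq (seq nat)),
        [/\ halts_in prog (init_state ss) t s,
            t <= C * (n * m * l + n ^ 3 * m).+1,
            outputs s ss' /\ lists_family ss' B',
            (B `<=` B')%fset &
            minimal_wg_extension B (span B')].
Proof.
(* The code length bounds the instructions per tick; 1000 is the factor of [total_time_bound]. *)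
exists (ccmd 0 extension_program), (size (ccmd 0 extension_program) * 1000).
move=> B ss listB n m l; have [uniq_ss uniq_sets EB] := listB.
have : wp extension_program (fun s' => exists f A rank k r,
    [/\ chain_inv ss rank f A k r,
        forall u, u < size ss * size ss -> {subset tgt ss u <= f u},
        vars s' 0 = 0 /\ (forall q, q < size (encode (ss ++ A)) ->
          memory s' q = nth 0 (encode (ss ++ A)) q) &
        clock s' <= 3 * size ss + 6 + setup_time ss + levels_time ss +
          (14 * (size ss * size ss) + 4 * size ss + 8 * (\max_(s <- ss) size s) + 20) * gam ss f +
          (3 * size (encode (ss ++ A)) + 2)])
    (CState (fun=> 0) (nth 0 (encode ss)) 0).
  apply: wp_seq; apply: wp_conseq (find_base_spec ss) _ => s1 [inp1 v2 v0 z t1].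
  apply: wp_seq.
  apply: wp_conseq (wp_same _ (extend_spec uniq_ss inp1 v2 z)) _ => //.
  move=> s2 [sm2 [f [A [rank [k [r [inv sub ou t2]]]]]]].
  have v0' : vars s2 0 = 0 by rewrite (same_var sm2).
  apply: wp_conseq (compact_spec ou v0') _ => s3 [v0'' [m3 t3]].
  by exists f, A, rank, k, r; split=> //; move: t1 t2 t3; clear; lia.
case=> s' hrun [f [A [rank [k [r [inv sub [v0 mem3] time]]]]]].
have [t [ms [halt ht r0 cm]]] := compiled_run hrun.
have usets : uniq [seq fset_of s | s <- ss] := uniq_sets.
have EB' : B = family ss by [].
have uss : uniq ss by apply: map_uniq usets.
exists t, ms, (family (ss ++ A)), (ss ++ A); split=> //.
- apply: (leq_trans ht); rewrite -mulnA leq_mul2l; apply/orP; right.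
  rewrite /n /m /l (card_family listB) (total_card_family listB) (max_card_family listB).
  apply: (total_time_bound _ _ _ (gam_le inv)) => //.
  + exact: max_le_sum.
  + exact: size_le_sum.
  + by move/size0nil => ->.
  + apply: (leq_trans time); rewrite /setup_time /levels_time.
    have := size_out inv uniq_ss usets.
    have -> : size (encode ss) = 1 + size ss + sumn (map size ss).
      rewrite /encode /= size_flatten /shape -map_comp.
      by elim: (ss) => //= s t'; lia.
    by clear; lia.
- split; last exact: final_lists inv usets.
  by move=> i hi; rewrite r0 v0 add0n cm mem3.
- rewrite EB'; apply/fsubsetP => X /familyP[g gss ->]; apply: mem_family.
  by rewrite mem_cat gss.
- by rewrite EB'; apply: final_minimal inv sub.
Qed.
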